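(* Let $L,V\ge1$ be integers, $M\ge1$, and let $K_1,\ldots,K_V$ be nonempty subsets of $[L]$. For every $T\ge1$, $$\Delta_{L,V,M}(T)\le\frac{(2^L-2)M}{\sqrt T},$$ where $$\Delta_{L,V,M}(T)=\sup_{\substack{D\ge1,\ A_0,\ldots,A_V\in M_D(\mathbb C)_{\rm sa}\\ \Lambda(A)\le M}}\bigl|\|\mathcal P_A(s^{(T)})\|-\|\mathcal P_A(x^\Gamma)\|\bigr|.$$ Consequently, $\Delta_{L,V,M}(T)\to0$ as $T\to\infty$.
   Context: $[L]=\{1,\dots,L\}$. For $A_0,\dots,A_V\in M_D(\mathbb C)_{\rm sa}$ (self-adjoint), $\mathcal P_A(x)=A_0\otimes1+\sum_{v=1}^VA_v\otimes x_v$ and $\Lambda(A)=\sum_{v=0}^V\|A_v\|$. Norms are in minimal tensor products. $\Gamma$ is the graph on $[V]$ in which distinct $v,w$ are adjacent iff $K_v\cap K_w=\varnothing$. $x^\Gamma=(x_1^\Gamma,\dots,x_V^\Gamma)$ is the graph-product semicircular family: $x_v^\Gamma=\ell_v+\ell_v^*$ on $\ell^2(\mathcal A_\Gamma^+)$, where $\mathcal A^+_\Gamma$ is the right-angled Artin monoid generated by $[V]$ with $uv=vu$ for adjacent $u,v$, and $\ell_v\delta_w=\delta_{vw}$. Limiting Hayes model: for each $j\in[L]$, $(s_{v,t,j})_{v\in[V],t\in[T]}$ is a free family of standard semicircular variables in a reduced (faithful trace) $C^*$-probability space $\mathcal B_j$, and everything is placed in the minimal tensor product $\mathcal B_1\otimes\cdots\otimes\mathcal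 B_L$, with $s_{v,t,j}$ in the $j$-th leg. Then $s_v^{(T)}=\frac1{\sqrt T}\sum_{t=1}^T\bigl(\bigotimes_{j\in K_v}s_{v,t,j}\bigr)\otimes1$, where $1$ is the unit on the legs $j\notin K_v$, and $s^{(T)}=(s_1^{(T)},\dots,s_V^{(T)})$. *)

(* Defs.v *)
From HB Require Import structures.
From mathcomp Require Import all_boot all_order all_algebra.
From mathcomp Require Import generic_quotient complex.
From mathcomp Require Import all_classical all_reals all_analysis.

Set Implicit Arguments.
Unset Strict Implicit.
Unset Printing Implicit Defensive.

Import Order.TTheory GRing.Theory Num.Theory.
Import numFieldNormedType.Exports.

Local Open Scope classical_set_scope.
Local Open Scope complex_scope.
Local Open Scope ring_scope.

(* The inner product is linear in its first argument. *)
Record hilbert (R : realType) := Hilbert {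
  hsort :> completeNormedModType R[i];
  hdot : {dot hsort for @Num.conj R[i]};
  hdotE : forall x : hsort, hdot x x = `|x| ^+ 2 }.

(* The library's norms on complex vector spaces take values in [R[i]]. *)
Definition rnorm (R : realType) (E : normedZmodType R[i]) (x : E) : R :=
  complex.Re `|x|.

Definition op_norm (R : realType) (E : Type) (nrm : E -> R) (P : E -> E) : R :=
  sup [set nrm (P x) | x in [set x | nrm x <= 1]].

Definition bounded_op (R : realType) (H : hilbert R) (S : H -> H) : Prop :=
  linear S /\ exists c : R, forall x, rnorm (S x) <= c * rnorm x.

Definition is_adjoint (R : realType) (H : hilbert R) (S S' : H -> H) : Prop :=
  forall x y, hdot H (S x) y = hdot H x (S' y).

Definition lin_span (R : realType) (H : hilbert R) (J : Type) (f : J -> H) :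
    set H :=
  [set x | exists (n : nat) (c : 'I_n -> R[i]) (e : 'I_n -> J),
             x = \sum_(i < n) c i *: f (e i)].

(* A unital C*-algebra of operators on [cs_space] with a faithful tracial
   state; the values of [cs_tr] outside [cs_alg] are irrelevant. *)
Record cstar_prob (R : realType) := CstarProb {
  cs_space : hilbert R;
  cs_alg : set (cs_space -> cs_space);
  cs_tr : (cs_space -> cs_space) -> R[i];
  cs_bounded : forall a, cs_alg a -> bounded_op a;
  cs_unit : cs_alg idfun;
  cs_lin : forall (k : R[i]) a b, cs_alg a -> cs_alg b ->
    cs_alg (fun x => k *: a x + b x);
  cs_mul : forall a b, cs_alg a -> cs_alg b -> cs_alg (a \o b);
  cs_star : forall a, cs_alg a -> exists2 a', cs_alg a' & is_adjoint a a';
  cs_closed : forall a, bounded_op a ->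
    (forall e : R, 0 < e -> exists2 b, cs_alg b &
       op_norm (@rnorm R cs_space) (fun x => a x - b x) < e) ->
    cs_alg a;
  cs_tr_lin : forall (k : R[i]) a b, cs_alg a -> cs_alg b ->
    cs_tr (fun x => k *: a x + b x) = k * cs_tr a + cs_tr b;
  cs_tr_unit : cs_tr idfun = 1;
  cs_tr_pos : forall a a', cs_alg a -> cs_alg a' -> is_adjoint a a' ->
    0 <= cs_tr (a' \o a);
  cs_tr_faithful : forall a a', cs_alg a -> cs_alg a' -> is_adjoint a a' ->
    cs_tr (a' \o a) = 0 -> forall x, a x = 0;
  cs_tr_tracial : forall a b, cs_alg a -> cs_alg b ->
    cs_tr (a \o b) = cs_tr (b \o a) }.

Arguments cs_alg {R} c _.
Arguments cs_tr {R} c _.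

Definition semicircle_moment (R : realType) (n : nat) : R :=
  (2 * pi)^-1 *
  \int[@lebesgue_measure R]_(t in `[-2, 2]) (t ^+ n * Num.sqrt (4 - t ^+ 2)).

Definition standard_semicircular (R : realType) (B : cstar_prob R)
    (s : cs_space B -> cs_space B) : Prop :=
  [/\ cs_alg B s, is_adjoint s s &
      forall n, cs_tr B (iter n s) = (semicircle_moment R n)%:C].

Definition op_horner (R : realType) (H : hilbert R) (s : H -> H)
    (p : {poly R[i]}) : H -> H :=
  fun x => \sum_(k < size p) p`_k *: iter k s x.

(* Freeness of the unital algebras generated by the [s j]: alternating products
   of centred elements are centred. Meant for self-adjoint [s j], for which
   these are also the unital *-algebras generated by the [s j]. *)
Definition free_family (R : realType) (B : cstar_prob R) (J : eqType)
    (s : J -> cs_space B -> cs_space B) : Prop :=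
  forall w : seq (J * {poly R[i]}), w != [::] ->
    sorted (fun a b => a.1 != b.1) w ->
    (forall a, a \in w -> cs_tr B (op_horner (s a.1) a.2) = 0) ->
    cs_tr B (foldr (fun a S => op_horner (s a.1) a.2 \o S) idfun w) = 0.

(* The Hilbert space tensor product of the [H j], which these properties
   determine up to a unitary preserving elementary tensors; [ht_dot] implies
   that [ht_tens] is multilinear. The minimal tensor product of C*-algebras of
   operators on the [H j] carries the operator norm of [ht_space]. *)
Record hilbert_tensor (R : realType) (L : nat) (H : 'I_L -> hilbert R) :=
    HilbertTensor {
  ht_space : hilbert R;
  ht_tens : (forall j, H j) -> ht_space;
  ht_dot : forall f g,
    hdot ht_space (ht_tens f) (ht_tens g) = \prod_j hdot (H j) (f j) (g j);
  ht_total : dense (lin_span ht_tens) }.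

Arguments ht_tens {R L H} h _.

Definition is_tensor_op (R : realType) (L : nat) (H : 'I_L -> hilbert R)
    (W : hilbert_tensor H) (a : forall j, H j -> H j)
    (X : ht_space W -> ht_space W) : Prop :=
  bounded_op X /\
  forall f, X (ht_tens W f) = ht_tens W (fun j => a j (f j)).

Record hayes_model (R : realType) (L V T : nat) (K : 'I_V -> {set 'I_L}) :=
    HayesModel {
  hm_B : 'I_L -> cstar_prob R;
  hm_W : hilbert_tensor (fun j => cs_space (hm_B j));
  hm_s : 'I_V -> 'I_T -> forall j, cs_space (hm_B j) -> cs_space (hm_B j);
  hm_semicircular : forall v t j, standard_semicircular (hm_s v t (j := j));
  hm_free : forall j,
    free_family (fun vt : 'I_V * 'I_T => hm_s vt.1 vt.2 (j := j));
  hm_term : 'I_V -> 'I_T -> ht_space hm_W -> ht_space hm_W;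
  hm_termP : forall v t,
    is_tensor_op (fun j => if j \in K v then hm_s v t (j := j) else idfun)
      (hm_term v t) }.

Arguments hm_s {R L V T K} h v t {j} _.
Arguments hm_term {R L V T K} h v t _.

Definition hayes_op (R : realType) (L V T : nat) (K : 'I_V -> {set 'I_L})
    (S : hayes_model R T K) (v : 'I_V) :
    ht_space (hm_W S) -> ht_space (hm_W S) :=
  fun x => ((Num.sqrt T%:R)^-1)%:C *: \sum_(t < T) hm_term S v t x.

Arguments hayes_op {R L V T K} S v _.

Definition hayes_graph (L V : nat) (K : 'I_V -> {set 'I_L}) : rel 'I_V :=
  fun v w => (v != w) && [disjoint K v & K w].

Section RightAngledArtinMonoid.
Variables (I : choiceType) (adj : rel I).

Inductive raam_cong : seq I -> seq I -> Prop :=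
| raam_refl u : raam_cong u u
| raam_sym u w : raam_cong u w -> raam_cong w u
| raam_trans u w z : raam_cong u w -> raam_cong w z -> raam_cong u z
| raam_comm a b : adj a b -> raam_cong [:: a; b] [:: b; a]
| raam_cat u u' w w' :
    raam_cong u u' -> raam_cong w w' -> raam_cong (u ++ w) (u' ++ w').

Definition raam_rel : rel (seq I) := fun u w => `[< raam_cong u w >].

Lemma raam_rel_refl : reflexive raam_rel.
Proof. by move=> u; apply/asboolP; exact: raam_refl. Qed.

Lemma raam_rel_sym : symmetric raam_rel.
Proof. by move=> u w; apply/asboolP/asboolP; exact: raam_sym. Qed.

Lemma raam_rel_trans : transitive raam_rel.
Proof.
by move=> w u z /asboolP uw /asboolP wz; apply/asboolP; exact: raam_trans uw wz.
Qed.

Canonical raam_equiv :=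
  EquivRel raam_rel raam_rel_refl raam_rel_sym raam_rel_trans.

Definition raam := {eq_quot raam_rel}%qT.
HB.instance Definition _ := Choice.on raam.

Definition raam_word (u : seq I) : raam := \pi_raam%qT u.
Definition raam_gen (a : I) : raam := raam_word [:: a].
Definition raam_one : raam := raam_word [::].
Definition raam_mul (g h : raam) : raam :=
  raam_word (repr g ++ repr h)%qT.

Lemma raam_wordP u w : raam_word u = raam_word w <-> raam_cong u w.
Proof.
split=> [|uw]; first by move/eqquotP/asboolP.
by apply/eqquotP/asboolP.
Qed.

Lemma raam_wordK (g : raam) : raam_word (repr g)%qT = g.
Proof. exact: reprK. Qed.

Lemma raam_repr u : raam_cong (repr (raam_word u))%qT u.
Proof. by apply/raam_wordP; rewrite raam_wordK. Qed.

Lemma raam_mul_word u w :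
  raam_mul (raam_word u) (raam_word w) = raam_word (u ++ w).
Proof. by apply/raam_wordP; apply: raam_cat; exact: raam_repr. Qed.

Lemma raam_mulA : associative raam_mul.
Proof.
move=> g h k; rewrite -(raam_wordK g) -(raam_wordK h) -(raam_wordK k).
by rewrite !raam_mul_word catA.
Qed.

Lemma raam_mul1 : left_id raam_one raam_mul.
Proof. by move=> g; rewrite -(raam_wordK g) raam_mul_word. Qed.

Lemma raam_mulr1 : right_id raam_one raam_mul.
Proof. by move=> g; rewrite -(raam_wordK g) raam_mul_word cats0. Qed.

HB.instance Definition _ :=
  isMonoid.Build raam raam_mulA raam_mul1 raam_mulr1.

End RightAngledArtinMonoid.

(* [l2_space] is l^2(X), i.e. a Hilbert space with an orthonormal basis indexed
   by X, which is determined up to unitary isomorphism. *)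
Record l2 (R : realType) (X : eqType) := L2 {
  l2_space :> hilbert R;
  l2_delta : X -> l2_space;
  l2_orthonormal : forall x y,
    hdot l2_space (l2_delta x) (l2_delta y) = (x == y)%:R;
  l2_total : dense (lin_span l2_delta) }.

Arguments l2_delta {R X} l _.

Record graph_fock (R : realType) (V : nat) (adj : rel 'I_V) := GraphFock {
  gf_space : l2 R (raam adj);
  gf_l : 'I_V -> gf_space -> gf_space;
  gf_l_star : 'I_V -> gf_space -> gf_space;
  gf_l_bounded : forall v, bounded_op (gf_l v);
  gf_l_star_bounded : forall v, bounded_op (gf_l_star v);
  gf_l_delta : forall v (g : raam adj),
    gf_l v (l2_delta gf_space g) = l2_delta gf_space (raam_gen adj v * g)%g;
  gf_adjoint : forall v, is_adjoint (gf_l v) (gf_l_star v) }.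

Arguments gf_l {R V adj} _ v _.
Arguments gf_l_star {R V adj} _ v _.

Definition graph_op (R : realType) (V : nat) (adj : rel 'I_V)
    (G : graph_fock R adj) (v : 'I_V) : gf_space G -> gf_space G :=
  fun x => gf_l G v x + gf_l_star G v x.

Arguments graph_op {R V adj} G v _.

(* The norm of E^D, for E = C or E a Hilbert space. *)
Definition tuple_norm (R : realType) (E : normedZmodType R[i]) (D : nat)
    (xi : 'I_D -> E) : R :=
  Num.sqrt (\sum_(i < D) rnorm (xi i) ^+ 2).

Definition mx_op_norm (R : realType) (D : nat) (A : 'M[R[i]]_D) : R :=
  op_norm (@tuple_norm R R[i] D)
    (fun (z : 'I_D -> R[i]) i => \sum_(k < D) A i k * z k).

(* The coefficients [A_0, A_1, .., A_V] are [A ord0] and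
   [A (lift ord0 v)] for [v : 'I_V]. *)
Definition Lambda (R : realType) (V D : nat) (A : 'I_V.+1 -> 'M[R[i]]_D) : R :=
  \sum_(v < V.+1) mx_op_norm (A v).

(* The operator [A_0 (x) 1 + \sum_v A_v (x) x_v] on H^D = C^D (x) H. *)
Definition pencil (R : realType) (H : hilbert R) (V D : nat)
    (A : 'I_V.+1 -> 'M[R[i]]_D) (x : 'I_V -> H -> H) :
    ('I_D -> H) -> 'I_D -> H :=
  fun xi i => \sum_(k < D) A ord0 i k *: xi k +
    \sum_(v < V) \sum_(k < D) A (lift ord0 v) i k *: x v (xi k).

Definition pencil_norm (R : realType) (H : hilbert R) (V D : nat)
    (A : 'I_V.+1 -> 'M[R[i]]_D) (x : 'I_V -> H -> H) : R :=
  op_norm (@tuple_norm R H D) (pencil A x).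

Definition Delta (R : realType) (L V T : nat) (K : 'I_V -> {set 'I_L}) (M : R)
    (S : hayes_model R T K) (G : graph_fock R (hayes_graph K)) : \bar R :=
  ereal_sup [set r | exists (D : nat) (A : 'I_V.+1 -> 'M[R[i]]_D),
    [/\ (0 < D)%N, forall v, A v \is hermsymmx, Lambda A <= M &
        r = (`|pencil_norm A (hayes_op S) - pencil_norm A (graph_op G)|)%:E]].

(* Main.v *)
(* Positivity of a hermitian matrix of polynomials in a free semicircular family
   s_i of a faithful C*-probability space is the same on H^n as for l_i + l_i^*
   on the full Fock space: from H^n to Fock space because the trace is
   nonnegative on positive operators; back because, for Z self-adjoint and N =
   |Z| - Z, which is a norm limit of matrices of polynomials, N Z N = - N |Z| N,
   so that positivity on Fock space and faithfulness force |Z|^(1/2) N = 0,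
   whence N = 0 and Z = |Z|. Applied to the legs one at a time, this leaves the
   norms of the pencils unchanged when every B_j is replaced by a full Fock
   space. There the tensor product over K_v of the l + l^* expands into the
   creation term, the annihilation term and 2^|K_v| - 2 mixed terms. After
   summation over t the mixed terms have norm at most 1 before the factor
   T^(-1/2), because their partial injections for distinct t have disjoint
   domains and disjoint ranges; this gives the rate. The creation terms L_v are
   isometries which commute when K_v and K_w are disjoint and have orthogonal
   ranges otherwise. By the Wold decomposition they are a multiple of the
   isometries of the graph product, so that the pencil of the L_v + L_v^* has
   exactly the norm of the pencil of x^Gamma. *)

Require Import Defs.
From HB Require Import structures.
From mathcomp Require Import all_boot all_order all_algebra.
From mathcomp Require Import complex.
From mathcomp Require Import zify ring lra.
From mathcomp Require Import all_classical all_reals all_analysis.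

Set Implicit Arguments.
Unset Strict Implicit.
Unset Printing Implicit Defensive.

Import Order.TTheory GRing.Theory Num.Theory.
Import numFieldNormedType.Exports.

Local Open Scope classical_set_scope.
Local Open Scope ring_scope.

Notation "x %:RC" := (real_complex _ x) (at level 1, format "x %:RC") : ring_scope.

(** The Fock spaces are never completed: they consist of finitely supported functions, and every
    term of the expansion acts by a partial injection of the basis. Hence [ips], with completeness
    asked only where square roots are extracted. A bound ||P xi|| <= c ||xi|| is read as positivity
    of c^2 <xi, xi> - <P xi, P xi>. When the coefficients of xi on n elementary tensors are fixed
    and the tensors vary, this is a sum of scalars times products over the legs; freezing all legs
    but one leaves a Hermitian n x n matrix of polynomials in that leg. This is why positivity of
    matrices, and not a norm, is what passes through a single leg. Operator norms come back at the
    end, through bounds valid for arbitrary c >= 0. In place of functional calculus, |Z| and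
    |Z|^(1/2) are limits of an explicit iteration with polynomial iterates and rate 2 / (k + 2). The
    rate yields membership in the algebra and commutation, and carries positivity from polynomial
    columns to those of N. The factor 2^L - 2 bounds the number of nonempty proper subsets of K_v,
    one for each mixed term. *)

Record ips (R : realType) := Ips {
  ips_sort :> lmodType R[i];
  ip : ips_sort -> ips_sort -> R[i];
  ip_lin : forall k x y z, ip (k *: x + y) z = k * ip x z + ip y z;
  ip_conj : forall x y, ip y x = (ip x y)^*;
  ip_ge0 : forall x, 0 <= ip x x;
  ip_eq0 : forall x, ip x x = 0 -> x = 0 }.

Arguments ip {R i} _ _.
Arguments Ips {R}.

(** * Inner product spaces *)

Section InnerProduct.
Variables (R : realType) (E : ips R).
Implicit Types (x y z : E) (k : R[i]).

Lemma ipDl x y z : ip (x + y) z = ip x z + ip y z.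
Proof. by rewrite -{1}(scale1r x) ip_lin mul1r. Qed.

Lemma ip0l z : ip 0 z = 0 :> R[i].
Proof. by apply: (addrI (ip (0 : E) z)); rewrite -ipDl !addr0. Qed.

Lemma ipZl k x z : ip (k *: x) z = k * ip x z.
Proof. by rewrite -[k *: x]addr0 ip_lin ip0l addr0. Qed.

Lemma ipDr x y z : ip z (x + y) = ip z x + ip z y.
Proof. by rewrite ip_conj ipDl rmorphD /= -!ip_conj. Qed.

Lemma ip0r z : ip z 0 = 0 :> R[i].
Proof. by rewrite ip_conj ip0l rmorph0. Qed.

Lemma ipZr k x z : ip z (k *: x) = k^* * ip z x.
Proof. by rewrite ip_conj ipZl rmorphM /= -ip_conj. Qed.

Lemma ipNl x z : ip (- x) z = - ip x z.
Proof. by rewrite -scaleN1r ipZl mulN1r. Qed.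

Lemma ipNr x z : ip z (- x) = - ip z x.
Proof. by rewrite -scaleN1r ipZr rmorphN1 mulN1r. Qed.

Lemma ipBl x y z : ip (x - y) z = ip x z - ip y z.
Proof. by rewrite ipDl ipNl. Qed.

Lemma ipBr x y z : ip z (x - y) = ip z x - ip z y.
Proof. by rewrite ipDr ipNr. Qed.

Lemma ip_suml (I : Type) (r : seq I) (P : pred I) (F : I -> E) z :
  ip (\sum_(i <- r | P i) F i) z = \sum_(i <- r | P i) ip (F i) z.
Proof.
by apply: (big_morph (fun x => ip x z)) => [x y|]; rewrite ?ipDl ?ip0l.
Qed.

Lemma ip_sumr (I : Type) (r : seq I) (P : pred I) (F : I -> E) z :
  ip z (\sum_(i <- r | P i) F i) = \sum_(i <- r | P i) ip z (F i).
Proof.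
by apply: (big_morph (fun x => ip z x)) => [x y|]; rewrite ?ipDr ?ip0r.
Qed.

Lemma ip_ext x y : (forall z, ip x z = ip y z) -> x = y.
Proof.
by move=> xy; apply/subr0_eq/ip_eq0; rewrite ipBl xy subrr.
Qed.

Lemma ip_real x : ip x x \is Num.real.
Proof. exact/ger0_real/ip_ge0. Qed.

Definition nrm x : R := Num.sqrt (complex.Re (ip x x)).

Lemma nrm_ge0 x : 0 <= nrm x. Proof. exact: sqrtr_ge0. Qed.

Lemma Re_ip_ge0 x : 0 <= complex.Re (ip x x).
Proof. by have := ip_ge0 x; rewrite lecE => /andP[]. Qed.

Lemma sqr_nrm x : nrm x ^+ 2 = complex.Re (ip x x).
Proof. by rewrite sqr_sqrtr ?Re_ip_ge0. Qed.

Lemma ip_nrm x : ip x x = (nrm x ^+ 2)%:RC.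
Proof. by rewrite sqr_nrm RRe_real ?ip_real. Qed.

Lemma nrm0 : nrm 0 = 0.
Proof. by rewrite /nrm ip0l sqrtr0. Qed.

Lemma nrm_eq0 x : nrm x = 0 -> x = 0.
Proof. by move=> x0; apply: ip_eq0; rewrite ip_nrm x0 expr0n. Qed.

Lemma Re_normE k : `|k| = (complex.Re `|k|)%:RC.
Proof. by rewrite RRe_real ?normr_real. Qed.

Lemma Re_norm_ge0 k : 0 <= complex.Re `|k|.
Proof. by have := normr_ge0 k; rewrite lecE => /andP[]. Qed.

Lemma nrmZ k x : nrm (k *: x) = complex.Re `|k| * nrm x.
Proof.
rewrite /nrm ipZl ipZr mulrA -normCK ip_nrm Re_normE -rmorphXn -rmorphM /=.
by rewrite sqrtrM ?sqr_ge0// !sqrtr_sqr !ger0_norm ?nrm_ge0 ?Re_norm_ge0.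
Qed.

Lemma nrmN x : nrm (- x) = nrm x.
Proof. by rewrite /nrm ipNl ipNr opprK. Qed.

Lemma nrmB x y : nrm (x - y) = nrm (y - x).
Proof. by rewrite -nrmN opprB. Qed.

Lemma nrmZr (r : R) x : nrm (r%:RC *: x) = `|r| * nrm x.
Proof. by rewrite nrmZ normc_def /= expr0n addr0 sqrtr_sqr. Qed.

Lemma Re_conj (z : R[i]) : complex.Re z^* = complex.Re z.
Proof. by case: z. Qed.

Lemma sqr_nrmD x y :
  nrm (x + y) ^+ 2 = nrm x ^+ 2 + 2 * complex.Re (ip x y) + nrm y ^+ 2.
Proof.
rewrite !sqr_nrm ipDl !ipDr !raddfD /= (ip_conj x y) Re_conj; ring.
Qed.

Lemma Re_ip_le x y : complex.Re (ip x y) <= nrm x * nrm y.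
Proof.
have key (t : R) : 0 <= nrm x ^+ 2 + 2 * t * complex.Re (ip x y) + t ^+ 2 * nrm y ^+ 2.
  have := sqr_ge0 (nrm (x + t%:RC *: y)).
  rewrite sqr_nrmD nrmZr exprMn real_normK ?num_real// ipZr.
  suff -> : complex.Re (t%:RC^* * ip x y) = t * complex.Re (ip x y) by rewrite mulrA.
  by case: (ip x y) => a b /=; rewrite oppr0 mul0r subr0.
have [/eqP y0|y0] := boolP (nrm y == 0).
  by move: y0 => /nrm_eq0 ->; rewrite nrm0 mulr0 ip0r.
have y_gt0 : 0 < nrm y by rewrite lt_neqAle eq_sym y0 nrm_ge0.
have [/eqP x0|x0] := boolP (nrm x == 0).
  by move: x0 => /nrm_eq0 ->; rewrite nrm0 mul0r ip0l.
have x_gt0 : 0 < nrm x by rewrite lt_neqAle eq_sym x0 nrm_ge0.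
(* For this value the two square terms coincide, and the quadratic factors as a positive multiple of
   the claim. *)
have := key (- (nrm x / nrm y)).
have -> : nrm x ^+ 2 + 2 * - (nrm x / nrm y) * complex.Re (ip x y) +
   (- (nrm x / nrm y)) ^+ 2 * nrm y ^+ 2 =
   2 * (nrm x / nrm y) * (nrm x * nrm y - complex.Re (ip x y)) by field.
by rewrite pmulr_rge0 ?subr_ge0// mulr_gt0// divr_gt0.
Qed.

Lemma nrm_triangle x y : nrm (x + y) <= nrm x + nrm y.
Proof.
rewrite -(ler_pXn2r (n := 2)) ?nnegrE ?nrm_ge0 ?addr_ge0 ?nrm_ge0//.
rewrite sqr_nrmD sqrrD; have := Re_ip_le x y; lra.
Qed.

Lemma nrm_sum (I : Type) (r : seq I) (P : pred I) (F : I -> E) :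
  nrm (\sum_(i <- r | P i) F i) <= \sum_(i <- r | P i) nrm (F i).
Proof.
elim/big_rec2: _ => [|i a b _ ab]; first by rewrite nrm0.
by apply: le_trans (nrm_triangle _ _) _; rewrite lerD2l.
Qed.

Definition bnd_by (c : R) (a : E -> E) := forall x, nrm (a x) <= c * nrm x.

Definition adjoint_pair (a a' : E -> E) := forall x y, ip (a x) y = ip x (a' y).

Lemma adjoint_pair_sym a a' : adjoint_pair a a' -> adjoint_pair a' a.
Proof. by move=> aa' x y; rewrite ip_conj -aa' -ip_conj. Qed.

Lemma adjoint_pair_comp a a' b b' : adjoint_pair a a' -> adjoint_pair b b' ->
  adjoint_pair (a \o b) (b' \o a').
Proof. by move=> aa' bb' x y /=; rewrite aa' bb'. Qed.

Lemma adjoint_pair_lin a a' b b' k : adjoint_pair a a' -> adjoint_pair b b' ->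
  adjoint_pair (fun x => k *: a x + b x) (fun x => k^* *: a' x + b' x).
Proof. by move=> aa' bb' x y; rewrite ip_lin ipDr ipZr conjCK aa' bb'. Qed.

Lemma adjoint_unique a a1 a2 :
  adjoint_pair a a1 -> adjoint_pair a a2 -> a1 =1 a2.
Proof.
move=> h1 h2 x; apply: ip_ext => z.
by rewrite ip_conj -h1 h2 -ip_conj.
Qed.

Lemma linB (F : lmodType R[i]) (a : E -> F) (l : linear a) (x y : E) : a (x - y) = a x - a y.
Proof. by rewrite addrC -scaleN1r l scaleN1r addrC. Qed.

Lemma lin0 (F : lmodType R[i]) (a : E -> F) (l : linear a) : a 0 = 0.
Proof. by rewrite -[X in a X](subrr 0) (linB l) subrr. Qed.

Lemma linD (F : lmodType R[i]) (a : E -> F) (l : linear a) (x y : E) : a (x + y) = a x + a y.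
Proof. by rewrite -[x in LHS]scale1r l scale1r. Qed.

Lemma linZ (F : lmodType R[i]) (a : E -> F) (l : linear a) k (x : E) : a (k *: x) = k *: a x.
Proof. by rewrite -[_ *: x]addr0 l (lin0 l) addr0. Qed.

Lemma lin_sum (F : lmodType R[i]) (a : E -> F) (l : linear a) (I : Type) (r : seq I) (P : pred I) (x : I -> E) :
  a (\sum_(i <- r | P i) x i) = \sum_(i <- r | P i) a (x i).
Proof. by apply: (big_morph a) => [u v|]; [exact: linD|exact: lin0]. Qed.

Lemma adjoint_linear a a' : adjoint_pair a a' -> linear a'.
Proof.
move=> aa' k x y; apply: ip_ext => z.
rewrite ip_lin !(adjoint_pair_sym aa') ip_lin //.
Qed.

End InnerProduct.

(** * Hilbert spaces and tuples of vectors *)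

Section Instances.
Variable R : realType.

Section Hilbert.
Variable H : hilbert R.
Let C := R[i].

Fact hdot_lin (k : R[i]) (x y z : H) :
  hdot H (k *: x + y) z = k * hdot H x z + hdot H y z.
Proof. by rewrite linearDl /= linearZl_LR. Qed.
Fact hdot_conj (x y : H) : hdot H y x = (hdot H x y)^*.
Proof. by rewrite hermC expr0 mul1r. Qed.
Fact hdot_ge0 (x : H) : 0 <= hdot H x x.
Proof. by rewrite hdotE exprn_ge0. Qed.
Fact hdot_eq0 (x : H) : hdot H x x = 0 -> x = 0.
Proof. by rewrite hdotE => /eqP; rewrite expf_eq0 /= normr_eq0 => /eqP. Qed.

Definition ips_hilbert : ips R :=
  Ips H (hdot H) hdot_lin hdot_conj hdot_ge0 hdot_eq0.

Lemma nrm_hilbert (x : H) : @nrm R ips_hilbert x = rnorm x.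
Proof.
rewrite /nrm /= hdotE /rnorm.
have kE : `|x| = (complex.Re `|x|)%:RC by rewrite RRe_real ?normr_real.
have k0 : 0 <= complex.Re `|x| by have := normr_ge0 x; rewrite lecE => /andP[].
by rewrite kE -rmorphXn /= sqrtr_sqr ger0_norm.
Qed.
End Hilbert.

Section Tuple.
Variables (E : ips R) (n : nat).

Definition tip (x y : 'I_n -> E) : R[i] := \sum_i ip (x i) (y i).

Fact tip_lin (k : R[i]) (x y z : 'I_n -> E) :
  tip (k *: x + y) z = k * tip x z + tip y z.
Proof.
rewrite /tip mulr_sumr -big_split /=; apply: eq_bigr => i _.
by rewrite -ip_lin.
Qed.
Fact tip_conj (x y : 'I_n -> E) : tip y x = (tip x y)^*.
Proof. by rewrite /tip rmorph_sum; apply: eq_bigr => i _; rewrite ip_conj. Qed.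
Fact tip_ge0 (x : 'I_n -> E) : 0 <= tip x x.
Proof. by apply: sumr_ge0 => i _; exact: ip_ge0. Qed.
Fact tip_eq0 (x : 'I_n -> E) : tip x x = 0 -> x = 0.
Proof.
move=> /eqP; rewrite /tip psumr_eq0; last by move=> i _; exact: ip_ge0.
move=> /allP x0; apply/funext => i; apply: ip_eq0; apply/eqP.
by apply: x0; rewrite mem_index_enum.
Qed.

Definition ips_tuple : ips R :=
  Ips ('I_n -> E) tip tip_lin tip_conj tip_ge0 tip_eq0.

Lemma sqr_nrm_tuple (x : ips_tuple) : nrm x ^+ 2 = \sum_i nrm (x i) ^+ 2.
Proof.
rewrite sqr_nrm /= /tip raddf_sum /=.
by apply: eq_bigr => i _; rewrite sqr_nrm.
Qed.

Lemma nrm_tuple (x : ips_tuple) : nrm x = Num.sqrt (\sum_i nrm (x i) ^+ 2).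
Proof. by rewrite -sqr_nrm_tuple sqrtr_sqr ger0_norm ?nrm_ge0. Qed.

Lemma nrm_tuple_ge (x : ips_tuple) i : nrm (x i) <= nrm x.
Proof.
rewrite -(ler_pXn2r (n := 2)) ?nnegrE ?nrm_ge0// sqr_nrm_tuple (bigD1 i)//=.
by rewrite lerDl; apply: sumr_ge0 => j _; exact: sqr_ge0.
Qed.

Lemma nrm_tuple_le (x : ips_tuple) : nrm x <= \sum_i nrm (x i).
Proof.
rewrite -(ler_pXn2r (n := 2)) ?nnegrE ?nrm_ge0//; last first.
  by apply: sumr_ge0 => i _; exact: nrm_ge0.
rewrite sqr_nrm_tuple.
suff [] : \sum_i nrm (x i) ^+ 2 <= (\sum_i nrm (x i)) ^+ 2 /\ 0 <= \sum_i nrm (x i) by [].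
elim/big_rec2: _ => [|i a b _ [ab a0]]; first by rewrite expr0n.
by have n0 := nrm_ge0 (x i); split; nra.
Qed.

End Tuple.
End Instances.

Section Completeness.
Variable R : realType.

Lemma norm_ip_le (E : ips R) (x y : E) : `|ip x y| <= (nrm x * nrm y)%:RC.
Proof.
have [->|a0] := eqVneq (ip x y) 0; first by rewrite normr0 ler0c mulr_ge0 ?nrm_ge0.
set a := ip x y in a0 *.
(* Scaling [x] by the conjugate of [a] turns the inner product into |a|^2, which is its own real
   part; one factor |a| is then cancelled. *)
have := Re_ip_le (a^* *: x) y.
rewrite ipZl -/a mulrC -normCK nrmZ norm_conjC.
have := Re_norm_ge0 a; have := Re_normE a; move: a0; rewrite -normr_eq0.
move: `|a| => b; move: (complex.Re b) => r b0 {}b0E r0; rewrite b0E in b0 *.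
have {b0} r1 : 0 < r by rewrite lt_neqAle r0 andbT eq_sym; apply: contra b0 => /eqP ->.
by rewrite -rmorphXn lecR /= expr2 -mulrA ler_pM2l.
Qed.

Definition ncvg (E : ips R) (u : nat -> E) (l : E) :=
  forall e : R, 0 < e -> exists N : nat, forall k, (N <= k)%N -> nrm (l - u k) <= e.

Definition ncauchy (E : ips R) (u : nat -> E) :=
  forall e : R, 0 < e -> exists N : nat,
    forall k m, (N <= k)%N -> (N <= m)%N -> nrm (u m - u k) <= e.

Definition ncomplete (E : ips R) := forall u : nat -> E, ncauchy u -> exists l, ncvg u l.

Lemma rnormE (H : normedZmodType R[i]) (x : H) : `|x| = (rnorm x)%:RC.
Proof. by rewrite /rnorm RRe_real ?normr_real. Qed.

Lemma ncomplete_hilbert (H : hilbert R) : ncomplete (ips_hilbert H).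
Proof.
move=> u cu.
have : cvgn (u : nat -> H).
  apply: cauchy_cvg; apply: cauchy_exP => e e0.
  have eE : e = (complex.Re e)%:RC by rewrite RRe_real// gtr0_real.
  have e0' : 0 < complex.Re e by move: e0; rewrite ltcE => /andP[].
  have e2 : 0 < complex.Re e / 2 by rewrite divr_gt0.
  have [N HN] := cu _ e2.
  exists (u N); exists N => // k /= Nk.
  rewrite -ball_normE /= eE.
  have := HN k N Nk (leqnn _); rewrite nrm_hilbert => le.
  rewrite rnormE ltcR; apply: le_lt_trans le _; lra.
move=> /cvg_ex[l ul]; exists l => e e0.
have e0C : 0 < e%:RC by rewrite ltcR.
have /cvgrPdist_le /(_ _ e0C)[N _ HN] := ul.
exists N => k /HN /=; by rewrite nrm_hilbert rnormE lecR.
Qed.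

Lemma ncomplete_tuple (E : ips R) n : ncomplete E -> ncomplete (ips_tuple E n).
Proof.
move=> cE u cu.
have H i : exists l, ncvg (fun k => u k i) l.
  apply: cE => e e0; have [N HN] := cu e e0; exists N => k m Nk Nm.
  exact: le_trans (nrm_tuple_ge (u m - u k : ips_tuple E n) i) (HN k m Nk Nm).
have [l Hl] := choice H.
exists l => e e0.
have n1 : 0 < n.+1%:R :> R by rewrite ltr0n.
have en : 0 < e / n.+1%:R by rewrite divr_gt0.
have H2 i : exists N, forall k, (N <= k)%N -> nrm (l i - u k i) <= e / n.+1%:R.
  exact: Hl.
have [N HN] := choice H2.
exists (\max_i N i)%N => k Nk.
apply: le_trans (nrm_tuple_le _) _.
apply: (@le_trans _ _ (\sum_(i < n) e / n.+1%:R)).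
  apply: ler_sum => i _; apply: HN.
  by apply: leq_trans Nk; exact: leq_bigmax.
rewrite sumr_const card_ord -[_ *+ n]mulr_natl mulrCA ler_piMr ?(ltW e0)//.
by rewrite ler_pdivrMr// mul1r ler_nat.
Qed.

End Completeness.

(** * Square roots of positive operators *)

Section OperatorSqrt.
Variables (R : realType) (E : ips R).
Hypothesis complE : ncomplete E.
Variable h : E -> E.
Hypothesis h_sa : adjoint_pair h h.
Hypothesis h_bnd : bnd_by 1 h.

(* The iteration [y := (h + y^2) / 2] for the equation [(1 - y)^2 = 1 - h]. *)
Fixpoint sqrt_iter (k : nat) : E -> E :=
  if k is k'.+1 then fun x => 2^-1 *: (h x + sqrt_iter k' (sqrt_iter k' x))
  else fun=> 0.

(** The same iteration for the scalar [h = 1]. It increases to 1, and its increments dominate those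
    of [sqrt_iter] for every contraction [h]. *)
Fixpoint sqrt_maj (k : nat) : R :=
  if k is k'.+1 then (1 + sqrt_maj k' ^+ 2) / 2 else 0.

Lemma sqrt_maj01 k : 0 <= sqrt_maj k <= 1.
Proof.
elim: k => [|k /andP[h0 h1]] /=; first by rewrite lexx ler01.
by apply/andP; split; nra.
Qed.

Lemma sqrt_maj_mono k : sqrt_maj k <= sqrt_maj k.+1.
Proof. by have /andP[h0 h1] := sqrt_maj01 k; rewrite /=; nra. Qed.

(** The gap d = 1 - [sqrt_maj] obeys d -> d - d^2 / 2, a map increasing on [0, 1] that sends 2 / m
    below 2 / (m + 1). The resulting rate is uniform in [h], even when 1 - h is not invertible. *)
Lemma sqrt_maj_cvg k : 1 - sqrt_maj k <= 2 / k.+2%:R.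
Proof.
elim: k => [|k IH]; first by rewrite /= subr0 divff.
have /andP[h0 h1] := sqrt_maj01 k.
have kR : (k.+3%:R = k.+2%:R + 1 :> R) by rewrite -natr1.
have k2 : (2 <= k.+2%:R :> R) by rewrite ler_nat.
rewrite kR; move: IH kR k2; rewrite [sqrt_maj k.+1]/=; move: (k.+2%:R) (sqrt_maj k) h0 h1 => m r.
move=> h0 h1 IH _ m2.
apply: (@le_trans _ _ (2 / m - (2 / m) ^+ 2 / 2)).
  have m_1 : 2 / m <= 1 by rewrite ler_pdivrMr; lra.
  have m_0 : 0 <= 2 / m by rewrite divr_ge0//; lra.
  move: (2 / m) IH m_1 m_0 => t; nra.
have m0 : 0 < m by lra.
have m10 : 0 < m + 1 by lra.
rewrite -subr_ge0.
have -> : 2 / (m + 1) - (2 / m - (2 / m) ^+ 2 / 2) = 2 / (m ^+ 2 * (m + 1)).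
  by field; lra.
by rewrite divr_ge0// mulr_ge0 ?sqr_ge0//; lra.
Qed.

Lemma small_bound (e : R) : 0 < e -> exists N, forall k, (N <= k)%N -> 2 / k.+2%:R <= e.
Proof.
move=> e0; exists (Num.bound (2 / e)) => k Nk.
rewrite ler_pdivrMr ?ltr0n// mulrC -ler_pdivrMr//.
have e2 : 0 <= 2 / e by rewrite divr_ge0// ltW.
apply: le_trans (ltW (archi_boundP e2)) _.
by rewrite ler_nat; apply: leq_trans Nk _; rewrite -addn2 leq_addr.
Qed.

Lemma null_bound (z : E) (c : R) : 0 <= c -> (forall k, nrm z <= 2 / k.+2%:R * c) -> z = 0.
Proof.
move=> c0 zc; apply: nrm_eq0; apply: le_anti; rewrite nrm_ge0 andbT.
apply/ler_addgt0Pr => e e0; rewrite add0r.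
have c1 : 0 < 1 + c by rewrite ltr_pwDl.
have [N HN] := small_bound (divr_gt0 e0 c1).
apply: le_trans (zc N) _; apply: (@le_trans _ _ (e / (1 + c) * c)).
  by apply: ler_wpM2r => //; exact: HN.
by rewrite -mulrA ler_piMr ?(ltW e0)// mulrC ler_pdivrMr ?mul1r ?lerDr.
Qed.

Lemma sqrt_iter_sa k : adjoint_pair (sqrt_iter k) (sqrt_iter k).
Proof.
elim: k => [|k IH] x y /=; first by rewrite ip0l ip0r.
rewrite ipZl ipZr ipDl ipDr h_sa !IH fmorphV rmorph_nat //.
Qed.

Lemma sqrt_iter_lin k : linear (sqrt_iter k).
Proof. exact: adjoint_linear (@sqrt_iter_sa k). Qed.

Lemma sqrt_iterB k x y : sqrt_iter k (x - y) = sqrt_iter k x - sqrt_iter k y.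
Proof. by rewrite addrC -scaleN1r sqrt_iter_lin scaleN1r addrC. Qed.

Lemma nrm_half (x : E) : nrm (2^-1 *: x) = nrm x / 2.
Proof.
have -> : 2^-1 = (2^-1)%:RC :> R[i] by rewrite fmorphV rmorph_nat.
by rewrite nrmZr ger0_norm ?invr_ge0// mulrC.
Qed.

Lemma sqrt_iter_bnd k : bnd_by (sqrt_maj k) (sqrt_iter k).
Proof.
elim: k => [|k IH] x /=; first by rewrite nrm0 mul0r.
have /andP[h0 h1] := sqrt_maj01 k.
rewrite nrm_half mulrAC ler_pM2r ?invr_gt0//.
apply: le_trans (nrm_triangle _ _) _; rewrite mulrDl; apply: lerD => //.
apply: le_trans (IH _) _; rewrite expr2 -mulrA; exact: ler_wpM2l.
Qed.

(** The difference of two squares splits as y' (y' - y) + (y' - y) y for consecutive iterates y, y',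
    and the triangle inequality then reproduces the factorization of the difference of squares of
    the majorants. *)
Lemma sqrt_iter_step k x :
  nrm (sqrt_iter k.+1 x - sqrt_iter k x) <= (sqrt_maj k.+1 - sqrt_maj k) * nrm x.
Proof.
elim: k x => [|k IH] x.
  rewrite /= !subr0 addr0 nrm_half expr0n addr0 mulrC div1r ler_pM2l ?invr_gt0//.
  by rewrite -[leRHS]mul1r.
have /andP[h0 h1] := sqrt_maj01 k; have /andP[h0' h1'] := sqrt_maj01 k.+1.
have hm := sqrt_maj_mono k.
have -> : sqrt_iter k.+2 x - sqrt_iter k.+1 x = 2^-1 *:
   (sqrt_iter k.+1 (sqrt_iter k.+1 x - sqrt_iter k x) +
    (sqrt_iter k.+1 (sqrt_iter k x) - sqrt_iter k (sqrt_iter k x))).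
  rewrite sqrt_iterB addrA subrK.
  rewrite [sqrt_iter k.+2 x]/= -/(sqrt_iter k.+1) {2}[sqrt_iter k.+1]/= -scalerBr.
  by rewrite opprD addrACA subrr add0r.
have -> : sqrt_maj k.+2 - sqrt_maj k.+1 = (sqrt_maj k.+1 ^+ 2 - sqrt_maj k ^+ 2) / 2.
  by rewrite [sqrt_maj k.+2]/= -/(sqrt_maj k.+1) [X in _ - X = _]/=; field.
rewrite nrm_half mulrAC ler_pM2r ?invr_gt0//.
apply: le_trans (nrm_triangle _ _) _.
have n0 := nrm_ge0 x.
apply: (@le_trans _ _ (sqrt_maj k.+1 * ((sqrt_maj k.+1 - sqrt_maj k) * nrm x) +
  (sqrt_maj k.+1 - sqrt_maj k) * (sqrt_maj k * nrm x))).
  apply: lerD.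
    by apply: le_trans (sqrt_iter_bnd _ _) _; exact: ler_wpM2l.
  apply: le_trans (IH _) _; apply: ler_wpM2l; first by rewrite subr_ge0.
  exact: sqrt_iter_bnd.
by rewrite le_eqVlt; apply/orP; left; apply/eqP; ring.
Qed.

Lemma sqrt_iter_diff k m x : (k <= m)%N ->
  nrm (sqrt_iter m x - sqrt_iter k x) <= (sqrt_maj m - sqrt_maj k) * nrm x.
Proof.
move=> /subnK <-; elim: (m - k)%N => [|d IH].
  by rewrite add0n !subrr nrm0 mul0r.
rewrite addSn -(subrK (sqrt_iter (d + k) x) (sqrt_iter (d + k).+1 x)) -addrA.
apply: le_trans (nrm_triangle _ _) _.
apply: le_trans (lerD (sqrt_iter_step _ _) IH) _.
by rewrite -mulrDl addrA subrK.
Qed.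

Lemma sqrt_iter_diff2 k m x : (k <= m)%N ->
  nrm (sqrt_iter m x - sqrt_iter k x) <= 2 / k.+2%:R * nrm x.
Proof.
move=> km; apply: le_trans (sqrt_iter_diff _ km) _.
apply: ler_wpM2r; first exact: nrm_ge0.
apply: le_trans (sqrt_maj_cvg k); rewrite lerD2r.
by have /andP[] := sqrt_maj01 m.
Qed.

Lemma sqrt_iter_cauchy x : ncauchy (sqrt_iter ^~ x).
Proof.
move=> e e0.
have e1 : 0 < e / (1 + nrm x) by rewrite divr_gt0// ltr_pwDl ?ltr01 ?nrm_ge0.
have [N HN] := small_bound e1.
exists N.
have H k m : (N <= k)%N -> (k <= m)%N -> nrm (sqrt_iter m x - sqrt_iter k x) <= e.
  move=> Nk km; apply: le_trans (sqrt_iter_diff2 x km) _.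
  apply: (@le_trans _ _ (e / (1 + nrm x) * nrm x)).
    by apply: ler_wpM2r; [exact: nrm_ge0|exact: HN].
  rewrite -mulrA ler_piMr ?(ltW e0)// mulrC ler_pdivrMr ?mul1r ?lerDr//.
  by rewrite ltr_pwDl ?ltr01 ?nrm_ge0.
move=> k m Nk Nm; have [km|/ltnW mk] := leqP k m; first exact: H.
by rewrite nrmB; exact: H.
Qed.

(** The square root of 1 - h is 1 - y. The rate is kept in the conclusion because it places [y] in
    every norm-closed algebra containing [h] and makes it commute with what commutes with [h]. *)
Theorem operator_sqrt : exists y : E -> E,
  [/\ adjoint_pair y y, bnd_by 1 y,
      forall x, y x = 2^-1 *: (h x + y (y x)) &
      forall k, bnd_by (2 / k.+2%:R) (fun x => y x - sqrt_iter k x)].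
Proof.
have [y Hy] := choice (fun x => complE (sqrt_iter_cauchy x)).
have near k : bnd_by (2 / k.+2%:R) (fun x => y x - sqrt_iter k x).
  move=> x; apply/ler_addgt0Pr => e e0.
  have [N HN] := Hy x e e0.
  rewrite -(subrK (sqrt_iter (maxn N k) x) (y x)) -addrA addrC.
  apply: le_trans (nrm_triangle _ _) _; apply: lerD.
    by apply: sqrt_iter_diff2; exact: leq_maxr.
  by apply: HN; exact: leq_maxl.
have y_bnd : bnd_by 1 y.
  move=> x; rewrite mul1r; apply/ler_addgt0Pr => e e0.
  have [N HN] := Hy x e e0.
  rewrite -(subrK (sqrt_iter N x) (y x)) addrC.
  apply: le_trans (nrm_triangle _ _) _; apply: lerD; last exact: HN.
  apply: le_trans (sqrt_iter_bnd _ _) _; rewrite ler_piMl ?nrm_ge0//.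
  by have /andP[] := sqrt_maj01 N.
have y_sa : adjoint_pair y y.
  move=> x z; apply/eqP; rewrite -subr_eq0 -normr_eq0; apply/eqP.
  suff [w Hw] : exists w : R[i], ip (y x) z - ip x (y z) = w /\ forall k,
      `|w| <= (2 / k.+2%:R * (2 * (nrm x * nrm z)))%:RC.
    case: Hw => -> Hw.
    apply/eqP; rewrite Re_normE; suff -> : complex.Re `|w| = 0 by [].
    apply: le_anti; rewrite Re_norm_ge0 andbT.
    apply/ler_addgt0Pr => e e0; rewrite add0r.
    set c := 2 * (nrm x * nrm z).
    have c0 : 0 <= c by rewrite !mulr_ge0 ?nrm_ge0.
    have c1 : 0 < 1 + c by rewrite ltr_pwDl.
    have [N HN] := small_bound (divr_gt0 e0 c1).
    have := Hw N; rewrite Re_normE lecR => /le_trans; apply.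
    apply: (@le_trans _ _ (e / (1 + c) * c)).
      by apply: ler_wpM2r => //; exact: HN.
    by rewrite -mulrA ler_piMr ?(ltW e0)// mulrC ler_pdivrMr ?mul1r ?lerDr.
  eexists; split; first by [].
  move=> k.
  have -> : ip (y x) z - ip x (y z) =
     ip (y x - sqrt_iter k x) z - ip x (y z - sqrt_iter k z).
    by rewrite ipBl ipBr (sqrt_iter_sa k) opprB addrA subrK.
  apply: le_trans (ler_normB _ _) _.
  apply: le_trans (lerD (norm_ip_le _ _) (norm_ip_le _ _)) _.
  rewrite -rmorphD lecR.
  have := near k x; have := near k z; have := nrm_ge0 x; have := nrm_ge0 z.
  move: (nrm (y x - _)) (nrm (y z - _)) (2 / k.+2%:R) (nrm x) (nrm z) => a b t u v.
  nra.
exists y; split => // x.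
have yB u v : y (u - v) = y u - y v.
  by rewrite addrC -scaleN1r (adjoint_linear y_sa) scaleN1r addrC.
apply: subr0_eq; apply: (@null_bound _ (2 * nrm x)) => [|k].
  by rewrite mulr_ge0 ?nrm_ge0.
(* The failure of the fixed-point equation is compared with the recursion at step [k]; it is of
   order 1 / k for every [k], hence zero. *)
have -> : y x - 2^-1 *: (h x + y (y x)) = (y x - sqrt_iter k.+1 x) -
  2^-1 *: ((y (y x) - sqrt_iter k (y x)) + sqrt_iter k (y x - sqrt_iter k x)).
  rewrite sqrt_iterB addrA subrK /= -[RHS]addrA; congr (_ + _).
  rewrite -opprD -scalerDr; congr (- (_ *: _)).
  by rewrite -addrA; congr (_ + _); rewrite addrC subrK.
have /andP[r0 r1] := sqrt_maj01 k.
have n0 := nrm_ge0 x.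
have -> : 2 * nrm x = nrm x + nrm x by rewrite mulr_natl mulr2n.
apply: le_trans (nrm_triangle _ _) _; rewrite nrmN nrm_half.
have e0 : 0 <= 2 / k.+2%:R :> R by rewrite divr_ge0.
rewrite mulrDr; apply: lerD.
  apply: le_trans (near k.+1 x) _; apply: ler_wpM2r => //.
  by rewrite ler_pM2l// lef_pV2 ?posrE ?ltr0n// ler_nat.
rewrite ler_pdivrMr// [leRHS]mulr_natr mulr2n.
apply: le_trans (nrm_triangle _ _) _; apply: lerD.
  apply: le_trans (near k (y x)) _; apply: ler_wpM2l => //.
  by rewrite -[leRHS]mul1r.
apply: le_trans (sqrt_iter_bnd k _) _.
apply: (@le_trans _ _ (nrm (y x - sqrt_iter k x))); last exact: near.
by rewrite ler_piMl ?nrm_ge0.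
Qed.
End OperatorSqrt.

Section SqrtProperties.
Variables (R : realType) (E : ips R).

Lemma sqrt_square (h y : E -> E) : linear y ->
  (forall x, y x = 2^-1 *: (h x + y (y x))) ->
  forall x, (x - y x) - y (x - y x) = x - h x.
Proof.
move=> ly yE x; rewrite (@linB R E E _ ly).
have -> : y (y x) = 2 *: y x - h x.
  by rewrite [in RHS](yE x) scalerA divff ?pnatr_eq0// scale1r [h x + _]addrC addrK.
by rewrite scaler_nat mulr2n opprB [y x + y x - h x]addrAC addrK addrA subrK.
Qed.

(** The iterates are polynomials in [h] and so commute with [a]; the rate passes this on to the
    limit. *)
Lemma sqrt_commute (h y a : E -> E) (c : R) : adjoint_pair y y -> linear a ->
  0 <= c -> bnd_by c a -> (forall x, h (a x) = a (h x)) ->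
  (forall k, bnd_by (2 / k.+2%:R) (fun x => y x - sqrt_iter h k x)) ->
  forall x, y (a x) = a (y x).
Proof.
move=> say la c0 ac ha near x; apply/subr0_eq.
have it k z : sqrt_iter h k (a z) = a (sqrt_iter h k z).
  elim: k z => [|k IH] z /=; first by rewrite (lin0 la).
  by rewrite (linZ la) (linD la) ha !IH.
apply: (@null_bound R E _ (nrm (a x) + c * nrm x)) => [|k].
  by rewrite addr_ge0 ?mulr_ge0 ?nrm_ge0.
have -> : y (a x) - a (y x) = (y (a x) - sqrt_iter h k (a x)) - a (y x - sqrt_iter h k x).
  by rewrite (linB la) it opprB addrA subrK.
apply: le_trans (nrm_triangle _ _) _; rewrite nrmN mulrDr; apply: lerD; first exact: near.
apply: le_trans (ac _) _; rewrite mulrCA; apply: ler_wpM2l => //; exact: near.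
Qed.

End SqrtProperties.

(** * Free semicircular families and the full Fock space *)

Section Chebyshev.
Variable R : comNzRingType.

(* Chebyshev polynomials of the second kind, rescaled to [-2, 2]. *)
Fixpoint chebU (n : nat) : {poly R} :=
  match n with
  | 0 => 1
  | n'.+1 => match n' with 0 => 'X | n''.+1 => 'X * chebU n' - chebU n'' end
  end.

Lemma chebUSS n : chebU n.+2 = 'X * chebU n.+1 - chebU n.
Proof. by []. Qed.

Lemma chebU_deriv n :
  'X * (chebU n.+1)^`() - 2 * (chebU n)^`() = n.+1%:R * chebU n.+1 /\
  2 * (chebU n.+1)^`() - 'X * (chebU n)^`() = n.+2%:R * chebU n.
Proof.
elim: n => [|n [IH1 IH2]].
  by rewrite /= derivX derivC !mulr0 !subr0 mulr1 mul1r.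
have DU : (chebU n.+2)^`() = chebU n.+1 + 'X * (chebU n.+1)^`() - (chebU n)^`().
  by rewrite chebUSS derivB derivM derivX mul1r.
rewrite DU; split.
  have -> : 'X * (chebU n.+1 + 'X * (chebU n.+1)^`() - (chebU n)^`()) - 2 * (chebU n.+1)^`() =
    'X * chebU n.+1 + 'X * ('X * (chebU n.+1)^`() - 2 * (chebU n)^`())
     - (2 * (chebU n.+1)^`() - 'X * (chebU n)^`()) by ring.
  rewrite IH1 IH2 chebUSS.
  rewrite -[n.+2%:R]natr1; ring.
have -> : 2 * (chebU n.+1 + 'X * (chebU n.+1)^`() - (chebU n)^`()) - 'X * (chebU n.+1)^`() =
  2 * chebU n.+1 + ('X * (chebU n.+1)^`() - 2 * (chebU n)^`()) by ring.
rewrite IH1 -[n.+3%:R]natr1 -[n.+2%:R]natr1; ring.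
Qed.

(** Chebyshev's equation rescaled to [-2, 2]. Its left-hand side times sqrt(4 - t^2) is the
    derivative of (4 - t^2)^(3/2) U', with U the polynomial [chebU n.+1], so that U has mean zero
    for the semicircle law. *)
Lemma chebU_ode n :
  (4 - 'X^2) * (chebU n.+1)^`()^`() - 3 * 'X * (chebU n.+1)^`() =
  - (n.+1%:R * n.+3%:R) * chebU n.+1.
Proof.
have [A B] := chebU_deriv n.
have D2 k (p : {poly R}) : (k%:R * p)^`() = k%:R * p^`().
  by rewrite !mulr_natl derivMn.
have A' := congr1 (@deriv R) A; have B' := congr1 (@deriv R) B.
rewrite derivB [('X * _)^`()]derivM derivX mul1r !D2 in A'.
rewrite derivB [('X * _)^`()]derivM derivX mul1r !D2 in B'.
set p := chebU n.+1 in A B A' B' *; set q := chebU n in A B A' B' *.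
have -> : n.+3%:R = n.+2%:R + 1 :> {poly R} by rewrite natr1.
have e1 : n.+2%:R = n.+1%:R + 1 :> {poly R} by rewrite natr1.
rewrite e1 in A B A' B' *.
move: (n.+1%:R : {poly R}) A B A' B' => m A B A' B'.
move: A B A' B'.
move: (p^`()) (q^`()) => p1 q1; move: (p1^`()) (q1^`()) => p2 q2 A B A' B'.
(* Twice the derivative of [B], minus 'X times the derivative of [A], minus m + 2 times [A]: the
   first two brackets vanish and the last gives the eigenvalue m (m + 2). *)
transitivity (2 * (2 * p2 - (q1 + 'X * q2) - (m + 1) * q1)
   - 'X * (p1 + 'X * p2 - 2 * q2 - m * p1)
   - (m + 2) * ('X * p1 - 2 * q1)); first by ring.
rewrite A' B' A; ring.
Qed.

End Chebyshev.

(** * Chebyshev moments of the semicircle law *)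

Section SemicircleMoments.
Variable R : realType.
Local Notation mu := (@lebesgue_measure R).

Let w : {poly R} := 4 - 'X^2.
Let wE t : w.[t] = 4 - t ^+ 2.
Proof. by rewrite /w hornerD hornerN hornerXn hornerMn hornerC. Qed.

Let wD : w^`() = - ('X *+ 2).
Proof. by rewrite /w derivB derivXn derivMn derivC mul0rn sub0r. Qed.

Lemma semicircle_density_continuous (p : {poly R}) :
  continuous (fun t : R => p.[t] * Num.sqrt (4 - t ^+ 2)).
Proof.
move=> t; apply: cvgM; first exact: continuous_horner.
apply: (@continuous_comp _ _ _ (fun x : R => 4 - x ^+ 2) (@Num.sqrt R)); last first.
  exact: sqrt_continuous.
rewrite (_ : (fun _ => _) = horner w); first exact: continuous_horner.
by apply/funext => x; rewrite wE.
Qed.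

Lemma semicircle_density_integrable (p : {poly R}) :
  mu.-integrable `[-2, 2] (EFin \o (fun t : R => p.[t] * Num.sqrt (4 - t ^+ 2))).
Proof.
apply: continuous_compact_integrable; first exact: segment_compact.
apply: continuous_subspaceT; exact: semicircle_density_continuous.
Qed.

Lemma semicircle_poly (p : {poly R}) :
  \sum_(k < size p) p`_k * semicircle_moment R k =
  (2 * pi)^-1 * \int[mu]_(t in `[-2, 2]) (p.[t] * Num.sqrt (4 - t ^+ 2)).
Proof.
under eq_bigr do rewrite /semicircle_moment mulrCA.
rewrite -mulr_sumr; congr (_ * _).
have key n : \int[mu]_(t in `[-2, 2]) ((\sum_(k < n) p`_k *: 'X^k).[t] * Num.sqrt (4 - t ^+ 2)) =
   \sum_(k < n) p`_k * \int[mu]_(t in `[-2, 2]) (t ^+ k * Num.sqrt (4 - t ^+ 2)).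
  elim: n => [|n IH].
    rewrite !big_ord0; under eq_Rintegral do rewrite horner0 mul0r.
    by rewrite /Rintegral integral0.
  rewrite !big_ord_recr /= -IH.
  under [LHS]eq_Rintegral do rewrite hornerD mulrDl.
  rewrite RintegralD//; [|exact: semicircle_density_integrable..].
  congr (_ + _).
  under [LHS]eq_Rintegral do rewrite hornerZ hornerXn -mulrA.
  rewrite RintegralZl//.
  have := semicircle_density_integrable 'X^n.
  by congr (_.-integrable _ _); apply/funext => t /=; rewrite hornerXn.
by rewrite -key -poly_def coefK.
Qed.

Lemma semicircle_chebU n :
  \sum_(k < size (chebU R n.+1)) (chebU R n.+1)`_k * semicircle_moment R k = 0.
Proof.
rewrite semicircle_poly.
set q := (chebU R n.+1)^`().
(* The primitive (4 - t^2)^(3/2) times the derivative of the Chebyshev polynomial. *)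
pose F := horner (q * w) * (@Num.sqrt R \o horner w).
pose g := (4 - 'X^2) * q^`() - 3 * 'X * q.
have gE : g = - (n.+1%:R * n.+3%:R) * chebU R n.+1 by exact: chebU_ode.
have dF (t : R) : t \in `]-2, 2[ ->
    is_derive t 1 F (g.[t] * Num.sqrt (4 - t ^+ 2)).
  rewrite in_itv /= => /andP[t1 t2].
  have w0 : 0 < w.[t] by rewrite wE; nra.
  apply: trigger_derive.
    apply: is_deriveM; apply: is_derive1_comp; exact: is_derive1_sqrt.
  have s0 : 0 < Num.sqrt w.[t] by rewrite sqrtr_gt0.
  have s2 : w.[t] = Num.sqrt w.[t] ^+ 2 by rewrite sqr_sqrtr// ltW.
  rewrite /= -wE; move: s0 s2; set s := Num.sqrt _ => s0 s2.
  have -> : g = (q * w)^`() - 'X * q.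
    by rewrite /g derivM wD -['X *+ 2]mulr_natl /w; ring.
  have w't : w^`().[t] = - (2 * t) by rewrite wD hornerN hornerMn hornerX -mulr_natl.
  have qwt : (q * w).[t] = q.[t] * w.[t] by rewrite hornerM.
  have -> : ((q * w)^`() - 'X * q).[t] = (q * w)^`().[t] - t * q.[t].
    by rewrite hornerD hornerN hornerM hornerX.
  rewrite w't qwt.
  by rewrite s2 /GRing.scale /=; field; exact: lt0r_neq0.
have cF : continuous F.
  move=> t; apply: cvgM; first exact: continuous_horner.
  by apply: (@continuous_comp _ _ _ (horner w) (@Num.sqrt R)); [exact: continuous_horner|exact: sqrt_continuous].
(* The derivative of [F] is computed only inside the interval, where 4 - t^2 > 0; at the end points
   continuity suffices, and [F] vanishes there. *)
have F0 : (\int[mu]_(t in `[(-2)%R, 2%R]) (g.[t] * Num.sqrt (4 - t ^+ 2))%:E = 0)%E.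
  rewrite (@continuous_FTC2 _ _ F).
  - have FE (t : R) : F t = (q * w).[t] * Num.sqrt w.[t] by [].
    have w0 : 4 - 2 ^+ 2 = 0 :> R by ring.
    by rewrite !FE !wE sqrrN w0 sqrtr0 !mulr0 -EFinD subrr.
  - lra.
  - by apply: continuous_subspaceT; exact: semicircle_density_continuous.
  - split.
    + by move=> t tI; have [] := dF t tI.
    + by apply: cvg_at_right_filter; exact: cF.
    + by apply: cvg_at_left_filter; exact: cF.
  - by move=> t tI; rewrite derive1E; have dFt := dF t tI; exact: derive_val.
have : \int[mu]_(t in `[(-2)%R, 2%R]) (g.[t] * Num.sqrt (4 - t ^+ 2)) = 0 by rewrite /Rintegral F0.
set c : R := - (n.+1%:R * n.+3%:R).
have c0 : c != 0 by rewrite oppr_eq0 mulf_eq0 !pnatr_eq0.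
have -> : g = c *: chebU R n.+1.
  by rewrite gE /c -mul_polyC rmorphN rmorphM !rmorph_nat.
under eq_Rintegral do rewrite hornerZ -mulrA.
rewrite RintegralZl//; last exact: semicircle_density_integrable.
by move=> /eqP; rewrite mulf_eq0 (negbTE c0) => /eqP ->; rewrite mulr0.
Qed.

End SemicircleMoments.

(** * Finitely supported functions and partial injections *)

Section FinSupp.
Variables (R : realType) (X : choiceType).
Local Notation C := R[i].

Definition has_finsupp (f : X -> C) := exists s : seq X, forall x, x \notin s -> f x = 0.

Definition finsupp : {pred X -> C} := fun f => `[< has_finsupp f >].

Lemma finsuppP f : f \in finsupp <-> has_finsupp f.
Proof. by split=> [/asboolP|?]; [|apply/asboolP]. Qed.

Fact finsupp_submod_closed : submod_closed finsupp.
Proof.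
split=> [|k f g /finsuppP[s Hs] /finsuppP[t Ht]]; apply/finsuppP.
  by exists [::].
exists (s ++ t) => x; rewrite mem_cat negb_or => /andP[xs xt].
have -> : (k *: f + g) x = k * f x + g x by [].
by rewrite Hs// Ht// mulr0 addr0.
Qed.
HB.instance Definition _ :=
  GRing.isSubmodClosed.Build C (X -> C) finsupp finsupp_submod_closed.

Record fs := Fs { fs_val :> X -> C; fs_valP : fs_val \in finsupp }.
HB.instance Definition _ := [isSub of fs for fs_val].
HB.instance Definition _ := [Choice of fs by <:].
HB.instance Definition _ := [SubChoice_isSubLmodule of fs by <:].

Implicit Types f g h : fs.

Lemma fs_ext f g : f =1 g -> f = g.
Proof. by move=> fg; apply/val_inj/funext. Qed.

Lemma fsD f g x : (f + g) x = f x + g x. Proof. by []. Qed.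
Lemma fsB f g x : (f - g) x = f x - g x. Proof. by []. Qed.
Lemma fsZ k f x : (k *: f) x = k * f x. Proof. by []. Qed.
Lemma fs0 x : (0 : fs) x = 0. Proof. by []. Qed.
Lemma fs_sum (I : Type) (r : seq I) (P : pred I) (F : I -> fs) x :
  (\sum_(i <- r | P i) F i) x = \sum_(i <- r | P i) F i x.
Proof. by apply: (big_morph (fun f : fs => f x)). Qed.

Lemma fs_supp_ex f : exists s : seq X, uniq s /\ forall x, x \notin s -> f x = 0.
Proof.
have /finsuppP[s Hs] := fs_valP f; exists (undup s); split; first exact: undup_uniq.
by move=> x; rewrite mem_undup => /Hs.
Qed.

(** A chosen list outside which [f] vanishes; it may contain zeros of [f], so sums are moved between
    such lists by [big_uniq_cover]. *)
Definition supp f : seq X := projT1 (cid (fs_supp_ex f)).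

Lemma supp_uniq f : uniq (supp f).
Proof. by rewrite /supp; case: cid => s []. Qed.

Lemma suppN f x : x \notin supp f -> f x = 0.
Proof. by rewrite /supp; case: cid => s [] /= _; exact. Qed.

Lemma big_uniq_cover (V : nmodType) (s t : seq X) (F : X -> V) : uniq s -> uniq t ->
  (forall x, x \notin s -> F x = 0) -> (forall x, x \notin t -> F x = 0) ->
  \sum_(x <- s) F x = \sum_(x <- t) F x.
Proof.
have red (r : seq X) : \sum_(x <- r) F x = \sum_(x <- [seq x <- r | F x != 0]) F x.
  by rewrite big_filter [RHS]big_mkcond; apply: eq_bigr => x _; case: eqVneq.
move=> us ut Hs Ht; rewrite red [RHS]red; apply: perm_big.
apply: uniq_perm; rewrite ?filter_uniq// => x; rewrite !mem_filter.
have [_ //|F0 /=] := eqVneq (F x) 0.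
have -> : x \in s by apply: contra_neqT F0 => /Hs.
by apply/esym; apply: contra_neqT F0 => /Ht.
Qed.

Definition fsip f g : C := \sum_(x <- supp f) f x * (g x)^*.

Lemma fsipE f g (s : seq X) : uniq s ->
  (forall x, x \notin s -> f x * (g x)^* = 0) ->
  fsip f g = \sum_(x <- s) f x * (g x)^*.
Proof.
move=> us Hs; apply: big_uniq_cover => //; first exact: supp_uniq.
by move=> x /suppN ->; rewrite mul0r.
Qed.

Fact fsip_lin k f g h : fsip (k *: f + g) h = k * fsip f h + fsip g h.
Proof.
pose s := undup (supp f ++ supp g).
have us : uniq s by exact: undup_uniq.
have Hs x : x \notin s -> f x = 0 /\ g x = 0.
  by rewrite mem_undup mem_cat negb_or => /andP[/suppN ? /suppN ?].
rewrite !(@fsipE _ _ s)//; try by move=> x /Hs[f0 g0]; rewrite ?fsD ?fsZ ?f0 ?g0 ?mulr0 ?add0r ?mul0r.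
rewrite mulr_sumr -big_split; apply: eq_bigr => x _.
by rewrite fsD fsZ mulrDl mulrA.
Qed.

Fact fsip_conj f g : fsip g f = (fsip f g)^*.
Proof.
rewrite (@fsipE g f (supp f)) ?supp_uniq//; last first.
  by move=> x /suppN ->; rewrite rmorph0 mulr0.
rewrite rmorph_sum; apply: eq_bigr => x _.
by rewrite rmorphM /= conjCK mulrC.
Qed.

Fact fsip_ge0 f : 0 <= fsip f f.
Proof. by apply: sumr_ge0 => x _; rewrite -normCK exprn_ge0. Qed.

Fact fsip_eq0 f : fsip f f = 0 -> f = 0.
Proof.
move/eqP; rewrite psumr_eq0; last by move=> x _; rewrite -normCK exprn_ge0.
move=> /allP f0; apply: fs_ext => x; have [xs|/suppN//] := boolP (x \in supp f).
by have /= := f0 x xs; rewrite -normCK expf_eq0 /= normr_eq0 => /eqP.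
Qed.

Definition ips_fs : ips R := Ips fs fsip fsip_lin fsip_conj fsip_ge0 fsip_eq0.

Fact delta_finsupp (x : X) : (fun y => (y == x)%:R : C) \in finsupp.
Proof. by apply/finsuppP; exists [:: x] => y; rewrite inE => /negbTE ->. Qed.
Definition fsdelta x : fs := Fs (delta_finsupp x).

Lemma fsdeltaE x y : fsdelta x y = (y == x)%:R. Proof. by []. Qed.

Lemma fs_sum_delta f : f = \sum_(x <- supp f) f x *: fsdelta x.
Proof.
apply: fs_ext => y; rewrite fs_sum.
have [ys|ys] := boolP (y \in supp f); last first.
  rewrite suppN// big1_seq// => x; rewrite andTb => xs; rewrite fsZ fsdeltaE.
  by case: eqVneq => [yx|]; rewrite ?mulr0//; rewrite yx xs in ys.
rewrite (bigD1_seq y) ?supp_uniq// fsZ fsdeltaE eqxx mulr1 big1; first by rewrite /= addr0.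
move=> x xy; by rewrite fsZ fsdeltaE eq_sym (negbTE xy) mulr0.
Qed.

Lemma fsip_delta x y : fsip (fsdelta x) (fsdelta y) = (x == y)%:R.
Proof.
rewrite (@fsipE _ _ [:: x])//; last first.
  by move=> z; rewrite inE fsdeltaE => /negbTE ->; rewrite mul0r.
by rewrite big_seq1 !fsdeltaE eqxx mul1r rmorph_nat.
Qed.

(** A partial injection stored with its inverse, so that the adjoint of the operator it induces is
    again of the same form. Creation, annihilation and mixed terms all arise in this way. *)
Record pbij := Pbij {
  pbij_fun :> X -> option X;
  pbij_inv : X -> option X;
  pbijP : forall x y, pbij_fun x = Some y <-> pbij_inv y = Some x }.

Definition pbij_sym (p : pbij) : pbij :=
  @Pbij (pbij_inv p) p (fun x y => iff_sym (pbijP p y x)).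

Fact pull_finsupp (p : pbij) f : (fun x => oapp f 0 (p x)) \in finsupp.
Proof.
apply/finsuppP; exists (pmap (pbij_inv p) (supp f)) => x.
case E : (p x) => [y|//] /= xs; apply: suppN; apply: contra xs => ys.
by move/pbijP : E; rewrite mem_pmap => <-; apply: map_f.
Qed.
Definition pull (p : pbij) f : fs := Fs (pull_finsupp p f).

Lemma pullE (p : pbij) f x : pull p f x = oapp f 0 (p x). Proof. by []. Qed.

Lemma pull_linear p : linear (pull p).
Proof.
move=> k f g; apply: fs_ext => x; rewrite fsD fsZ !pullE.
by case: (p x) => [y|] /=; rewrite ?fsD ?fsZ // mulr0 addr0.
Qed.

Lemma pull_delta p x : pull p (fsdelta x) = oapp fsdelta 0 (pbij_inv p x).
Proof.
apply: fs_ext => y; rewrite pullE.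
case E : (p y) => [z|] /=; last first.
  case E' : (pbij_inv p x) => [z|//] /=; rewrite ?fsdeltaE; case: eqVneq => // yz.
  by move/pbijP : E'; rewrite -yz E.
rewrite ?fsdeltaE; case: eqVneq => [zx|zx].
  by move: E; rewrite zx => /pbijP -> /=; rewrite ?fsdeltaE eqxx.
case E' : (pbij_inv p x) => [t|//] /=; rewrite ?fsdeltaE; case: eqVneq => // yt.
by move/pbijP : E'; rewrite -yt E => -[] /eqP; rewrite (negbTE zx).
Qed.

Lemma fs_linear_ext (V : lmodType C) (E1 E2 : fs -> V) : linear E1 -> linear E2 ->
  (forall x, E1 (fsdelta x) = E2 (fsdelta x)) -> E1 =1 E2.
Proof.
move=> l1 l2 E12 f.
have z (E : fs -> V) : linear E -> E 0 = 0.
  by move=> l; rewrite -[X in E X](subrr 0) addrC -scaleN1r l scaleN1r addNr.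
rewrite (fs_sum_delta f); elim: (supp f) => [|x s IH]; first by rewrite big_nil !z.
by rewrite big_cons l1 l2 IH E12.
Qed.

Lemma fs_scalar_ext (E1 E2 : fs -> C) : (forall k f g, E1 (k *: f + g) = k * E1 f + E1 g) ->
  (forall k f g, E2 (k *: f + g) = k * E2 f + E2 g) ->
  (forall x, E1 (fsdelta x) = E2 (fsdelta x)) -> E1 =1 E2.
Proof. exact: (@fs_linear_ext C^o). Qed.

Lemma pull_adjoint (p : pbij) : @adjoint_pair R ips_fs (pull p) (pull (pbij_sym p)).
Proof.
move=> f g /=; move: f; apply: fs_scalar_ext.
- by move=> k f h; rewrite pull_linear fsip_lin.
- by move=> k f h; rewrite fsip_lin.
move=> x; rewrite pull_delta fsip_conj [RHS]fsip_conj; congr (_^*).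
move: g; apply: fs_scalar_ext.
- by move=> k f h; rewrite fsip_lin.
- by move=> k f h; rewrite pull_linear fsip_lin.
move=> y; rewrite pull_delta /=.
case E : (pbij_inv p x) => [z|] /=; case E' : (p y) => [t|] /=.
- rewrite !fsip_delta; congr ((nat_of_bool _)%:R); apply/eqP/eqP => [yz|tx].
    by move: E'; rewrite yz; move/pbijP : E => -> [].
  by move: E'; rewrite tx => /pbijP; rewrite E => -[].
- rewrite fsip_delta; case: eqVneq => [yz|_].
    by move/pbijP : E; rewrite -yz E'.
  by rewrite (@fsipE _ _ [::])// ?big_nil// => u _; rewrite fs0 mul0r.
- rewrite fsip_delta; case: eqVneq => [tx|_].
    by move/pbijP : E'; rewrite tx E.
  by rewrite (@fsipE _ _ [::])// ?big_nil// => u _; rewrite fs0 rmorph0 mulr0.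
by rewrite !(@fsipE _ _ [::])// ?big_nil// => u _; rewrite fs0 ?rmorph0 ?mulr0 ?mul0r.
Qed.

(** [pull p] followed by its adjoint restricts [f] to the range of [p], so the loss in square norm
    is the sum of |f x|^2 over the remaining points. *)
Lemma pull_contraction (p : pbij) : @bnd_by R ips_fs 1 (pull p).
Proof.
move=> f; rewrite mul1r.
rewrite -(ler_pXn2r (n := 2)) ?nnegrE ?nrm_ge0// !sqr_nrm -lecR.
rewrite !RRe_real ?ip_real// pull_adjoint -subr_ge0.
rewrite [X in _ <= X - _]/(ip _ _) -/(fsip _ _).
have -> : fsip f f - fsip f (pull (pbij_sym p) (pull p f)) =
  \sum_(x <- supp f) f x * ((f - pull (pbij_sym p) (pull p f)) x)^*.
  by rewrite /fsip -sumrB; apply: eq_bigr => x _; rewrite fsB rmorphB mulrBr.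
apply: sumr_ge0 => x _; rewrite fsB !pullE /=.
case E : (pbij_inv p x) => [y|] /=; last by rewrite subr0 -normCK exprn_ge0.
by move/pbijP : E => -> /=; rewrite subrr rmorph0 mulr0.
Qed.

End FinSupp.

(** * Positive operators and positivity of the trace *)

Section SelfAdjoint.
Variables (R : realType) (E : ips R).

(** Polarization over the complex numbers: the pairs of [x] with [d x] and with 'i times [d x] give
    two equations, which together force the square norm of [d x] to vanish. *)
Lemma form_eq0 (d : E -> E) : linear d -> (forall x, ip (d x) x = 0) -> forall x, d x = 0.
Proof.
move=> l d0 x; apply: ip_eq0.
have P u v : ip (d u) v + ip (d v) u = 0.
  have := d0 (u + v); rewrite (linD l) !ipDl !ipDr !d0 add0r addr0 addrC.
  by rewrite addrC.
have h1 := P x (d x); have h2 := P x ('i *: d x).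
rewrite ipZr (linZ l) ipZl conjCi in h2.
have : 'i * (ip (d (d x)) x - ip (d x) (d x)) = 0 by rewrite -h2; ring.
move=> /eqP; rewrite mulf_eq0 (negbTE (neq0Ci _)) /= subr_eq0 => /eqP e.
move: h1; rewrite e => /eqP; rewrite -mulr2n mulrn_eq0 /= => /eqP //.
Qed.

Lemma pos_self_adjoint (a a' : E -> E) : linear a -> adjoint_pair a a' ->
  (forall x, 0 <= ip (a x) x) -> adjoint_pair a a.
Proof.
move=> l aa' a0; have l' := adjoint_linear aa'.
suff e x : a x = a' x by move=> x y; rewrite aa' e.
apply/subr0_eq; apply: (@form_eq0 (fun x => a x - a' x)).
  by move=> k u v; rewrite l l' scalerBr opprD addrACA.
move=> z; rewrite ipBl (adjoint_pair_sym aa') (ip_conj (a z)).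
by rewrite (CrealP (ger0_real (a0 z))) subrr.
Qed.

Lemma pos_contraction (a : E -> E) : adjoint_pair a a -> bnd_by 1 a ->
  (forall x, 0 <= ip (a x) x) -> bnd_by 1 (fun x => x - a x).
Proof.
move=> sa a1 a0 x; have l := adjoint_linear sa.
rewrite mul1r -(ler_pXn2r (n := 2)) ?nnegrE ?nrm_ge0// sqr_nrmD nrmN ipNr raddfN /=.
(* This is a^2 <= a: positivity of [a] at x - a x reads 2 |a x|^2 <= <a x, x> + <a (a x), a x>, and
   the last term is at most |a x|^2. *)
have h : nrm (a x) ^+ 2 <= complex.Re (ip (a x) x).
  have := a0 (x - a x); rewrite (linB l) ipBl !ipBr lecE => /andP[_].
  rewrite !raddfB /= (sa (a x) x) -sqr_nrm => h.
  have h2 : complex.Re (ip (a (a x)) (a x)) <= nrm (a x) ^+ 2.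
    apply: le_trans (Re_ip_le _ _) _; rewrite expr2; apply: ler_wpM2r => //.
      exact: nrm_ge0.
    by have := a1 (a x); rewrite mul1r.
  lra.
rewrite (sa x x) in h; have := sqr_ge0 (nrm (a x)); lra.
Qed.

End SelfAdjoint.

Section Trace.
Variables (R : realType) (B : cstar_prob R).
Local Notation C := R[i].
Local Notation H := (cs_space B).
Local Notation HI := (ips_hilbert (cs_space B)).
Local Notation alg := (cs_alg B).
Local Notation tr := (cs_tr B).
Implicit Types a b c : H -> H.

Lemma op_norm_le (P : H -> H) (c : R) : 0 <= c ->
  (forall x : HI, nrm (P x : HI) <= c * nrm x) -> op_norm (@rnorm R H) P <= c.
Proof.
move=> c0 Pc; apply: ge_sup.
  exists (rnorm (P 0)); exists 0 => //=.
  by have := @nrm0 R HI; rewrite nrm_hilbert => ->.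
move=> _ [x /= x1 <-]; rewrite -!nrm_hilbert in x1 *.
by apply: le_trans (Pc x) _; apply: ler_piMr.
Qed.

Lemma alg_linear a : alg a -> linear a.
Proof. by move=> /cs_bounded[]. Qed.

Lemma alg_bnd a : alg a -> exists2 c : R, 0 < c & @bnd_by R HI c a.
Proof.
move=> /cs_bounded[_ [c Hc]]; exists (1 + `|c|); first by rewrite ltr_pwDl.
move=> x; rewrite !nrm_hilbert; apply: le_trans (Hc x) _.
apply: ler_wpM2r; first by rewrite -nrm_hilbert nrm_ge0.
by apply: le_trans (ler_norm c) _; rewrite lerDr.
Qed.

Lemma alg0 : alg (fun=> 0).
Proof.
have := cs_lin (-1) (cs_unit B) (cs_unit B).
by congr alg; apply/funext => x /=; rewrite scaleN1r addNr.
Qed.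

Lemma algD a b : alg a -> alg b -> alg (fun x => a x + b x).
Proof.
move=> aa ab; have := cs_lin 1 aa ab.
by congr alg; apply/funext => x; rewrite scale1r.
Qed.

Lemma algZ k a : alg a -> alg (fun x => k *: a x).
Proof.
move=> aa; have := cs_lin k aa alg0.
by congr alg; apply/funext => x; rewrite addr0.
Qed.

Lemma alg_sum (I : Type) (r : seq I) (P : pred I) (F : I -> H -> H) :
  (forall i, alg (F i)) -> alg (fun x => \sum_(i <- r | P i) F i x).
Proof.
move=> aF; elim: r => [|i r IH].
  by have := alg0; congr alg; apply/funext => x; rewrite big_nil.
case Pi : (P i); last first.
  by move: IH; congr alg; apply/funext => x; rewrite big_cons Pi.
have := algD (aF i) IH.
by congr alg; apply/funext => x; rewrite big_cons Pi.
Qed.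

Lemma tr0 : tr (fun=> 0) = 0.
Proof.
have := cs_tr_lin (-1) (cs_unit B) (cs_unit B); rewrite mulN1r addNr => <-.
by congr tr; apply/funext => x /=; rewrite scaleN1r addNr.
Qed.

Lemma trD a b : alg a -> alg b -> tr (fun x => a x + b x) = tr a + tr b.
Proof.
move=> aa ab; rewrite -[tr a]mul1r -cs_tr_lin//.
by congr tr; apply/funext => x; rewrite scale1r.
Qed.

Lemma trZ k a : alg a -> tr (fun x => k *: a x) = k * tr a.
Proof.
move=> aa; rewrite -[RHS]addr0 -tr0 -(cs_tr_lin _ aa alg0).
by congr tr; apply/funext => x; rewrite addr0.
Qed.

Lemma tr_sum (I : Type) (r : seq I) (P : pred I) (F : I -> H -> H) :
  (forall i, alg (F i)) ->
  tr (fun x => \sum_(i <- r | P i) F i x) = \sum_(i <- r | P i) tr (F i).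
Proof.
move=> aF; elim: r => [|i r IH].
  by rewrite big_nil -tr0; congr tr; apply/funext => x; rewrite big_nil.
case Pi : (P i); last first.
  by rewrite big_cons Pi -IH; congr tr; apply/funext => x; rewrite big_cons Pi.
rewrite big_cons Pi -IH -trD//; last exact: alg_sum.
by congr tr; apply/funext => x; rewrite big_cons Pi.
Qed.

Lemma alg_limit a (u : nat -> H -> H) : linear a -> @bnd_by R HI 1 a ->
  (forall k, alg (u k)) ->
  (forall k, @bnd_by R HI (2 / k.+2%:R) (fun x => a x - u k x)) -> alg a.
Proof.
move=> la a1 au near; apply: cs_closed.
  by split=> //; exists 1 => x; rewrite -!nrm_hilbert.
move=> e e0; have [N HN] := small_bound (divr_gt0 e0 (ltr0Sn R 1)).
exists (u N) => //; apply: (@le_lt_trans _ _ (e / 2)); last lra.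
apply: op_norm_le => [|x]; first lra.
by apply: le_trans (near N x) _; apply: ler_wpM2r; [exact: nrm_ge0|exact: HN].
Qed.

Lemma alg_sqrt_iter h k : alg h -> alg (@sqrt_iter R HI h k).
Proof.
move=> ah; elim: k => [|k IH]; first exact: alg0.
by apply: algZ; apply: algD => //; exact: (cs_mul IH IH).
Qed.

(** Scaled to a contraction, a positive element is the square of a self-adjoint element of the
    algebra, by the square root iteration for its complement; the positivity axiom for elements of
    the form a'a then applies. *)
Lemma tr_ge0 k : alg k -> (forall x : HI, 0 <= ip (k x : HI) x) -> 0 <= tr k.
Proof.
move=> ak k0.
have [k' ak' kk'] := cs_star ak.
have sa : @adjoint_pair R HI k k.
  exact: (@pos_self_adjoint R HI k k' (alg_linear ak) kk' k0).
have [c c0 kc] := alg_bnd ak.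
pose k1 x := c^-1%:RC *: k x.
have ak1 : alg k1 by exact: algZ.
have cr : (c^-1%:RC : C)^* = c^-1%:RC by apply/CrealP/complex_realP; exists c^-1.
have ci0 : 0 <= c^-1 by rewrite invr_ge0 ltW.
have sa1 : @adjoint_pair R HI k1 k1 by move=> x y; rewrite /k1 ipZl ipZr sa cr.
have k11 : @bnd_by R HI 1 k1.
  move=> x; rewrite /k1 (@nrmZr R HI) mul1r ger0_norm//.
  by rewrite mulrC ler_pdivrMr// mulrC; exact: kc.
have k10 x : 0 <= @ip R HI (k1 x) x by rewrite /k1 ipZl mulr_ge0// ler0c.
pose h x := x - k1 x.
have ah : alg h.
  have := cs_lin (-1) ak1 (cs_unit B); congr alg; apply/funext => x.
  by rewrite scaleN1r addrC.
have sah : @adjoint_pair R HI h h by move=> x y; rewrite /h ipBl ipBr sa1.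
have [y [say y1 yE ynear]] :=
  operator_sqrt (@ncomplete_hilbert R H) sah (pos_contraction sa1 k11 k10).
have ly : linear y := adjoint_linear say.
have ay : alg y.
  by apply: (alg_limit ly y1 _ ynear) => n; exact: alg_sqrt_iter.
pose b x := x - y x.
have ab : alg b.
  have := cs_lin (-1) ay (cs_unit B); congr alg; apply/funext => x.
  by rewrite scaleN1r addrC.
have sab : @adjoint_pair R HI b b by move=> u v; rewrite /b ipBl ipBr say.
have bb : k1 = b \o b.
  apply/funext => x; rewrite /b /= (@sqrt_square R HI h y ly yE).
  by rewrite /h opprB addrC subrK.
have -> : k = fun x => c%:RC *: k1 x.
  by apply/funext => x; rewrite /k1 scalerA -rmorphM /= divff ?lt0r_neq0// scale1r.
rewrite trZ// mulr_ge0 ?ler0c ?(ltW c0)// bb.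
exact: cs_tr_pos.
Qed.

End Trace.

(** * Wick words and the GNS map *)

Section WordFock.
Variables (R : realType) (J : choiceType).
Local Notation F := (fs R (seq J)).

Definition strip (i : J) (w : seq J) : option (seq J) :=
  if w is i' :: w' then if i' == i then Some w' else None else None.

Lemma stripP i w y : strip i w = Some y <-> w = i :: y.
Proof.
case: w => [|i' w] //=; split=> [|[-> ->]]; last by rewrite eqxx.
by case: eqVneq => // -> [->].
Qed.

Fact strip_pbij i x y : strip i x = Some y <-> Some (i :: y) = Some x.
Proof. by rewrite stripP; split=> [->|[]]. Qed.
Definition push_word i : pbij (seq J) :=
  @Pbij _ (strip i) (fun x => Some (i :: x)) (strip_pbij i).

(* [l_i + l_i^*] on the full Fock space. *)
Definition fock (i : J) (f : F) : F := pull (push_word i) f + pull (pbij_sym (push_word i)) f.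

Definition fockw (u : seq J) (f : F) : F := foldr fock f u.

Lemma fock_linear i : linear (fock i).
Proof. by move=> k f g; rewrite /fock !pull_linear scalerDr addrACA. Qed.

Lemma fock_sa i : @adjoint_pair R (ips_fs R (seq J)) (fock i) (fock i).
Proof.
move=> f g; rewrite /fock (@ipDl R (ips_fs R (seq J))) (@ipDr R (ips_fs R (seq J))).
by rewrite !pull_adjoint addrC.
Qed.

Lemma fockw_adjoint u : @adjoint_pair R (ips_fs R (seq J)) (fockw u) (fockw (rev u)).
Proof.
elim: u => [|i u IH] f g //.
have -> : fockw (i :: u) f = fock i (fockw u f) by [].
by rewrite fock_sa IH rev_cons /fockw foldr_rcons.
Qed.

Lemma fock_delta i w : fock i (fsdelta R w) =
  fsdelta R (i :: w) + oapp (@fsdelta R _) 0 (strip i w).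
Proof. by rewrite /fock !pull_delta /= addrC. Qed.

End WordFock.

Section Words.
Variables (R : realType) (B : cstar_prob R) (J : choiceType).
Variable s : J -> cs_space B -> cs_space B.
Hypothesis s_sc : forall j, standard_semicircular (s j).
Hypothesis s_free : free_family s.

Local Notation C := R[i].
Local Notation H := (cs_space B).
Local Notation HI := (ips_hilbert (cs_space B)).
Local Notation alg := (cs_alg B).
Local Notation tr := (cs_tr B).
Local Notation F := (fs R (seq J)).

Lemma alg_s j : alg (s j). Proof. by have [] := s_sc j. Qed.
Lemma s_sa j : @adjoint_pair R HI (s j) (s j). Proof. by have [] := s_sc j. Qed.
Lemma s_linear j : linear (s j). Proof. exact: alg_linear (alg_s j). Qed.

Definition opw (u : seq J) : H -> H := foldr (fun i g => s i \o g) idfun u.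

Lemma alg_opw u : alg (opw u).
Proof. by elim: u => [|i u IH]; [exact: cs_unit|exact: cs_mul (alg_s i) IH]. Qed.

Lemma opw_rcons u i : opw (rcons u i) = opw u \o s i.
Proof. by elim: u => //= j u ->. Qed.

Lemma opw_adjoint u : @adjoint_pair R HI (opw u) (opw (rev u)).
Proof.
elim: u => [|i u IH] // x y.
have -> : opw (i :: u) x = s i (opw u x) by [].
by rewrite (s_sa i) IH rev_cons opw_rcons.
Qed.

(* The image of the basis word [w] under the inverse of the GNS map
   [a |-> a Omega]. *)
Fixpoint wick (w : seq J) : H -> H :=
  if w is i :: w' then fun x => s i (wick w' x) -
    (if w' is i' :: w'' then if i' == i then wick w'' x else 0 else 0)
  else idfun.

Lemma wick_cons i w x :
  wick (i :: w) x = s i (wick w x) - oapp (wick ^~ x) 0 (strip i w).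
Proof. by case: w => [|i' w] //=; case: eqP. Qed.

Lemma alg_wick w : alg (wick w).
Proof.
have [n] := ubnP (size w); elim: n w => // n IH [|i w] sw; first exact: cs_unit.
have a1 : alg (s i \o wick w) by apply: cs_mul; [exact: alg_s|exact: IH].
have a2 : alg (fun x => oapp (wick ^~ x) 0 (strip i w)).
  case E : (strip i w) => [w'|] /=; last exact: alg0.
  apply: IH; move/stripP : E sw => -> /= ; exact: ltnW.
have := cs_lin (-1) a2 a1; congr alg; apply/funext => x.
by rewrite wick_cons scaleN1r addrC.
Qed.

Lemma op_horner_cheb i n x :
  op_horner (s i) (chebU C n.+2) x =
  s i (op_horner (s i) (chebU C n.+1) x) - op_horner (s i) (chebU C n) x.
Proof.
have E (p : {poly C}) m : (size p <= m)%N ->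
    op_horner (s i) p x = \sum_(k < m) p`_k *: iter k (s i) x.
  move=> pm; rewrite /op_horner [RHS](bigID (fun k : 'I_m => (k < size p)%N)) /=.
  rewrite [X in _ + X]big1 ?addr0; last first.
    by move=> k; rewrite -leqNgt => pk; rewrite nth_default// scale0r.
  by rewrite (big_ord_widen m (fun k => p`_k *: iter k (s i) x)).
(* [op_horner] stops at the size of its polynomial, so the three sums are padded with zero
   coefficients to lengths [m.+1], [m] and [m.+1]; the shorter middle one leaves room for the factor
   'X. *)
pose m := (size (chebU C n.+2) + size (chebU C n.+1) + size (chebU C n))%N.
rewrite (E (chebU C n.+2) m.+1); last by apply: leqW; rewrite /m -addnA leq_addr.
rewrite (E (chebU C n.+1) m); last by rewrite /m addnAC leq_addl.
rewrite (E (chebU C n) m.+1); last by apply: leqW; rewrite /m leq_addl.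
rewrite (@lin_sum R HI HI _ (s_linear i)) big_ord_recl [X in _ - X]big_ord_recl /=.
under [X in _ = X - _]eq_bigr do rewrite (@linZ R HI HI _ (s_linear i)).
rewrite !coefB coefXM /= sub0r scaleNr opprD addrCA; congr (_ + _).
rewrite -sumrB; apply: eq_bigr => k _.
by rewrite coefB coefXM /= scalerBl.
Qed.

(** Along a run of one letter the recursion defining [wick] is the Chebyshev recursion; the
    condition on [w] says that the run does not continue. *)
Lemma wick_run i n w x : ohead w != Some i ->
  wick (nseq n i ++ w) x = op_horner (s i) (chebU C n) (wick w x).
Proof.
move=> Hw.
have h0 y : op_horner (s i) (chebU C 0) y = y.
  by rewrite /op_horner /= size_poly1 big_ord1 coef1 /= scale1r.
have h1 y : op_horner (s i) (chebU C 1) y = s i y.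
  by rewrite /op_horner /= size_polyX !big_ord_recl big_ord0 !coefX /= scale0r add0r addr0 scale1r.
suff : wick (nseq n i ++ w) x = op_horner (s i) (chebU C n) (wick w x) /\
   wick (nseq n.+1 i ++ w) x = op_horner (s i) (chebU C n.+1) (wick w x) by case.
elim: n => [|n [IH1 IH2]].
  rewrite h0 h1 /= -/(wick w); split=> //.
  by case: w Hw => [|i' w] /=; rewrite ?subr0//; case: (i' =P i) => [->|_ _]; rewrite ?eqxx ?subr0.
split=> //; rewrite op_horner_cheb -IH1 -IH2 -[nseq n.+2 i ++ w]/(i :: (nseq n.+1 i ++ w)).
by rewrite wick_cons /= eqxx.
Qed.

Lemma tr_cheb i n : tr (op_horner (s i) (chebU C n.+1)) = 0.
Proof.
rewrite /op_horner tr_sum; last first.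
  move=> k; apply: algZ; elim: (k : nat) => [|m IH]; first exact: cs_unit.
  exact: cs_mul (alg_s i) IH.
have [_ _ mom] := s_sc i.
have chebC m : chebU C m = map_poly (real_complex R) (chebU R m).
  suff : chebU C m = map_poly (real_complex R) (chebU R m) /\
     chebU C m.+1 = map_poly (real_complex R) (chebU R m.+1) by case.
  elim: m => [|m [IH1 IH2]]; first by rewrite /= rmorph1 map_polyX.
  by split=> //; rewrite !chebUSS IH1 IH2 rmorphB rmorphM; congr (_ * _ - _); rewrite /= map_polyX.
rewrite chebC size_map_poly.
have /(congr1 (real_complex R)) := semicircle_chebU R n.
rewrite rmorph0 => /(etrans _); apply; rewrite rmorph_sum; apply: eq_bigr => k _.
rewrite trZ; last first.
  elim: (k : nat) => [|m IH]; first exact: cs_unit.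
  exact: cs_mul (alg_s i) IH.
rewrite rmorphM /= coef_map /=; congr (_ * _).
exact: mom.
Qed.

Lemma wick_runs w : w != [::] -> exists r : seq (J * {poly C}),
  [/\ r != [::], sorted (fun a b => a.1 != b.1) r,
      (forall a, a \in r -> tr (op_horner (s a.1) a.2) = 0),
      head None (map (Some \o fst) r) = head None (map Some w) &
      wick w = foldr (fun a S => op_horner (s a.1) a.2 \o S) idfun r].
Proof.
have [n] := ubnP (size w); elim: n w => // n IH [//|i w] sw _.
have [m [w' [wE Hw']]] : exists m w', i :: w = nseq m.+1 i ++ w' /\
    ohead w' != Some i.
  elim: w {sw} => [|j w [m [w' [wE Hw']]]]; first by exists 0%N, [::].
  have [->|ji] := eqVneq j i; first by exists m.+1, w'; rewrite wE.
  by exists 0%N, (j :: w); split=> //=; apply: contra ji => /eqP[->].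
have sw' : (size w' < n)%N.
  have := congr1 size wE; rewrite size_cat size_nseq /= => e; move: sw => /=; lia.
have wickE : wick (i :: w) = op_horner (s i) (chebU C m.+1) \o wick w'.
  by rewrite wE; apply/funext => x; exact: (wick_run m.+1 x Hw').
have [w'0|w'0] := eqVneq w' [::].
  exists [:: (i, chebU C m.+1)]; split=> //.
    move=> a; rewrite inE => /eqP ->; exact: (tr_cheb i m).
  by rewrite wickE w'0.
have [r [r0 rs rt rh rw]] := IH w' sw' w'0.
exists ((i, chebU C m.+1) :: r); split=> //.
- case: r r0 rs rh {rt rw} => // a r _ /= -> .
  by case: w' Hw' w'0 {wE sw' wickE} => // i' w' /= i'i _ [->]; rewrite andbT; apply: contra i'i => /eqP ->.
- move=> a; rewrite inE => /predU1P[->|]; [exact: tr_cheb|exact: rt].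
- by rewrite wickE rw.
Qed.

Lemma tr_wick w : tr (wick w) = (w == [::])%:R.
Proof.
have [->|w0] := eqVneq w [::]; first exact: cs_tr_unit.
have [r [r0 rs rt _ ->]] := wick_runs w0.
exact: s_free.
Qed.

End Words.

Section GNS.
Variables (R : realType) (B : cstar_prob R) (J : choiceType).
Variable s : J -> cs_space B -> cs_space B.
Hypothesis s_sc : forall j, standard_semicircular (s j).
Hypothesis s_free : free_family s.

Local Notation C := R[i].
Local Notation H := (cs_space B).
Local Notation HI := (ips_hilbert (cs_space B)).
Local Notation alg := (cs_alg B).
Local Notation tr := (cs_tr B).
Local Notation F := (fs R (seq J)).
Local Notation wick := (@wick R B J s).
Local Notation opw := (@opw R B J s).

(** The adjoint chosen inside the algebra; elsewhere the value is a dummy. *)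
Definition adj (b : H -> H) : H -> H :=
  if pselect (alg b) is left h then s2val (cid2 (cs_star h)) else idfun.

Lemma adjP b : alg b -> alg (adj b) /\ @adjoint_pair R HI b (adj b).
Proof. by rewrite /adj; case: pselect => // h _; case: cid2. Qed.

Lemma adj_eq b b' : alg b -> @adjoint_pair R HI b b' -> adj b = b'.
Proof.
move=> ab bb'; apply/funext; apply: (@adjoint_unique R HI b) bb'.
by have [] := adjP ab.
Qed.

Lemma alg_adj b : alg b -> alg (adj b). Proof. by move=> /adjP[]. Qed.

Definition gns_ip (a b : H -> H) : C := tr (adj b \o a).

Lemma gns_ip_linl k a b c : alg a -> alg b -> alg c ->
  gns_ip (fun x => k *: a x + b x) c = k * gns_ip a c + gns_ip b c.
Proof.
move=> aa ab ac; have ac' := alg_adj ac.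
rewrite /gns_ip -cs_tr_lin; [|exact: cs_mul..].
by congr tr; apply/funext => x /=; rewrite (alg_linear ac').
Qed.

Lemma gns_ip_linr k a b c : alg a -> alg b -> alg c ->
  gns_ip c (fun x => k *: a x + b x) = k^* * gns_ip c a + gns_ip c b.
Proof.
move=> aa ab ac; have [aa' ha] := adjP aa; have [ab' hb] := adjP ab.
rewrite /gns_ip -cs_tr_lin; [|exact: cs_mul..]; congr tr; apply/funext => x /=.
rewrite (_ : adj _ = fun x => k^* *: adj a x + adj b x)//.
by apply: adj_eq; [exact: cs_lin|exact: adjoint_pair_lin].
Qed.

Lemma gns_ip_suml (I : Type) (r : seq I) (P : pred I) (A : I -> H -> H) c :
  (forall i, alg (A i)) -> alg c ->
  gns_ip (fun x => \sum_(i <- r | P i) A i x) c = \sum_(i <- r | P i) gns_ip (A i) c.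
Proof.
move=> aA ac; have ac' := alg_adj ac; rewrite /gns_ip -tr_sum; last by move=> i; exact: cs_mul.
congr tr; apply/funext => x /=.
by rewrite (@lin_sum R HI HI _ (alg_linear ac')).
Qed.

Lemma gns_ip_adj a a' b c : alg a -> alg a' -> @adjoint_pair R HI a a' -> alg b -> alg c ->
  gns_ip (a \o b) c = gns_ip b (a' \o c).
Proof.
move=> aa aa' haa' ab ac; have [ac' hc] := adjP ac.
rewrite /gns_ip; congr tr; rewrite (_ : adj (a' \o c) = adj c \o a)//.
apply: adj_eq; first exact: cs_mul.
by apply: adjoint_pair_comp => //; exact: adjoint_pair_sym.
Qed.

Lemma gns_ip_ge0 a : alg a -> 0 <= gns_ip a a.
Proof. by move=> aa; have [aa' h] := adjP aa; exact: cs_tr_pos. Qed.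

Lemma gns_ip_eq0 a : alg a -> gns_ip a a = 0 -> forall x, a x = 0.
Proof. by move=> aa; have [aa' h] := adjP aa; exact: cs_tr_faithful. Qed.

Definition gns (f : F) : H -> H := fun x => \sum_(w <- supp f) f w *: wick w x.

Lemma gnsE (f : F) (r : seq (seq J)) x : uniq r -> (forall w, w \notin r -> f w = 0) ->
  gns f x = \sum_(w <- r) f w *: wick w x.
Proof.
move=> ur Hr; apply: big_uniq_cover => //; first exact: supp_uniq.
  by move=> w /suppN ->; rewrite scale0r.
by move=> w /Hr ->; rewrite scale0r.
Qed.

Lemma alg_gns f : alg (gns f).
Proof. by apply: alg_sum => w; apply: algZ; exact: alg_wick. Qed.

Lemma gns_linear x : linear (gns ^~ x).
Proof.
move=> k f g; pose r := undup (supp f ++ supp g).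
have ur : uniq r by exact: undup_uniq.
have Hr w : w \notin r -> f w = 0 /\ g w = 0.
  by rewrite mem_undup mem_cat negb_or => /andP[/suppN ? /suppN ?].
rewrite !(@gnsE _ r)//; try by move=> w /Hr[f0 g0]; rewrite ?fsD ?fsZ ?f0 ?g0 ?mulr0 ?addr0.
rewrite scaler_sumr -big_split; apply: eq_bigr => w _.
by rewrite fsD fsZ scalerDl scalerA.
Qed.

Lemma gns_lin k f g : gns (k *: f + g) = fun x => k *: gns f x + gns g x.
Proof. by apply/funext => x; exact: gns_linear. Qed.

Lemma gns_delta w : gns (fsdelta R w) = wick w.
Proof.
apply/funext => x; rewrite (@gnsE _ [:: w])//; last first.
  by move=> v; rewrite inE fsdeltaE => /negbTE ->.
by rewrite big_seq1 fsdeltaE eqxx scale1r.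
Qed.

(** The recursion for [wick] says that s_i times the Wick operator of w is that of i w plus that of
    w with a leading i stripped, which is how [fock i] acts on basis words. *)
Lemma gns_fock i f : gns (fock i f) = s i \o gns f.
Proof.
apply/funext => x; move: f; apply: fs_linear_ext.
- by move=> k f g; rewrite fock_linear gns_linear.
- by move=> k f g /=; rewrite gns_linear (s_linear s_sc i).
move=> w; rewrite /= fock_delta gns_delta.
have -> : fsdelta R (i :: w) + oapp (fsdelta R (X:=_)) 0 (strip i w) =
  1 *: fsdelta R (i :: w) + oapp (fsdelta R (X:=_)) 0 (strip i w) by rewrite scale1r.
rewrite gns_linear gns_delta scale1r wick_cons.
case: (strip i w) => [v|] /=; first by rewrite gns_delta subrK.
have := gns_linear x (-1) 0 0; rewrite scaler0 addr0 scaleN1r addNr => ->.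
by rewrite addr0 subr0.
Qed.

Lemma gns_fockw u f : gns (fockw u f) = opw u \o gns f.
Proof. by elim: u => [|i u IH] //; rewrite [fockw _ _]/= gns_fock -/(fockw u f) IH. Qed.

(** Induction on [u]: its first letter i moves across by self-adjointness of s_i and meets [wick w].
    Of the three resulting terms, those comparing i w with u cancel, and the one comparing w with i
    u remains. The empty word is the trace formula [tr_wick]. *)
Lemma gns_ip_wick w u : gns_ip (wick w) (wick u) = (w == u)%:R.
Proof.
have a1 v := alg_wick s_sc v.
have aid : adj (idfun : H -> H) = idfun.
  by apply: adj_eq; [exact: cs_unit|move=> ? ?].
have [n] := ubnP (size u); elim: n w u => // n IH w [|i u] su.
  rewrite /gns_ip aid -(tr_wick s_sc s_free); congr tr.
have su' : (size u < n)%N by [].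
have z0 (a c : H -> H) : alg a -> alg c -> gns_ip (fun x => oapp (fun=> 0) 0 (Some (a x))) c = 0 /\
    gns_ip c (fun x => oapp (fun=> 0) 0 (Some (a x))) = 0.
  move=> aa ac.
  have h1 := gns_ip_linl (-1) aa aa ac; have h2 := gns_ip_linr (-1) aa aa ac.
  rewrite mulN1r addNr in h1; rewrite rmorphN1 mulN1r addNr in h2.
  split; [rewrite -[RHS]h1|rewrite -[RHS]h2]; congr gns_ip; apply/funext => x /=;
    by rewrite scaleN1r addNr.
pose o v x := oapp (wick ^~ x) 0 v.
have ao v : alg (o v) by case: v => [v|]; [exact: a1|exact: alg0].
have El v c : alg c -> gns_ip (o v) c = oapp (fun v => gns_ip (wick v) c) 0 v.
  by move=> ac; case: v => [v|] //=; have [<- _] := z0 _ _ (cs_unit B) ac.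
have Er v c : alg c -> gns_ip c (o v) = oapp (fun v => gns_ip c (wick v)) 0 v.
  by move=> ac; case: v => [v|] //=; have [_ <-] := z0 _ _ (cs_unit B) ac.
have -> : wick (i :: u) = fun x => (-1) *: o (strip i u) x + (s i \o wick u) x.
  by apply/funext => x; rewrite wick_cons scaleN1r addrC.
have asu : alg (s i \o wick u) by apply: cs_mul => //; exact: alg_s.
rewrite gns_ip_linr// -(gns_ip_adj (alg_s s_sc i) (alg_s s_sc i) (s_sa s_sc i))//.
have -> : s i \o wick w = fun x => 1 *: wick (i :: w) x + o (strip i w) x.
  by apply/funext => x; rewrite wick_cons scale1r subrK.
rewrite gns_ip_linl// mul1r rmorphN1 mulN1r Er// El// IH//.
have -> : oapp (fun v => gns_ip (wick w) (wick v)) 0 (strip i u) = (i :: w == u)%:R.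
  case E : (strip i u) => [v|] /=.
    move/stripP : E su' => -> /=; rewrite eqseq_cons eqxx => /ltnW su'.
    by rewrite IH.
  case: eqVneq => // iwu; move: E; rewrite -iwu /= eqxx //.
have -> : oapp (fun v => gns_ip (wick v) (wick u)) 0 (strip i w) = (w == i :: u)%:R.
  case E : (strip i w) => [v|] /=.
    by move/stripP : E => ->; rewrite eqseq_cons eqxx IH.
  by case: eqVneq => // wiu; move: E; rewrite wiu /= eqxx.
by rewrite addKr.
Qed.

Lemma gns_ip_gns f g : gns_ip (gns f) (gns g) = ip (f : ips_fs R (seq J)) g.
Proof.
move: f; apply: fs_scalar_ext.
- by move=> k f h; rewrite gns_lin gns_ip_linl//; exact: alg_gns.
- by move=> k f h; rewrite (@ip_lin R (ips_fs R (seq J))).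
move=> w; move: g.
(* Conjugation makes both sides linear in [g], so that they can be compared on basis vectors. *)
have E : (fun g => (gns_ip (gns (fsdelta R w)) (gns g))^*) =1
         (fun g => (ip (fsdelta R w : ips_fs R (seq J)) g)^*).
  apply: fs_scalar_ext.
  - move=> k f g; rewrite gns_lin gns_ip_linr; [|exact: alg_gns..].
    by rewrite rmorphD rmorphM /= conjCK.
  - by move=> k f g; rewrite -!ip_conj (@ip_lin R (ips_fs R (seq J))).
  by move=> u; rewrite !gns_delta gns_ip_wick /= fsip_delta.
by move=> g; have /(congr1 Num.conj) := E g; rewrite !conjCK.
Qed.

End GNS.

(** * Positivity in one leg *)

Section Entries.
Variables (R : realType) (B : cstar_prob R) (n : nat).
Local Notation C := R[i].
Local Notation H := (cs_space B).
Local Notation HI := (ips_hilbert (cs_space B)).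
Local Notation E := (ips_tuple HI n).

Definition single (m : 'I_n) (v : H) : 'I_n -> H := fun j => if j == m then v else 0.

Definition entry (A : E -> E) (i m : 'I_n) : H -> H := fun v => A (single m v) i.

Lemma single_linear m : linear (single m : HI -> E).
Proof.
move=> k x y; apply/funext => j; rewrite !fctE /single.
by case: (j == m); rewrite ?scaler0 ?addr0.
Qed.

Lemma nrm_single m v : nrm (single m v : E) = nrm (v : HI).
Proof.
rewrite nrm_tuple (bigD1 m)//= /single eqxx big1 ?addr0; last first.
  by move=> j /negbTE ->; rewrite nrm0 expr0n.
by rewrite sqrtr_sqr ger0_norm ?nrm_ge0.
Qed.

Lemma sum_single (x : E) : x = \sum_m (single m (x m) : E).
Proof.
apply/funext => j; rewrite fct_sumE (bigD1 j)//= /single eqxx big1 ?addr0// => m mj.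
by rewrite eq_sym (negbTE mj).
Qed.

Lemma entryE (A : E -> E) (x : E) i : linear A -> A x i = \sum_m entry A i m (x m).
Proof.
move=> lA; rewrite {1}(sum_single x) (@lin_sum R E E _ lA).
exact: (big_morph (fun y : E => y i)).
Qed.

Variable P : (H -> H) -> Prop.
Hypothesis P_lin : forall a, P a -> linear a.
Hypothesis P_id : P idfun.
Hypothesis P_comb : forall (k : C) a b, P a -> P b -> P (fun x => k *: a x + b x).
Hypothesis P_mul : forall a b, P a -> P b -> P (a \o b).

(** Used with two choices of [P]: the polynomials in the family, which contain the entries of all
    iterates, and the whole algebra, which contains those of the limits. *)
Definition entries_in (A : E -> E) := linear A /\ forall i m, P (entry A i m).

Lemma unital_zero : P (fun=> 0).
Proof.
have := P_comb (-1) P_id P_id; congr P; apply/funext => x /=.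
by rewrite scaleN1r addNr.
Qed.

Lemma unital_sum (I : Type) (r : seq I) (a : I -> H -> H) : (forall i, P (a i)) ->
  P (fun x => \sum_(i <- r) a i x).
Proof.
move=> Pa; elim: r => [|i r IH].
  by have := unital_zero; congr P; apply/funext => x; rewrite big_nil.
have := P_comb 1 (Pa i) IH; congr P; apply/funext => x.
by rewrite big_cons scale1r.
Qed.

Lemma entries_id : entries_in idfun.
Proof.
split=> // i m; rewrite /entry /single /=.
case: (i == m); [exact: P_id|exact: unital_zero].
Qed.

Lemma entries_comb (k : C) A A' : entries_in A -> entries_in A' ->
  entries_in (fun x => k *: A x + A' x).
Proof.
move=> [lA PA] [lA' PA']; split=> [c x y|i m].
  rewrite lA lA' !scalerDr !scalerA [k * c]mulrC !addrA; congr (_ + _).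
  by rewrite -!addrA; congr (_ + _); rewrite addrC.
exact: P_comb (PA i m) (PA' i m).
Qed.

Lemma entries0 : entries_in (fun=> 0).
Proof. by split=> [c x y|i m]; [rewrite scaler0 addr0|exact: unital_zero]. Qed.

Lemma entries_scale (k : C) A : entries_in A -> entries_in (fun x => k *: A x).
Proof.
move=> PA; have := entries_comb k PA entries0.
by congr entries_in; apply/funext => x; rewrite addr0.
Qed.

Lemma entries_sub A A' : entries_in A -> entries_in A' -> entries_in (fun x => A x - A' x).
Proof.
move=> PA PA'; have := entries_comb (-1) PA' PA.
by congr entries_in; apply/funext => x; rewrite scaleN1r addrC.
Qed.

Lemma entries_comp A A' : entries_in A -> entries_in A' -> entries_in (A \o A').
Proof.
move=> [lA PA] [lA' PA']; split=> [c x y|i m] /=; first by rewrite lA' lA.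
have -> : entry (A \o A') i m = fun v => \sum_l entry A i l (entry A' l m v).
  by apply/funext => v; rewrite {1}/entry /= entryE.
by apply: unital_sum => l; exact: P_mul (PA i l) (PA' l m).
Qed.

Lemma entries_sqrt_iter h k : entries_in h -> entries_in (sqrt_iter h k).
Proof.
move=> Ph; elim: k => [|k IH] /=; first exact: entries0.
have := entries_scale 2^-1 (entries_comb 1 Ph (entries_comp IH IH)).
by congr entries_in; apply/funext => x /=; rewrite scale1r.
Qed.

End Entries.

Section EntriesAlg.
Variables (R : realType) (B : cstar_prob R) (n : nat).
Local Notation H := (cs_space B).
Local Notation HI := (ips_hilbert (cs_space B)).
Local Notation E := (ips_tuple HI n).

Lemma entries_limit (A : E -> E) (u : nat -> E -> E) : linear A -> bnd_by 1 A ->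
  (forall k, entries_in (cs_alg B) (u k)) ->
  (forall k, bnd_by (2 / k.+2%:R) (fun x => A x - u k x)) ->
  entries_in (cs_alg B) A.
Proof.
move=> lA A1 au near; split=> // i m.
apply: (@alg_limit _ _ _ (fun k => entry (u k) i m)).
- move=> c x y; rewrite /entry (single_linear m c x y) lA //.
- move=> x; rewrite mul1r; apply: le_trans (nrm_tuple_ge _ i) _.
  by apply: le_trans (A1 _) _; rewrite mul1r nrm_single.
- by move=> k; have [_] := au k; exact.
move=> k x; rewrite -(nrm_single m x).
exact: le_trans (nrm_tuple_ge (A (single m x) - u k (single m x) : E) i) (near k _).
Qed.

End EntriesAlg.

Section LegPositivity.
Variables (R : realType) (B : cstar_prob R) (J : choiceType).
Variable s : J -> cs_space B -> cs_space B.
Hypothesis s_sc : forall j, standard_semicircular (s j).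
Hypothesis s_free : free_family s.

Local Notation C := R[i].
Local Notation H := (cs_space B).
Local Notation HI := (ips_hilbert (cs_space B)).
Local Notation alg := (cs_alg B).
Local Notation tr := (cs_tr B).
Local Notation F := (fs R (seq J)).
Local Notation FI := (ips_fs R (seq J)).
Local Notation wick := (@wick R B J s).
Local Notation opw := (@opw R B J s).
Local Notation gns := (@gns R B J s).

(** Polynomials in the family, expanded in Wick operators, so that a column of polynomials is at
    once a tuple of Fock vectors on which positivity can be tested. *)
Definition in_pol (a : H -> H) := exists f : F, a = gns f.

Lemma pol_alg a : in_pol a -> alg a.
Proof. by move=> [f ->]; exact: (alg_gns s_sc). Qed.

Lemma pol_id : in_pol idfun.
Proof. by exists (fsdelta R [::]); rewrite gns_delta. Qed.

Lemma pol_comb (k : C) a b : in_pol a -> in_pol b -> in_pol (fun x => k *: a x + b x).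
Proof. by move=> [f ->] [g ->]; exists (k *: f + g); rewrite gns_lin. Qed.

Lemma pol0 : in_pol (fun=> 0).
Proof. exact: (unital_zero pol_id pol_comb). Qed.

(** Left multiplication by a Wick operator is built up letter by letter, each letter acting through
    [fock]. *)
Lemma pol_mul a b : in_pol a -> in_pol b -> in_pol (a \o b).
Proof.
move=> [f ->] [g ->].
have W w : in_pol (wick w \o gns g).
  have [n] := ubnP (size w); elim: n w => // n IH [|i w] sw; first by exists g.
  have [f1 f1E] : in_pol (wick w \o gns g) by exact: IH.
  have P2 : in_pol (fun x => oapp (wick ^~ (gns g x)) 0 (strip i w)).
    case E : (strip i w) => [v|] /=; last exact: pol0.
    by apply: IH; move/stripP : E sw => -> /= /ltnW.
  have P1 : in_pol (s i \o (wick w \o gns g)).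
    by exists (fock i f1); rewrite (gns_fock s_sc) f1E.
  have := pol_comb (-1) P2 P1; congr in_pol; apply/funext => x.
  by rewrite [RHS]/comp wick_cons scaleN1r addrC.
have -> : gns f \o gns g = fun x => \sum_(w <- supp f) f w *: (wick w \o gns g) x by [].
apply: (unital_sum pol_id pol_comb) => w.
have := pol_comb (f w) (W w) pol0; congr in_pol; apply/funext => x.
by rewrite addr0.
Qed.

Lemma pol_opw u : in_pol (opw u).
Proof. by exists (fockw u (fsdelta R [::])); rewrite (gns_fockw s_sc) gns_delta. Qed.

Variables (n : nat) (G : finType) (inv : G -> G) (u : G -> seq J).
Variable y : G -> 'I_n -> 'I_n -> C.
Hypothesis invK : involutive inv.
Hypothesis u_inv : forall g, u (inv g) = rev (u g).
Hypothesis y_inv : forall g i i', y (inv g) i' i = (y g i i')^*.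

Local Notation E := (ips_tuple HI n).

(** Since [inv] pairs each monomial with its adjoint and each coefficient with the conjugate
    transposed one, this matrix of polynomials is Hermitian. The row index comes first. *)
Definition mat (i' i : 'I_n) : H -> H := fun x => \sum_g y g i i' *: opw (u g) x.

Definition matop (x : E) : E := fun i' => \sum_i mat i' i (x i).

Lemma pol_mat i' i : in_pol (mat i' i).
Proof.
apply: (unital_sum pol_id pol_comb) => g.
have := pol_comb (y g i i') (pol_opw (u g)) pol0; congr in_pol; apply/funext => x.
by rewrite addr0.
Qed.

Lemma mat_adjoint i' i : @adjoint_pair R HI (mat i' i) (mat i i').
Proof.
move=> a b; rewrite /mat (@ip_suml R HI) (@ip_sumr R HI).
rewrite [RHS](reindex_inj (inv_inj invK)); apply: eq_bigr => g _.
rewrite (@ipZl R HI) (@ipZr R HI) y_inv conjCK u_inv; congr (_ * _).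
exact: (@opw_adjoint _ _ _ _ s_sc (u g) a b).
Qed.

Lemma entry_matop i m : entry matop i m = mat i m.
Proof.
apply/funext => v; rewrite /entry /matop (bigD1 m)//= /single eqxx.
rewrite big1 ?addr0// => j /negbTE ->.
exact: (@lin0 R HI HI _ (alg_linear (pol_alg (pol_mat i j)))).
Qed.

Lemma matop_linear : linear matop.
Proof.
move=> k x z; apply/funext => i.
have -> : (k *: matop x + matop z) i = k *: matop x i + matop z i by [].
rewrite /matop scaler_sumr -big_split /=; apply: eq_bigr => m _.
exact: (alg_linear (pol_alg (pol_mat i m))).
Qed.

Lemma matop_entries : entries_in in_pol matop.
Proof. by split=> [|i m]; [exact: matop_linear|rewrite entry_matop; exact: pol_mat]. Qed.

Lemma entries_pol_alg (A : E -> E) : entries_in in_pol A -> entries_in alg A.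
Proof. by move=> [lA PA]; split=> // i m; exact: pol_alg. Qed.

Lemma matop_sa : adjoint_pair matop matop.
Proof.
move=> x z; rewrite [LHS]/(tip _ _) [RHS]/(tip _ _) /tip /matop.
under eq_bigr do rewrite (@ip_suml R HI).
under [RHS]eq_bigr do rewrite (@ip_sumr R HI).
rewrite exchange_big; apply: eq_bigr => i _; apply: eq_bigr => i' _.
exact: mat_adjoint.
Qed.

Lemma form_mat (x : E) :
  \sum_i \sum_i' \sum_g y g i i' * ip (opw (u g) (x i) : HI) (x i') = ip (matop x) x.
Proof.
rewrite [RHS]/(tip _ _) /tip /matop.
under [RHS]eq_bigr do rewrite (@ip_suml R HI).
rewrite [RHS]exchange_big; apply: eq_bigr => i _; apply: eq_bigr => i' _.
by rewrite /mat (@ip_suml R HI); apply: eq_bigr => g _; rewrite (@ipZl R HI).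
Qed.

(** The matrix sandwiched between the column [a] and its adjoint. For a column of polynomials, the
    trace of this operator is the value of the Fock form at the corresponding vectors. *)
Definition compress (a : 'I_n -> H -> H) : H -> H :=
  fun x => \sum_i \sum_i' adj (a i') (mat i' i (a i x)).

Lemma alg_mat i' i : alg (mat i' i). Proof. exact: pol_alg (pol_mat i' i). Qed.

Lemma alg_compress a : (forall i, alg (a i)) -> alg (compress a).
Proof.
move=> aa; apply: alg_sum => i; apply: alg_sum => i'.
have := cs_mul (alg_adj (aa i')) (cs_mul (alg_mat i' i) (aa i)).
by congr alg.
Qed.

Lemma ip_compress a (x z : HI) : (forall i, alg (a i)) ->
  ip (compress a x : HI) z = ip (matop (fun i => a i x)) (fun i => a i z).
Proof.
move=> aa; rewrite /compress (@ip_suml R HI) [RHS]/(tip _ _) /tip /matop.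
under [RHS]eq_bigr do rewrite (@ip_suml R HI).
rewrite [RHS]exchange_big; apply: eq_bigr => i _.
rewrite (@ip_suml R HI); apply: eq_bigr => i' _.
have [_ h] := adjP (aa i').
by rewrite (adjoint_pair_sym h).
Qed.

Lemma tr_compress a : (forall i, alg (a i)) ->
  tr (compress a) = \sum_i \sum_i' gns_ip (mat i' i \o a i) (a i').
Proof.
move=> aa; have am i i' : alg (adj (a i') \o (mat i' i \o a i)).
  by apply: cs_mul; [exact: alg_adj|exact: cs_mul (alg_mat i' i) (aa i)].
rewrite /compress tr_sum; last first.
  by move=> i; apply: alg_sum => i'; exact: am.
by apply: eq_bigr => i _; rewrite tr_sum// => i'; exact: am.
Qed.

Lemma form_fock (f : 'I_n -> F) :
  \sum_i \sum_i' \sum_g y g i i' * ip (fockw (u g) (f i) : FI) (f i') =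
  tr (compress (fun i => gns (f i))).
Proof.
have ag := alg_gns s_sc.
rewrite tr_compress//; apply: eq_bigr => i _; apply: eq_bigr => i' _.
have -> : mat i' i \o gns (f i) = fun x => \sum_g y g i i' *: (opw (u g) \o gns (f i)) x by [].
have ao g : alg (opw (u g) \o gns (f i)) by apply: cs_mul => //; exact: alg_opw.
rewrite gns_ip_suml//; last by move=> g; exact: algZ.
apply: eq_bigr => g _.
rewrite -(gns_ip_gns s_sc s_free) (gns_fockw s_sc).
have := gns_ip_linl (y g i i') (ao g) (alg0 B) (ag (f i')).
have -> : gns_ip (fun=> 0) (gns (f i')) = 0.
  have := gns_ip_linl (-1) (ao g) (ao g) (ag (f i')); rewrite mulN1r addNr => h.
  by rewrite -[RHS]h; congr gns_ip; apply/funext => x; rewrite scaleN1r addNr.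
by rewrite addr0 => <-; congr gns_ip; apply/funext => x; rewrite addr0.
Qed.

Lemma leg_hilbert_fock : (forall x : E, 0 <= ip (matop x) x) ->
  forall f : 'I_n -> F, 0 <= tr (compress (fun i => gns (f i))).
Proof.
move=> pos f; have ag i : alg (gns (f i)) by exact: alg_gns.
apply: tr_ge0; first exact: alg_compress.
by move=> x; rewrite ip_compress.
Qed.

End LegPositivity.

Section BoundedEntries.
Variables (R : realType) (B : cstar_prob R) (n : nat).
Local Notation HI := (ips_hilbert (cs_space B)).
Local Notation E := (ips_tuple HI n).

Lemma entries_bounded (A : E -> E) : entries_in (cs_alg B) A ->
  exists2 c : R, 0 < c & bnd_by c A.
Proof.
move=> [lA aA].
have H i m : exists c : R, 0 < c /\ @bnd_by R HI c (entry A i m).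
  by have [c c0 Hc] := alg_bnd (aA i m); exists c.
have [c Hc] := choice (fun im : 'I_n * 'I_n => H im.1 im.2).
exists (1 + \sum_i \sum_m c (i, m)).
  rewrite ltr_pwDl// sumr_ge0// => i _; apply: sumr_ge0 => m _.
  by have [/ltW] := Hc (i, m).
move=> x; rewrite {1}(sum_single (A x)).
apply: le_trans (nrm_sum _ _ _) _; rewrite mulrDl mul1r -[leLHS]add0r.
apply: lerD; first exact: nrm_ge0.
rewrite mulr_suml; apply: ler_sum => i _; rewrite nrm_single (entryE x i lA).
apply: le_trans (@nrm_sum R HI _ _ _ _) _; rewrite mulr_suml; apply: ler_sum => m _.
have [c0 cb] := Hc (i, m).
by apply: le_trans (cb _) _; apply: ler_wpM2l; [exact: ltW|exact: nrm_tuple_ge].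
Qed.

End BoundedEntries.

Section LegPositivityConverse.
Variables (R : realType) (B : cstar_prob R) (J : choiceType).
Variable s : J -> cs_space B -> cs_space B.
Hypothesis s_sc : forall j, standard_semicircular (s j).
Hypothesis s_free : free_family s.
Local Notation C := R[i].
Local Notation H := (cs_space B).
Local Notation HI := (ips_hilbert (cs_space B)).
Local Notation alg := (cs_alg B).
Local Notation tr := (cs_tr B).
Local Notation F := (fs R (seq J)).
Local Notation gns := (@gns R B J s).
Variables (n : nat) (G : finType) (inv : G -> G) (u : G -> seq J).
Variable y : G -> 'I_n -> 'I_n -> C.
Hypothesis invK : involutive inv.
Hypothesis u_inv : forall g, u (inv g) = rev (u g).
Hypothesis y_inv : forall g i i', y (inv g) i' i = (y g i i')^*.
Local Notation E := (ips_tuple HI n).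
Local Notation matop := (@matop R B J s n G u y : E -> E).
Local Notation compress := (@compress R B J s n G u y).

(** Continuity of the trace is obtained from its positivity: for large k the operator e + [compress]
    of N - [compress] of Nk is positive, so the two traces differ by at most e in the required
    direction. *)
Lemma compress_limit (N : E -> E) (Nk : nat -> E -> E) (d : R) m :
  0 <= d -> entries_in alg N -> (forall k, entries_in (in_pol s) (Nk k)) ->
  bnd_by d N -> (forall k, bnd_by d (Nk k)) ->
  (forall k, bnd_by (2 / k.+2%:R) (fun x => N x - Nk k x)) ->
  (forall f : 'I_n -> F, 0 <= tr (compress (fun i => gns (f i)))) ->
  0 <= tr (compress (fun i => entry N i m)).
Proof.
move=> d0 eN eNk bN bNk near pos.
have eM : entries_in alg matop by apply: entries_pol_alg => //; exact: matop_entries.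
have [c c0 bM] := entries_bounded eM.
have saM := @matop_sa R B J s s_sc n G inv u y invK u_inv y_inv.
have aN i : alg (entry N i m) by have [] := eN.
have aNk k i : alg (entry (Nk k) i m) by apply: (pol_alg s_sc); have [] := eNk k.
have acN := alg_compress s_sc u y aN.
have acNk k := alg_compress s_sc u y (aNk k).
have posk k : 0 <= tr (compress (fun i => entry (Nk k) i m)).
  have [f fE] := choice (fun i => (eNk k).2 i m).
  rewrite (_ : (fun i => entry (Nk k) i m) = fun i => gns (f i)); first exact: pos.
  by apply/funext => i; rewrite fE.
have realM (z : E) : ip (matop z) z \is Num.real.
  by apply/CrealP; rewrite -ip_conj saM.
suff key (e : R) : 0 < e -> 0 <= e%:RC + tr (compress (fun i => entry N i m)).
  (* Nonnegativity of a complex number includes the vanishing of its imaginary part; one value of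
     [e] gives that, and arbitrary [e] gives the real part. *)
  rewrite lecE; apply/andP; split.
    by have := key 1 ltr01; rewrite lecE => /andP[/eqP + _]; rewrite raddfD /= add0r => ->.
  apply/ler_addgt0Pr => e e0; have := key e e0.
  by rewrite lecE => /andP[_]; rewrite raddfD /= addrC.
move=> e0.
(* With p and q the columns of N and Nk at a unit vector, <M p, p> - <M q, q> splits into two terms,
   each at most c d |p - q|; the 1 added below keeps the divisor positive. *)
have cd0 : 0 <= c * (2 * d) by rewrite !mulr_ge0// ltW.
have cd1 : 0 < 1 + c * (2 * d) by rewrite ltr_pwDl.
have [k Hk0] := small_bound (divr_gt0 e0 cd1).
have Hk : 2 / k.+2%:R * (c * (2 * d)) <= e.
  apply: (@le_trans _ _ (e / (1 + c * (2 * d)) * (c * (2 * d)))).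
    by apply: ler_wpM2r => //; exact: Hk0.
  by rewrite mulrAC ler_pdivrMr// ler_pM2l// lerDr.
pose a1 := compress (fun i => entry N i m); pose a2 := compress (fun i => entry (Nk k) i m).
have aid := cs_unit B.
have am : alg (fun x => (-1) *: a2 x + a1 x) by exact: (cs_lin (-1) (acNk k) acN).
have := tr_ge0 (cs_lin e%:RC aid am).
rewrite (cs_tr_lin _ aid am) (cs_tr_lin _ (acNk k) acN) cs_tr_unit mulr1 mulN1r => h.
apply: (@le_trans _ _ (e%:RC + (- tr a2 + tr a1))); last first.
  by rewrite lerD2l gerDr oppr_le0; exact: posk.
apply: h => x; rewrite (@ipDl R HI) (@ipZl R HI) (@ipDl R HI) (@ipZl R HI) mulN1r.
rewrite /a1 /a2 !ip_compress//.
have -> : (fun i => entry N i m x) = N (single m x) by [].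
have -> : (fun i => entry (Nk k) i m x) = Nk k (single m x) by [].
set p := N _; set q := Nk k _.
have lM : linear matop by exact: matop_linear.
have tR : - ip (matop q) q + ip (matop p) p \is Num.real by rewrite realD// realN.
have tE : - ip (matop q) q + ip (matop p) p = ip (matop (p - q)) p + ip (matop q) (p - q).
  by rewrite (linB lM) ipBl ipBr; ring.
have tB : `|- ip (matop q) q + ip (matop p) p| <= (e * nrm (x : HI) ^+ 2)%:RC.
  rewrite tE; apply: le_trans (ler_normD _ _) _.
  apply: le_trans (lerD (norm_ip_le _ _) (norm_ip_le _ _)) _; rewrite -rmorphD lecR.
  have n0 := @nrm_ge0 R HI x.
  have hp : nrm p <= d * nrm (x : HI) by rewrite -(nrm_single m x); exact: bN.
  have hq : nrm q <= d * nrm (x : HI) by rewrite -(nrm_single m x); exact: bNk.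
  have hpq : nrm (p - q) <= 2 / k.+2%:R * nrm (x : HI).
    by rewrite -(nrm_single m x); exact: near.
  have h1 := bM (p - q); have h2 := bM q.
  have p0 := nrm_ge0 p; have q0 := nrm_ge0 q; have pq0 := nrm_ge0 (p - q).
  have ek0 : 0 <= 2 / k.+2%:R :> R by rewrite divr_ge0.
  move: (nrm p) (nrm q) (nrm (p - q)) (nrm (x : HI)) (nrm (matop q)) (nrm (matop (p - q)))
    (2 / k.+2%:R) hp hq hpq h1 h2 p0 q0 pq0 n0 Hk ek0 {tR tE posk aNk acNk near bNk bN eNk}.
  move=> np nq npq nx nMq nMpq ek hp hq hpq h1 h2 p0 q0 pq0 n0 Hk ek0.
  have m1 : npq * np <= ek * nx * (d * nx) by exact: ler_pM.
  have m2 : nq * npq <= d * nx * (ek * nx) by exact: ler_pM.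
  apply: (@le_trans _ _ (c * npq * np + c * nq * npq)).
    by apply: lerD; apply: ler_wpM2r.
  apply: (@le_trans _ _ (ek * (c * (2 * d)) * nx ^+ 2)); last first.
    by apply: ler_wpM2r => //; exact: sqr_ge0.
  have -> : c * npq * np + c * nq * npq = c * (npq * np + nq * npq) by ring.
  have -> : ek * (c * (2 * d)) * nx ^+ 2 = c * (ek * nx * (d * nx) + d * nx * (ek * nx)) by ring.
  by rewrite ler_pM2l//; exact: lerD.
rewrite [X in _ * X](@ip_nrm R HI) -rmorphM /= -[X in _ + X]opprK subr_ge0.
apply: le_trans tB; rewrite -normrN; apply: real_ler_norm.
by rewrite realN.
Qed.

Theorem leg_fock_hilbert :
  (forall f : 'I_n -> F, 0 <= tr (compress (fun i => gns (f i)))) ->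
  forall x : E, 0 <= ip (matop x) x.
Proof.
move=> pos.
have eMp : entries_in (in_pol s) matop by exact: matop_entries.
have eM : entries_in alg matop by exact: entries_pol_alg.
have lM : linear matop by exact: matop_linear.
have [c c0 bM] := entries_bounded eM.
have saM := @matop_sa R B J s s_sc n G inv u y invK u_inv y_inv.
have cr (r : R) : (r%:RC : C)^* = r%:RC by apply/CrealP/complex_realP; exists r.
pose Z (x : E) : E := c^-1%:RC *: matop x.
have pid := pol_id s; have pcomb := @pol_comb R B J s.
have pmul := pol_mul s_sc.
have aid := cs_unit B; have acomb := @cs_lin R B; have amul := @cs_mul R B.
have cZ x : matop x = c%:RC *: Z x.
  by rewrite /Z scalerA -rmorphM /= divff ?lt0r_neq0// scale1r.
have ci0 : 0 <= c^-1 by rewrite invr_ge0 ltW.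
have Zp : entries_in (in_pol s) Z by apply: entries_scale.
have Za : entries_in alg Z by exact: entries_pol_alg.
have lZ : linear Z by case: Za.
have saZ : adjoint_pair Z Z by move=> a b; rewrite /Z ipZl ipZr saM cr.
have Z1 : bnd_by 1 Z.
  by move=> x; rewrite /Z nrmZr mul1r ger0_norm// mulrC ler_pdivrMr// mulrC; exact: bM.
pose h (x : E) : E := x - Z (Z x).
have hp : entries_in (in_pol s) h.
  by apply: entries_sub => //; [exact: entries_id|exact: entries_comp].
have ha : entries_in alg h by exact: entries_pol_alg.
have sah : adjoint_pair h h by move=> a b; rewrite /h ipBl ipBr !saZ.
have h1 : bnd_by 1 h.
  move=> x; rewrite mul1r -(ler_pXn2r (n := 2)) ?nnegrE ?nrm_ge0//.
  have ReN (z : C) : complex.Re (- z) = - complex.Re z by case: z.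
  rewrite sqr_nrmD nrmN ipNr -(saZ x (Z x)) ReN -sqr_nrm.
  have : nrm (Z (Z x)) ^+ 2 <= nrm (Z x) ^+ 2.
    by rewrite ler_pXn2r ?nnegrE ?nrm_ge0//; have := Z1 (Z x); rewrite mul1r.
  have := sqr_ge0 (nrm (Z x)); lra.
have cE : ncomplete E := ncomplete_tuple (@ncomplete_hilbert R H).
(* Since 1 - h = Z^2, the operator [b = 1 - r] below is |Z|. *)
have [r [sar r1 rE rnear]] := operator_sqrt cE sah h1.
have lr : linear r := adjoint_linear sar.
have ra : entries_in alg r.
  apply: (entries_limit lr r1 _ rnear) => k.
  exact: (entries_sqrt_iter aid acomb amul).
(* A second extraction, with [r] in the place of [h]: [q = 1 - r'] squares to 1 - r = |Z|. *)
have [r' [sar' r'1 r'E r'near]] := operator_sqrt cE sar r1.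
have lr' : linear r' := adjoint_linear sar'.
have r'a : entries_in alg r'.
  apply: (entries_limit lr' r'1 _ r'near) => k.
  exact: (entries_sqrt_iter aid acomb amul).
pose b (x : E) : E := x - r x; pose q (x : E) : E := x - r' x.
have bb x : b (b x) = Z (Z x).
  by rewrite /b (sqrt_square lr rE) /h opprB addrC subrK.
have qq x : q (q x) = b x by exact: (sqrt_square lr' r'E).
have saq : adjoint_pair q q by move=> u1 u2; rewrite /q ipBl ipBr sar'.
have sab : adjoint_pair b b by move=> u1 u2; rewrite /b ipBl ipBr sar.
have lb : linear b := adjoint_linear sab.
have qa : entries_in alg q by apply: entries_sub => //; exact: entries_id.
have hZ x : h (Z x) = Z (h x) by rewrite /h (linB lZ).
have bZ x : b (Z x) = Z (b x).
  by rewrite /b (linB lZ) (sqrt_commute sar lZ ler01 Z1 hZ rnear).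
pose N (x : E) : E := b x - Z x.
have saN : adjoint_pair N N by move=> u1 u2; rewrite /N ipBl ipBr sab saZ.
have lN : linear N := adjoint_linear saN.
have Na : entries_in alg N.
  by apply: entries_sub => //; apply: entries_sub => //; exact: entries_id.
have ZN x : Z (N x) = - b (N x).
  by rewrite /N (linB lZ) (linB lb) bZ bb opprB.
have NN x : N (N x) = 2 *: b (N x).
  by rewrite {1}/N ZN opprK scaler_nat mulr2n.
(* Replacing the root [r] by its iterates gives matrices with polynomial entries. *)
pose Nk k (x : E) : E := (x - sqrt_iter h k x) - Z x.
have Nkp k : entries_in (in_pol s) (Nk k).
  apply: entries_sub => //; apply: entries_sub => //; first exact: entries_id.
  exact: entries_sqrt_iter.
(* The 3 adds the bounds 1 of the identity, of the root and of [Z]. *)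
have bN : bnd_by 3 N.
  move=> x; apply: le_trans (nrm_triangle _ _) _; rewrite nrmN.
  have := nrm_triangle x (- r x); rewrite nrmN; have := r1 x; have := Z1 x.
  rewrite -/(b x); lra.
have bNk k : bnd_by 3 (Nk k).
  move=> x; apply: le_trans (nrm_triangle _ _) _; rewrite nrmN.
  have := nrm_triangle x (- sqrt_iter h k x); rewrite nrmN.
  have := sqrt_iter_bnd h1 k x; have := Z1 x; have n0 := nrm_ge0 x.
  have : sqrt_maj R k * nrm x <= 1 * nrm x.
    by apply: ler_wpM2r => //; have /andP[] := sqrt_maj01 R k.
  lra.
have near k : bnd_by (2 / k.+2%:R) (fun x => N x - Nk k x).
  move=> x; rewrite /N /Nk /b.
  have -> : x - r x - Z x - (x - sqrt_iter h k x - Z x) = - (r x - sqrt_iter h k x).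
    by rewrite !opprB addrA subrK addrC addrA subrK.
  by rewrite nrmN; exact: rnear.
have qN0 x : q (N x) = 0.
  have qNa : entries_in alg (q \o N) by exact: entries_comp.
  have qN_entry l m v : entry (q \o N) l m v = 0.
    have d3 : 0 <= 3 :> R by [].
    have := compress_limit m d3 Na Nkp bN bNk near pos.
    (* Here N Z N = - N q q N is read on the column m: the compression is - c times a sum of terms
       a'a with a the entries of q N, so its nonnegative trace forces each of them to vanish by
       faithfulness. *)
    have -> : compress (fun i => entry N i m) = fun v => \sum_l (- c%:RC) *:
        (adj (entry (q \o N) l m) \o entry (q \o N) l m) v.
      apply/funext => v1; apply: (@ip_ext R HI) => v2.
      rewrite ip_compress; last by move=> i; case: Na.
      have -> : (fun i => entry N i m v1) = N (single m v1) by [].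
      have -> : (fun i => entry N i m v2) = N (single m v2) by [].
      rewrite cZ ZN -qq ipZl ipNl saq (@ip_suml R HI) [X in _ * - X]/(tip _ _) /tip.
      rewrite -sumrN mulr_sumr; apply: eq_bigr => l' _.
      rewrite (@ipZl R HI) mulrN mulNr; congr (- (_ * _)).
      have [_ hd] := adjP (qNa.2 l' m).
      by rewrite [RHS](adjoint_pair_sym hd).
    have aq l' : alg (adj (entry (q \o N) l' m) \o entry (q \o N) l' m).
      by apply: cs_mul; [apply: alg_adj|]; exact: qNa.2.
    rewrite tr_sum; last by move=> l'; exact: algZ.
    under eq_bigr do rewrite trZ//.
    have c0C : 0 < c%:RC :> C by rewrite ltcR.
    rewrite -mulr_sumr mulNr oppr_ge0 pmulr_rle0// => le0.
    have ge0 : forall l', true -> 0 <= gns_ip (entry (q \o N) l' m) (entry (q \o N) l' m).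
      by move=> l' _; apply: gns_ip_ge0; exact: qNa.2.
    have sum0 : \sum_l' gns_ip (entry (q \o N) l' m) (entry (q \o N) l' m) == 0.
      by rewrite eq_le le0 sumr_ge0.
    move: sum0; rewrite psumr_eq0// => /allP/(_ l (mem_index_enum _)) /eqP dl.
    by apply: gns_ip_eq0 dl v; exact: qNa.2.
  apply/funext => l; have lqN : linear (q \o N) by case: qNa.
  by have := entryE x l lqN; rewrite /= => ->; rewrite big1.
have lq : linear q := adjoint_linear saq.
(* |N x|^2 = <x, N (N x)>, and N (N x) = 2 q (q (N x)) = 0. *)
have bE x : Z x = b x.
  have N0 : N x = 0.
    apply: ip_eq0; rewrite saN NN -qq qN0 (lin0 lq) scaler0 ip0r //.
  by move: N0 => /subr0_eq ->.
move=> x; rewrite cZ ipZl mulr_ge0 ?ler0c ?(ltW c0)// bE -qq saq; exact: ip_ge0.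
Qed.

End LegPositivityConverse.

Section LegEquivalence.
Variables (R : realType) (B : cstar_prob R) (J : choiceType).
Variable s : J -> cs_space B -> cs_space B.
Hypothesis s_sc : forall j, standard_semicircular (s j).
Hypothesis s_free : free_family s.

Theorem leg_positivity (n : nat) (G : finType) (inv : G -> G) (u : G -> seq J)
    (y : G -> 'I_n -> 'I_n -> R[i]) :
  involutive inv -> (forall g, u (inv g) = rev (u g)) ->
  (forall g i i', y (inv g) i' i = (y g i i')^*) ->
  (forall x : 'I_n -> cs_space B,
     0 <= \sum_i \sum_i' \sum_g y g i i' *
            ip (opw s (u g) (x i) : ips_hilbert (cs_space B)) (x i')) <->
  (forall f : 'I_n -> fs R (seq J),
     0 <= \sum_i \sum_i' \sum_g y g i i' *
            ip (fockw (u g) (f i) : ips_fs R (seq J)) (f i')).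
Proof.
move=> invK u_inv y_inv; split=> pos.
  move=> f; rewrite (form_fock s_sc s_free); apply: (leg_hilbert_fock s_sc) => x.
  by rewrite -(form_mat s).
have := leg_fock_hilbert s_sc invK u_inv y_inv.
move=> h x; rewrite (form_mat s); apply: h => f.
by rewrite -(form_fock s_sc s_free).
Qed.

End LegEquivalence.

(** * Exchanging the legs *)

Section LegSwap.
Variables (R : realType) (L n : nat) (G : finType) (W : Type).
Local Notation C := R[i].
Variables (T0 T1 : 'I_L -> Type) (p0 : forall j, T0 j) (p1 : forall j, T1 j).
Variable k0 : forall j, W -> T0 j -> T0 j -> C.
Variable k1 : forall j, W -> T1 j -> T1 j -> C.
Arguments k0 : clear implicits.
Arguments k1 : clear implicits.
Variables (inv : G -> G) (rv : W -> W) (u : G -> 'I_L -> W).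
Hypothesis u_inv : forall g j, u (inv g) j = rv (u g j).
Hypothesis k0_rv : forall j w a b, k0 j (rv w) b a = (k0 j w a b)^*.
Hypothesis k1_rv : forall j w a b, k1 j (rv w) b a = (k1 j w a b)^*.
Hypothesis legs : forall j (y : G -> 'I_n -> 'I_n -> C),
  (forall g i i', y (inv g) i' i = (y g i i')^*) ->
  (forall x : 'I_n -> T0 j,
     0 <= \sum_i \sum_i' \sum_g y g i i' * k0 j (u g j) (x i) (x i')) <->
  (forall x : 'I_n -> T1 j,
     0 <= \sum_i \sum_i' \sum_g y g i i' * k1 j (u g j) (x i) (x i')).
Variable z : G -> 'I_n -> 'I_n -> C.
Hypothesis z_inv : forall g i i', z (inv g) i' i = (z g i i')^*.

(** Interpolation between the two models: the legs in [S] have already been exchanged. Both families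
    of vectors run over all legs, so that [S] can vary without changing types. *)
Let kern (S : {set 'I_L}) (x0 : 'I_n -> forall j, T0 j) (x1 : 'I_n -> forall j, T1 j) j g i i' :=
  if j \in S then k1 j (u g j) (x1 i j) (x1 i' j) else k0 j (u g j) (x0 i j) (x0 i' j).

Let form S x0 x1 := \sum_i \sum_i' \sum_g z g i i' * \prod_j kern S x0 x1 j g i i'.

Let rest (j : 'I_L) S x0 x1 g i i' := z g i i' * \prod_(l | l != j) kern S x0 x1 l g i i'.

Let rest_inv j S x0 x1 g i i' : rest j S x0 x1 (inv g) i' i = (rest j S x0 x1 g i i')^*.
Proof.
rewrite /rest rmorphM z_inv rmorph_prod; congr (_ * _); apply: eq_bigr => l _.
by rewrite /kern u_inv k0_rv k1_rv; case: ifP.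
Qed.

Let formE j S x0 x1 : form S x0 x1 =
  \sum_i \sum_i' \sum_g rest j S x0 x1 g i i' * kern S x0 x1 j g i i'.
Proof.
apply: eq_bigr => i _; apply: eq_bigr => i' _; apply: eq_bigr => g _.
by rewrite (bigD1 j)//= mulrCA mulrC.
Qed.

Let pos S := forall x0 x1, 0 <= form S x0 x1.

Let pos_step (j : 'I_L) (S : {set 'I_L}) : j \notin S -> pos S <-> pos (j |: S).
Proof.
move=> jS.
have eq_rest x0 x1 (y0 : forall i l, T0 l) (y1 : forall i l, T1 l) g i i' :
    (forall i l, l != j -> x0 i l = y0 i l) -> (forall i l, l != j -> x1 i l = y1 i l) ->
    rest j S x0 x1 g i i' = rest j (j |: S) y0 y1 g i i'.
  move=> h0 h1; congr (_ * _); apply: eq_bigr => l lj.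
  by rewrite /kern !inE (negbTE lj) /= !h0// !h1.
split=> posS x0 x1; rewrite (formE j).
  have := (@legs j _ (rest_inv j (j |: S) x0 x1)).1 _ (fun i => x1 i j).
  rewrite /kern !inE eqxx; apply=> t.
  (* Only the leg [j] of the vectors is overwritten, which leaves [rest] unchanged. *)
  have := posS (fun i => dfwith (x0 i) j (t i)) x1; rewrite (formE j).
  congr (0 <= _); apply: eq_bigr => i _; apply: eq_bigr => i' _; apply: eq_bigr => g _.
  rewrite /kern (negbTE jS) !dfwithin; congr (_ * _).
  by apply: eq_rest => // k l lj; rewrite dfwithout// eq_sym.
have := (@legs j _ (rest_inv j S x0 x1)).2 _ (fun i => x0 i j).
rewrite /kern (negbTE jS); apply=> t.
have := posS x0 (fun i => dfwith (x1 i) j (t i)); rewrite (formE j).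
congr (0 <= _); apply: eq_bigr => i _; apply: eq_bigr => i' _; apply: eq_bigr => g _.
rewrite /kern !inE eqxx !dfwithin; congr (_ * _); apply/esym.
by apply: eq_rest => // k l lj; rewrite dfwithout// eq_sym.
Qed.

Theorem leg_swap :
  (forall x : 'I_n -> forall j, T0 j,
     0 <= \sum_i \sum_i' \sum_g z g i i' * \prod_j k0 j (u g j) (x i j) (x i' j)) <->
  (forall x : 'I_n -> forall j, T1 j,
     0 <= \sum_i \sum_i' \sum_g z g i i' * \prod_j k1 j (u g j) (x i j) (x i' j)).
Proof.
have -> : (forall x : 'I_n -> forall j, T0 j,
     0 <= \sum_i \sum_i' \sum_g z g i i' * \prod_j k0 j (u g j) (x i j) (x i' j)) =
     pos finset.set0.
  apply/propext; split=> [h x0 x1|h x]; last first.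
    have := h x (fun _ => p1); congr (0 <= _); apply: eq_bigr => i _.
    apply: eq_bigr => i' _; apply: eq_bigr => g _; congr (_ * _).
    by apply: eq_bigr => j _; rewrite /kern inE.
  have := h x0; congr (0 <= _); apply: eq_bigr => i _.
  apply: eq_bigr => i' _; apply: eq_bigr => g _; congr (_ * _).
  by apply: eq_bigr => j _; rewrite /kern inE.
have -> : (forall x : 'I_n -> forall j, T1 j,
     0 <= \sum_i \sum_i' \sum_g z g i i' * \prod_j k1 j (u g j) (x i j) (x i' j)) =
     pos [set: 'I_L]%SET.
  apply/propext; split=> [h x0 x1|h x]; last first.
    have := h (fun _ => p0) x; congr (0 <= _); apply: eq_bigr => i _.
    apply: eq_bigr => i' _; apply: eq_bigr => g _; congr (_ * _).
    by apply: eq_bigr => j _; rewrite /kern inE.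
  have := h x1; congr (0 <= _); apply: eq_bigr => i _.
  apply: eq_bigr => i' _; apply: eq_bigr => g _; congr (_ * _).
  by apply: eq_bigr => j _; rewrite /kern inE.
have key (l : seq 'I_L) : uniq l -> pos finset.set0 <-> pos [set j in l]%SET.
  elim: l => [|j l IH] /=; first by rewrite (_ : [set j in _]%SET = finset.set0)//; apply/setP => j; rewrite !inE.
  move=> /andP[jl ul]; rewrite IH//.
  rewrite (_ : [set x in j :: l]%SET = j |: [set x in l]%SET).
    by apply: pos_step; rewrite inE.
  by apply/setP => x; rewrite !inE.
rewrite (key (enum 'I_L)) ?enum_uniq//.
by rewrite (_ : [set j in _]%SET = [set: 'I_L]%SET)//; apply/setP => j; rewrite !inE mem_enum.
Qed.

End LegSwap.

(** * Tensor products of Fock spaces *)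

Section TensorFinSupp.
Variables (R : realType) (L : nat) (J : choiceType).
Local Notation C := R[i].
Local Notation X := {ffun 'I_L -> seq J}.
Local Notation F := (fs R (seq J)).
Local Notation XI := (ips_fs R X).
Local Notation FI := (ips_fs R (seq J)).
Implicit Types f g : 'I_L -> F.

Definition supps f : seq (seq J) := undup (flatten [seq supp (f j) | j <- enum 'I_L]).

(** The finite product set of all multi-indices with components in [r]; going through the finite
    type of members of [r] makes sums over it distribute over products. *)
Definition box (r : seq (seq J)) : seq X :=
  [seq [ffun j => val (phi j)] | phi : {ffun 'I_L -> seq_sub r}].

Lemma box_uniq r : uniq (box r).
Proof.
rewrite map_inj_uniq ?enum_uniq// => phi psi /ffunP e; apply/ffunP => j.
by apply: val_inj; have := e j; rewrite !ffunE.
Qed.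

Lemma mem_box r (x : X) : (forall j, x j \in r) -> x \in box r.
Proof.
move=> xr; apply/mapP; exists [ffun j => SeqSub (xr j)]; first by rewrite mem_enum.
by apply/ffunP => j; rewrite !ffunE.
Qed.

Lemma tens_out f (x : X) : x \notin box (supps f) -> \prod_j f j (x j) = 0.
Proof.
move=> xb; have [/existsP[j /eqP fj]|] := boolP [exists j, f j (x j) == 0].
  by rewrite (bigD1 j)//= fj mul0r.
rewrite negb_exists => /forallP nz; case/negP: xb; apply: mem_box => j.
rewrite mem_undup; apply/flattenP; exists (supp (f j)).
  by apply: map_f; rewrite mem_enum.
by apply: contraNT (nz j) => /suppN ->.
Qed.

Fact tens_finsupp f : (fun x : X => \prod_j f j (x j)) \in @finsupp R X.
Proof. by apply/finsuppP; exists (box (supps f)) => x; exact: tens_out. Qed.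
Definition tens f : fs R X := Fs (tens_finsupp f).

Lemma tensE f x : tens f x = \prod_j f j (x j). Proof. by []. Qed.

Lemma tens_ip f g : ip (tens f : XI) (tens g) = \prod_j ip (f j : FI) (g j).
Proof.
pose r := supps f.
transitivity (\sum_(x <- box r) tens f x * (tens g x)^*).
  apply: fsipE; first exact: box_uniq.
  by move=> x /tens_out; rewrite tensE => ->; rewrite mul0r.
rewrite big_image /=.
transitivity (\sum_(phi : {ffun 'I_L -> seq_sub r})
   \prod_j (f j (val (phi j)) * (g j (val (phi j)))^*)).
  apply: eq_bigr => phi _; rewrite ?tensE rmorph_prod -big_split /=.
  by apply: eq_bigr => j _; rewrite !ffunE.
rewrite -(bigA_distr_bigA (fun j (w : seq_sub r) => f j (val w) * (g j (val w))^*)).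
apply: eq_bigr => j _; symmetry.
transitivity (\sum_(w <- r) f j w * (g j w)^*).
  apply: fsipE; first exact: undup_uniq.
  move=> w wr; rewrite suppN ?mul0r//; apply: contra wr => wj.
  rewrite mem_undup; apply/flattenP; exists (supp (f j)) => //.
  by apply: map_f; rewrite mem_enum.
rewrite -(big_map val xpredT (fun w => f j w * (g j w)^*)); apply: perm_big.
apply: uniq_perm; first exact: undup_uniq.
  by rewrite map_inj_uniq ?index_enum_uniq//; exact: val_inj.
move=> w; apply/idP/mapP => [wr|[v _ ->]]; last exact: valP.
by exists (SeqSub wr) => //; rewrite mem_index_enum.
Qed.

Lemma tens_delta (x : X) : fsdelta R x = tens (fun j => fsdelta R (x j)).
Proof.
apply: fs_ext => z; rewrite tensE fsdeltaE.
have [->|zx] := eqVneq z x; first by rewrite big1// => j _; rewrite fsdeltaE eqxx.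
have [/forallP h|] := boolP [forall j, z j == x j].
  by case/eqP: zx; apply/ffunP => j; exact/eqP.
by rewrite negb_forall => /existsP[j zj]; rewrite (bigD1 j)//= (negbTE zj) mul0r.
Qed.

(* [shift i A B] removes the letter [i] in front of the legs in [A], and adds
   it in front of the legs in [B]. *)
Definition shift (i : J) (A B : {set 'I_L}) (x : X) : option X :=
  if [forall j in A, strip i (x j) != None] then
    Some [ffun j => if j \in A then behead (x j)
                    else if j \in B then i :: x j else x j]
  else None.

Lemma shiftP i A B x y : shift i A B x = Some y <->
  forall j, if j \in A then x j = i :: y j else
            if j \in B then y j = i :: x j else y j = x j.
Proof.
rewrite /shift; split.
  case: ifPn => // /forall_inP h [<-] j; rewrite ffunE.
  case jA: (j \in A); last by case: (j \in B).
  by move: (h j jA); case E : (strip i (x j)) => [w|//] _; move/stripP : E => ->.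
move=> h; have -> : [forall j in A, strip i (x j) != None].
  apply/forall_inP => j jA; have := h j; rewrite jA => /stripP -> //.
congr Some; apply/ffunP => j; rewrite ffunE; have := h j.
by case: ifP => [_ ->|_]//; case: ifP.
Qed.

Lemma shift_sym i (A B : {set 'I_L}) x y : [disjoint A & B]%B ->
  shift i A B x = Some y -> shift i B A y = Some x.
Proof.
move=> dAB /shiftP h; apply/shiftP => j; have := h j.
case: ifP => jA; last by case: ifP => // _ ->.
by rewrite (disjointFr dAB jA).
Qed.

Fact shift_pbij i (A B : {set 'I_L}) : [disjoint A & B]%B ->
  forall x y, shift i A B x = Some y <-> shift i B A y = Some x.
Proof.
by move=> dAB x y; split; apply: shift_sym => //; rewrite disjoint_sym.
Qed.

Fact disjointD (A B : {set 'I_L}) : [disjoint A & B :\: A]%B.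
Proof. by rewrite -finset.setI_eq0 finset.setDE finset.setICA finset.setICr finset.setI0. Qed.

Definition shift_bij i (K A : {set 'I_L}) : pbij X :=
  Pbij (shift_pbij i (disjointD A K)).

(* The tensor product over the legs in [K] of the operators [l_i + l_i^*]. *)
Definition fockK i (K : {set 'I_L}) (f : fs R X) : fs R X :=
  \sum_(A : {set 'I_L} | A \subset K) pull (shift_bij i K A) f.

Lemma fockK_linear i K : linear (fockK i K).
Proof.
move=> k f g; rewrite /fockK scaler_sumr -big_split; apply: eq_bigr => A _.
exact: pull_linear.
Qed.

(** At a basis point each leg contributes a creation part, which looks up the stripped word and
    vanishes outside [K], plus the rest. Expanding the product over the legs gives one term for each
    subset A of [K], the set of legs where creation is chosen. *)
Lemma fockK_tens i (K : {set 'I_L}) f :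
  fockK i K (tens f) = tens (fun j => if j \in K then fock i (f j) else f j).
Proof.
apply: fs_ext => x; rewrite fs_sum tensE.
pose a j := if j \in K then oapp (f j) 0 (strip i (x j)) else 0.
pose b j := if j \in K then f j (i :: x j) else f j (x j).
transitivity (\prod_j (a j + b j)); last first.
  apply: eq_bigr => j _; rewrite /a /b; case: ifP => _; last by rewrite add0r.
  by rewrite /fock fsD.
rewrite bigA_distr [RHS](bigID (fun A : {set 'I_L} => A \subset K)) /=.
rewrite [X in _ + X]big1 ?addr0; last first.
  move=> A /fintype.subsetPn[j jA jK]; rewrite (bigD1 j)//= jA.
  by rewrite {1}/a (negbTE jK) mul0r.
apply: eq_bigr => A AK; rewrite ?pullE /=.
case E : (shift i A (K :\: A) x) => [y|] /=.
  apply: eq_bigr => j _; move/shiftP : E => /(_ j).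
  rewrite !inE; case jA: (j \in A) => /=.
    by move=> xj; rewrite /a (fintype.subsetP AK _ jA) xj /= eqxx.
  by rewrite /b; case: (j \in K) => ->.
move: E; rewrite /shift; case: ifP => // /negbT.
rewrite negb_forall => /existsP[j]; rewrite negb_imply negbK => /andP[jA /eqP s0] _.
by rewrite (bigD1 j)//= jA {1}/a (fintype.subsetP AK _ jA) s0 mul0r.
Qed.

End TensorFinSupp.

Lemma sum_option (V : nmodType) (I : finType) (F : option I -> V) :
  \sum_o F o = F None + \sum_i F (Some i).
Proof.
rewrite (bigD1 None)//=; congr (_ + _).
rewrite (reindex_omap Some id) /=; last by case.
by apply: eq_bigl => i; rewrite eqxx.
Qed.

(** * Norm bounds as positive forms *)

Section QuadraticForm.
Variables (R : realType) (L : nat) (J : finType) (K : J -> {set 'I_L}).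
Local Notation C := R[i].

(* [None] stands for the identity. *)
Definition letter (al : option J) (j : 'I_L) : seq J :=
  if al is Some i then if j \in K i then [:: i] else [::] else [::].

(** [None] indexes the term c^2 <xi, xi>, and [Some (al, be)] the pairing of the images under the
    al-th and be-th operators: moving the second one across the inner product reverses its word. *)
Definition quad_word (g : option (option J * option J)) (j : 'I_L) : seq J :=
  if g is Some (al, be) then rev (letter be j) ++ letter al j else [::].

Definition swap_inv (g : option (option J * option J)) :=
  if g is Some (al, be) then Some (be, al) else None.

Lemma swap_invK : involutive swap_inv.
Proof. by case=> [[]|]. Qed.

Lemma quad_word_inv g j : quad_word (swap_inv g) j = rev (quad_word g j).
Proof. by case: g => [[al be]|] //=; rewrite rev_cat revK. Qed.

Variables (D n : nat) (b : option J -> 'I_D -> 'I_D -> C) (c : R).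
Variable a : 'I_D -> 'I_n -> C.

(** The coefficients of c^2 |xi|^2 - |P xi|^2 for a vector xi with fixed coefficients [a] on n
    elementary tensors. They make no reference to the space, so both models share them. *)
Definition quad_coef (g : option (option J * option J)) (i i' : 'I_n) : C :=
  if g is Some (al, be) then
    - \sum_d (\sum_k b al d k * a k i) * (\sum_k b be d k * a k i')^*
  else (c ^+ 2)%:RC * \sum_d a d i * (a d i')^*.

Lemma quad_coef_inv g i i' : quad_coef (swap_inv g) i' i = (quad_coef g i i')^*.
Proof.
case: g => [[al be]|]; rewrite /quad_coef [swap_inv _]/=.
  rewrite [RHS]rmorphN; congr (- _); rewrite [RHS]rmorph_sum; apply: eq_bigr => d _.
  by rewrite rmorphM /= conjCK mulrC.
rewrite [RHS]rmorphM; congr (_ * _); last rewrite [RHS]rmorph_sum.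
  by symmetry; apply/CrealP/complex_realP; exists (c ^+ 2).
by apply: eq_bigr => d _; rewrite rmorphM /= conjCK mulrC.
Qed.

Variables (E : ips R) (T : 'I_L -> Type) (tns : (forall j, T j) -> E).
Variable ker : forall j, seq J -> T j -> T j -> C.
Arguments ker : clear implicits.
Variable O : option J -> E -> E.
Hypothesis O_lin : forall al, linear (O al).
Hypothesis O_None : O None = id.
Hypothesis O_ip : forall al be f g, ip (O al (tns f)) (O be (tns g)) =
  \prod_j ker j (rev (letter be j) ++ letter al j) (f j) (g j).

Definition multi_pencil (xi : ips_tuple E D) : ips_tuple E D :=
  fun d => \sum_al \sum_k b al d k *: O al (xi k).

Definition span_vec (f : 'I_n -> forall j, T j) : ips_tuple E D :=
  fun d => \sum_i a d i *: tns (f i).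

Lemma quad_formE (f : 'I_n -> forall j, T j) :
  \sum_i \sum_i' \sum_g quad_coef g i i' * \prod_j ker j (quad_word g j) (f i j) (f i' j) =
  (c ^+ 2)%:RC * ip (span_vec f) (span_vec f) -
  ip (multi_pencil (span_vec f)) (multi_pencil (span_vec f)).
Proof.
pose e al d i := \sum_k b al d k * a k i.
have PE d : multi_pencil (span_vec f) d = \sum_al \sum_i e al d i *: O al (tns (f i)).
  apply: eq_bigr => al _; rewrite /span_vec.
  under eq_bigr do rewrite (lin_sum (O_lin al)) scaler_sumr.
  rewrite exchange_big; apply: eq_bigr => i _; rewrite scaler_suml.
  by apply: eq_bigr => k _; rewrite (linZ (O_lin al)) scalerA.
have ip2 (I1 I2 : finType) (x : I1 -> E) (z : I2 -> E) (p : I1 -> C) (q : I2 -> C) :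
    ip (\sum_i p i *: x i) (\sum_i' q i' *: z i') =
    \sum_i \sum_i' p i * (q i')^* * ip (x i) (z i').
  rewrite ip_suml; apply: eq_bigr => i _; rewrite ip_sumr; apply: eq_bigr => i' _.
  by rewrite ipZl ipZr mulrA.
have -> : ip (span_vec f) (span_vec f) =
    \sum_i \sum_i' (\sum_d a d i * (a d i')^*) * \prod_j ker j [::] (f i j) (f i' j).
  rewrite [LHS]/(tip _ _) /tip; under eq_bigr do rewrite ip2.
  rewrite exchange_big; apply: eq_bigr => i _; rewrite exchange_big; apply: eq_bigr => i' _.
  rewrite mulr_suml; apply: eq_bigr => d _; congr (_ * _).
  by have := O_ip None None (f i) (f i'); rewrite O_None.
have -> : ip (multi_pencil (span_vec f)) (multi_pencil (span_vec f)) =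
    \sum_i \sum_i' \sum_al \sum_be (\sum_d e al d i * (e be d i')^*) *
       \prod_j ker j (rev (letter be j) ++ letter al j) (f i j) (f i' j).
  rewrite [LHS]/(tip _ _) /tip.
  pose Fk al i be i' := \prod_j ker j (rev (letter be j) ++ letter al j) (f i j) (f i' j).
  transitivity (\sum_al \sum_i \sum_be \sum_i' (\sum_d e al d i * (e be d i')^*) *
      Fk al i be i').
    transitivity (\sum_d \sum_al \sum_i \sum_be \sum_i' e al d i * (e be d i')^* *
      Fk al i be i').
      apply: eq_bigr => d _; rewrite PE ip_suml; apply: eq_bigr => al _.
      rewrite ip_suml; apply: eq_bigr => i _; rewrite ip_sumr; apply: eq_bigr => be _.
      by rewrite ip_sumr; apply: eq_bigr => i' _; rewrite ipZl ipZr mulrA O_ip.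
    rewrite exchange_big; apply: eq_bigr => al _.
    rewrite exchange_big; apply: eq_bigr => i _.
    rewrite exchange_big; apply: eq_bigr => be _.
    rewrite exchange_big; apply: eq_bigr => i' _.
    by rewrite mulr_suml.
  rewrite exchange_big; apply: eq_bigr => i _.
  rewrite [RHS]exchange_big; apply: eq_bigr => al _.
  by rewrite [LHS]exchange_big.
rewrite mulr_sumr -sumrB; apply: eq_bigr => i _.
rewrite mulr_sumr -sumrB; apply: eq_bigr => i' _.
rewrite sum_option mulrA; congr (_ + _).
rewrite [X in - X](pair_bigA _ (fun al be => (\sum_d e al d i * (e be d i')^*) *
  \prod_j ker j (rev (letter be j) ++ letter al j) (f i j) (f i' j))).
by rewrite -sumrN; apply: eq_bigr => -[al be] _; rewrite /quad_coef mulNr.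
Qed.

Lemma quad_form_ge0 (f : 'I_n -> forall j, T j) : 0 <= c ->
  0 <= \sum_i \sum_i' \sum_g quad_coef g i i' *
         \prod_j ker j (quad_word g j) (f i j) (f i' j) <->
  nrm (multi_pencil (span_vec f)) <= c * nrm (span_vec f).
Proof.
move=> c0; rewrite quad_formE !ip_nrm -rmorphM subr_ge0 lecR -exprMn.
by rewrite ler_pXn2r ?nnegrE ?mulr_ge0 ?nrm_ge0.
Qed.

End QuadraticForm.

Lemma opw_cat (R : realType) (B : cstar_prob R) (J : choiceType)
    (s : J -> cs_space B -> cs_space B) (u v : seq J) x :
  opw s (u ++ v) x = opw s u (opw s v x).
Proof. by elim: u => //= i u IH; rewrite -IH. Qed.

Lemma fockw_cat (R : realType) (J : choiceType) (u v : seq J) (f : fs R (seq J)) :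
  fockw (u ++ v) f = fockw u (fockw v f).
Proof. by elim: u => //= i u ->. Qed.

Section NormTransfer.
Variables (R : realType) (L : nat) (J : finType) (K : J -> {set 'I_L}).
Local Notation C := R[i].
Variables (B : 'I_L -> cstar_prob R).
Variable W : hilbert_tensor (fun j => cs_space (B j)).
Variable s : J -> forall j, cs_space (B j) -> cs_space (B j).
Hypothesis s_sc : forall i j, standard_semicircular (s i (j := j)).
Hypothesis s_free : forall j, free_family (fun i => s i (j := j)).
Variable term : J -> ht_space W -> ht_space W.
Hypothesis termP : forall i,
  is_tensor_op (fun j => if j \in K i then s i (j := j) else idfun) (term i).

Local Notation X := {ffun 'I_L -> seq J}.
Local Notation XI := (ips_fs R X).
Local Notation WI := (ips_hilbert (ht_space W)).

Definition term_opt (al : option J) : WI -> WI := if al is Some i then term i else id.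
Definition fock_opt (al : option J) : XI -> XI := if al is Some i then fockK i (K i) else id.

Lemma term_opt_linear al : linear (term_opt al).
Proof. by case: al => [i|] //; have [[]] := termP i. Qed.

Lemma fock_opt_linear al : linear (fock_opt al).
Proof. by case: al => [i|] //; exact: fockK_linear. Qed.

Lemma term_opt_tens al f :
  term_opt al (ht_tens W f) = ht_tens W (fun j => opw (fun i => s i (j := j)) (letter K al j) (f j)).
Proof.
case: al => [i|] //=; have [_ ->] := termP i.
congr ht_tens; apply: functional_extensionality_dep => j.
by case: ifP.
Qed.

Lemma fock_opt_tens al (f : 'I_L -> fs R (seq J)) :
  fock_opt al (tens f) = tens (fun j => fockw (letter K al j) (f j)).
Proof.
case: al => [i|] //=; rewrite fockK_tens.
by congr tens; apply/funext => j; case: ifP.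
Qed.

Local Notation ker0 := (fun j w (x y : cs_space (B j)) =>
  ip (opw (fun i => s i (j := j)) w x : ips_hilbert (cs_space (B j))) y).
Local Notation ker1 := (fun (j : 'I_L) w f g => ip (fockw w f : ips_fs R (seq J)) g).

Lemma term_opt_ip al be f g :
  ip (term_opt al (ht_tens W f)) (term_opt be (ht_tens W g)) =
  \prod_j ker0 j (rev (letter K be j) ++ letter K al j) (f j) (g j).
Proof.
rewrite !term_opt_tens [LHS]ht_dot; apply: eq_bigr => j _.
rewrite opw_cat.
have h := opw_adjoint (fun i => s_sc i j) (letter K be j).
by rewrite (adjoint_pair_sym h).
Qed.

Lemma fock_opt_ip al be (f g : 'I_L -> fs R (seq J)) :
  ip (fock_opt al (tens f)) (fock_opt be (tens g)) =
  \prod_j ker1 j (rev (letter K be j) ++ letter K al j) (f j) (g j).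
Proof.
rewrite !fock_opt_tens tens_ip; apply: eq_bigr => j _.
by rewrite fockw_cat (adjoint_pair_sym (@fockw_adjoint R J _)).
Qed.

Variables (D : nat) (b : option J -> 'I_D -> 'I_D -> C) (c : R).
Hypothesis c0 : 0 <= c.

(** For fixed [a] and all choices of tensors, both bounds are positivity of a form with the
    coefficients [quad_coef], and [leg_swap] exchanges its kernels. *)
Lemma span_transfer n (a : 'I_D -> 'I_n -> C) :
  (forall f : 'I_n -> forall j, cs_space (B j),
     nrm (multi_pencil b term_opt (span_vec a (fun f => ht_tens W f : WI) f)) <=
       c * nrm (span_vec a (fun f => ht_tens W f : WI) f)) <->
  (forall f : 'I_n -> 'I_L -> fs R (seq J),
     nrm (multi_pencil b fock_opt (span_vec a (fun f => tens f : XI) f)) <=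
       c * nrm (span_vec a (fun f => tens f : XI) f)).
Proof.
have E0 f := quad_form_ge0 b a term_opt_linear erefl term_opt_ip f c0.
have E1 f := quad_form_ge0 b a fock_opt_linear erefl fock_opt_ip f c0.
have k0rv j w (x y : cs_space (B j)) : ker0 j (rev w) y x = (ker0 j w x y)^*.
  have h := opw_adjoint (fun i => s_sc i j) w.
  by rewrite (adjoint_pair_sym h) (ip_conj (opw _ w x : ips_hilbert (cs_space (B j)))).
have k1rv (j : 'I_L) w (f g : fs R (seq J)) : ker1 j (rev w) g f = (ker1 j w f g)^*.
  rewrite (adjoint_pair_sym (@fockw_adjoint R J w)).
  by rewrite (ip_conj (fockw w f : ips_fs R (seq J))).
have lg j (y : option (option J * option J) -> 'I_n -> 'I_n -> C) :
    (forall g i i', y (@swap_inv J g) i' i = (y g i i')^*) ->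
    (forall x : 'I_n -> cs_space (B j),
       0 <= \sum_i \sum_i' \sum_g y g i i' * ker0 j (quad_word K g j) (x i) (x i')) <->
    (forall x : 'I_n -> fs R (seq J),
       0 <= \sum_i \sum_i' \sum_g y g i i' * ker1 j (quad_word K g j) (x i) (x i')).
  move=> yi.
  have := @leg_positivity R (B j) J (fun i => s i (j := j)) (fun i => s_sc i j) (@s_free j)
    n (option (option J * option J)) (@swap_inv J) (fun g => quad_word K g j) y
    (@swap_invK J) (fun g => quad_word_inv K g j) yi.
  by [].
have sw := @leg_swap R L n (option (option J * option J)) (seq J)
  (fun j => cs_space (B j)) (fun _ => fs R (seq J)) (fun j => 0) (fun _ => 0)
  ker0 ker1 (@swap_inv J) rev (quad_word K) (quad_word_inv K) k0rv k1rv lg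
  (quad_coef b c a) (quad_coef_inv b c a).
split=> h f.
  have h0 f' := (E0 f').2 (h f').
  exact: (E1 f).1 (sw.1 h0 f).
have h1 f' := (E1 f').2 (h f').
exact: (E0 f).1 (sw.2 h1 f).
Qed.

End NormTransfer.

(** * From spans of elementary tensors to all vectors *)

Section Density.
Variable R : realType.
Local Notation C := R[i].

Definition in_span (V : lmodType C) (T : Type) (f : T -> V) (x : V) :=
  exists (n : nat) (c : 'I_n -> C) (e : 'I_n -> T), x = \sum_(i < n) c i *: f (e i).

(** The index sets of the D components are put side by side, with zero coefficients elsewhere, since
    the quadratic form needs one list of tensors for all components. *)
Lemma common_span (V : lmodType C) (T : Type) (f : T -> V) (D : nat) (y : 'I_D -> V) :
  (forall d, in_span f (y d)) ->
  exists (n : nat) (a : 'I_D -> 'I_n -> C) (g : 'I_n -> T),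
    forall d, y d = \sum_(i < n) a d i *: f (g i).
Proof.
move=> H.
have H' d : exists t : {n : nat & (('I_n -> C) * ('I_n -> T))%type},
    y d = \sum_(i < projT1 t) (projT2 t).1 i *: f ((projT2 t).2 i).
  by have [n [c [e yE]]] := H d; exists (existT _ n (c, e)).
have [t Ht] := choice H'.
pose I := {d : 'I_D & 'I_(projT1 (t d))}.
pose coef (p : I) := (projT2 (t (tag p))).1 (tagged p).
pose elt (p : I) := (projT2 (t (tag p))).2 (tagged p).
exists #|{: I}|, (fun d i => if tag (enum_val i) == d then coef (enum_val i) else 0),
  (fun i => elt (enum_val i)) => d.
transitivity (\sum_(p : I) (if tag p == d then coef p else 0) *: f (elt p)); last first.
  exact: (big_enum_val (A := {: I}) (fun p => (if tag p == d then coef p else 0) *: f (elt p))).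
rewrite Ht.
transitivity (\sum_(d' : 'I_D) \sum_(k < projT1 (t d')) (if d' == d then (projT2 (t d')).1 k else 0)
   *: f ((projT2 (t d')).2 k)).
  rewrite (bigD1 d)//= eqxx [X in _ + X]big1 ?addr0// => d' /negbTE ->.
  by apply: big1 => k _; rewrite scale0r.
exact: (sig_big_dep (fun=> true) (fun _ _ => true)
  (fun d' k => (if d' == d then (projT2 (t d')).1 k else 0) *: f ((projT2 (t d')).2 k))).
Qed.

Lemma dense_bound (E F : ips R) (P : E -> F) (S : E -> Prop) (c : R) : 0 <= c ->
  linear P -> (exists2 C, 0 <= C & forall x, nrm (P x) <= C * nrm x) ->
  (forall x e, 0 < e -> exists2 z, S z & nrm (x - z) <= e) ->
  (forall z, S z -> nrm (P z) <= c * nrm z) -> forall x, nrm (P x) <= c * nrm x.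
Proof.
move=> c0 lP [C0 C00 PC] dS PS x; apply/ler_addgt0Pr => e e0.
(* The error is C0 |x - z| from the a priori bound plus c |x - z| from comparing |z| with |x|; the 1
   makes the divisor positive. *)
have cC0 : 0 < 1 + c + C0 by rewrite -addrA ltr_pwDl// addr_ge0.
have [z Sz xz] := dS x _ (divr_gt0 e0 cC0).
rewrite -(subrK z x) (linD lP) subrK; apply: le_trans (nrm_triangle _ _) _.
have h1 := PC (x - z); have h2 := PS z Sz.
have h3 : nrm z <= nrm x + nrm (x - z).
  by rewrite -{1}(subrK x z) -(nrmB z x) addrC; exact: nrm_triangle.
have n0 := nrm_ge0 (x - z).
have h4 : (1 + c + C0) * nrm (x - z) <= e by rewrite mulrC -ler_pdivlMr.
nra.
Qed.

Lemma tuple_dense (E : ips R) (S : E -> Prop) (D : nat) :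
  (forall x e, 0 < e -> exists2 z, S z & nrm (x - z) <= e) ->
  forall (x : ips_tuple E D) e, 0 < e ->
    exists2 z : ips_tuple E D, (forall d, S (z d)) & nrm (x - z) <= e.
Proof.
move=> dS x e e0; have e1 : 0 < e / D.+1%:R by rewrite divr_gt0.
have H d : exists z, S z /\ nrm (x d - z) <= e / D.+1%:R.
  by have [z ? ?] := dS (x d) _ e1; exists z.
have [z Hz] := choice H; exists z; first by move=> d; have [] := Hz d.
apply: le_trans (nrm_tuple_le _) _.
apply: (@le_trans _ _ (\sum_(d < D) e / D.+1%:R)).
  by apply: ler_sum => d _; have [] := Hz d.
rewrite sumr_const card_ord -[_ *+ D]mulr_natl mulrCA ler_piMr ?(ltW e0)//.
by rewrite ler_pdivrMr// mul1r ler_nat.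
Qed.

Lemma hilbert_dense (H : hilbert R) (S : set H) : dense S ->
  forall (x : ips_hilbert H) (e : R), 0 < e -> exists2 z, S z & nrm (x - z : ips_hilbert H) <= e.
Proof.
move=> dS x e e0.
have e0C : 0 < e%:RC :> C by rewrite ltcR.
have [] := dS (ball (x : H) e%:RC).
- by exists x; exact: ballxx.
- exact: ball_open.
move=> z [xz Sz]; exists z => //.
by move: xz; rewrite -ball_normE /= rnormE ltcR nrm_hilbert => /ltW.
Qed.

End Density.

Section MultiPencilBound.
Variables (R : realType) (J : finType) (E : ips R) (D : nat).
Variables (b : option J -> 'I_D -> 'I_D -> R[i]) (O : option J -> E -> E).
Hypothesis O_lin : forall al, linear (O al).

Lemma multi_pencil_linear : linear (multi_pencil b O).
Proof.
move=> k x y; apply/funext => d.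
have -> : (k *: multi_pencil b O x + multi_pencil b O y) d =
  k *: multi_pencil b O x d + multi_pencil b O y d by [].
rewrite /multi_pencil scaler_sumr -big_split; apply: eq_bigr => al _.
rewrite scaler_sumr -big_split; apply: eq_bigr => d' _.
by rewrite O_lin scalerDr !scalerA mulrC.
Qed.

Lemma multi_pencil_bounded : (forall al, exists2 c : R, 0 <= c & bnd_by c (O al)) ->
  exists2 C, 0 <= C & forall x, nrm (multi_pencil b O x) <= C * nrm x.
Proof.
move=> H.
have H' al : exists c : R, 0 <= c /\ bnd_by c (O al) by have [c ? ?] := H al; exists c.
have [c Hc] := choice H'.
exists (\sum_d \sum_al \sum_d' complex.Re `|b al d d'| * c al).
  apply: sumr_ge0 => d _; apply: sumr_ge0 => al _; apply: sumr_ge0 => d' _.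
  by rewrite mulr_ge0 ?Re_norm_ge0//; have [] := Hc al.
move=> x; apply: le_trans (nrm_tuple_le _) _; rewrite mulr_suml; apply: ler_sum => d _.
apply: le_trans (nrm_sum _ _ _) _; rewrite mulr_suml; apply: ler_sum => al _.
apply: le_trans (nrm_sum _ _ _) _; rewrite mulr_suml; apply: ler_sum => d' _.
have [c0 cb] := Hc al.
rewrite nrmZ -mulrA; apply: ler_wpM2l; first exact: Re_norm_ge0.
by apply: le_trans (cb _) _; apply: ler_wpM2l => //; exact: nrm_tuple_ge.
Qed.

End MultiPencilBound.

Section NormTransferFull.
Variables (R : realType) (L : nat) (J : finType) (K : J -> {set 'I_L}).
Local Notation C := R[i].
Variables (B : 'I_L -> cstar_prob R).
Variable W : hilbert_tensor (fun j => cs_space (B j)).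
Variable s : J -> forall j, cs_space (B j) -> cs_space (B j).
Hypothesis s_sc : forall i j, standard_semicircular (s i (j := j)).
Hypothesis s_free : forall j, free_family (fun i => s i (j := j)).
Variable term : J -> ht_space W -> ht_space W.
Hypothesis termP : forall i,
  is_tensor_op (fun j => if j \in K i then s i (j := j) else idfun) (term i).
Local Notation WI := (ips_hilbert (ht_space W)).
Local Notation X := {ffun 'I_L -> seq J}.
Local Notation XI := (ips_fs R X).
Variables (D : nat) (b : option J -> 'I_D -> 'I_D -> C).

Lemma term_opt_bounded al : exists2 c : R, 0 <= c & bnd_by c (term_opt term al).
Proof.
case: al => [i|] /=; last by exists 1 => // x; rewrite mul1r.
have [[_ [c Hc]] _] := termP i; exists `|c| => // x; rewrite !nrm_hilbert.
apply: le_trans (Hc x) _; apply: ler_wpM2r; last exact: ler_norm.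
by rewrite -nrm_hilbert nrm_ge0.
Qed.

(** A finitely supported vector is exactly a combination of elementary tensors. On the Hilbert side
    such combinations are only dense, and boundedness of the terms closes the gap. *)
Theorem norm_transfer (c : R) : 0 <= c ->
  (forall xi : ips_tuple WI D, nrm (multi_pencil b (term_opt term) xi) <= c * nrm xi) <->
  (forall xi : ips_tuple XI D, nrm (multi_pencil b (fock_opt K) xi) <= c * nrm xi).
Proof.
move=> c0; have st n (a : 'I_D -> 'I_n -> C) :=
  span_transfer (@s_sc) (@s_free) termP b c0 a.
split=> h.
  move=> xi; have [|n [a [g xiE]]] := @common_span R (fs R X) _ (fun f => tens f) D xi.
    move=> d; exists (size (supp (xi d))), (fun i => xi d (tnth (in_tuple (supp (xi d))) i)),
      (fun i j => fsdelta R (tnth (in_tuple (supp (xi d))) i j)).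
    rewrite {1}(fs_sum_delta (xi d)) big_tnth; apply: eq_bigr => i _.
    by rewrite tens_delta.
  have -> : xi = span_vec a (fun f => tens f : XI) g by apply/funext.
  by apply: (st n a).1 => f; exact: h.
have lP := multi_pencil_linear b (term_opt_linear termP).
have bP := multi_pencil_bounded b term_opt_bounded.
have dS := @tuple_dense R WI _ D (hilbert_dense (@ht_total _ _ _ W)).
apply: (dense_bound c0 lP bP dS).
move=> xi xiS; have [n [a [g xiE]]] := @common_span R (ht_space W) _ (ht_tens W) D xi xiS.
have -> : xi = span_vec a (fun f => ht_tens W f : WI) g by apply/funext.
by apply: (st n a).2 => f; exact: h.
Qed.

End NormTransferFull.

(** * Wold decomposition *)

Section RemoveLetter.
Variables (I : choiceType) (adj : rel I).
Hypothesis adj_sym : symmetric adj.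
Hypothesis adj_irr : irreflexive adj.
Local Notation cong := (raam_cong adj).

(* [w'] such that [w = v w'] in the monoid, if there is one. *)
Fixpoint rmv (v : I) (w : seq I) : option (seq I) :=
  if w is x :: w' then
    if x == v then Some w'
    else if adj x v then omap (cons x) (rmv v w') else None
  else None.

Lemma rmv_cat v u w : rmv v (u ++ w) =
  if rmv v u is Some u' then Some (u' ++ w)
  else if all (adj^~ v) u then omap (cat u) (rmv v w) else None.
Proof.
elim: u => [|x u IH] /=; first by case: (rmv v w).
case: eqVneq => // xv; case: (adj x v) => //=; rewrite IH.
case: (rmv v u) => //=; case: (all _ u) => //; by case: (rmv v w).
Qed.

Lemma rmv_sound v w w' : rmv v w = Some w' -> cong (v :: w') w.
Proof.
elim: w w' => [|x w IH] //= w'.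
case: eqVneq => [-> [->]|xv]; first exact: raam_refl.
case xva: (adj x v) => //; case E : (rmv v w) => [w0|//] /= [<-].
apply: (raam_trans (w := [:: x; v] ++ w0)).
  apply: (raam_cat (u := [:: v; x])); last exact: raam_refl.
  by apply: raam_comm; rewrite adj_sym.
exact: (raam_cat (raam_refl _ [:: x]) (IH _ E)).
Qed.

Lemma cong_all (P : pred I) u w : cong u w -> all P u = all P w.
Proof.
elim=> {u w} [//|u w _ ->//|u w z _ -> _ ->//|a b _|u u' w w' _ e1 _ e2] /=.
  by rewrite !andbT andbC.
by rewrite !all_cat e1 e2.
Qed.

Definition opt_cong (a b : option (seq I)) :=
  match a, b with Some u, Some w => cong u w | None, None => True | _, _ => False end.

(** Removal of a leading letter is thus well defined on the monoid; left cancellation, in the form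
    of [cong_cons], follows. *)
Lemma rmv_cong v u w : cong u w -> opt_cong (rmv v u) (rmv v w).
Proof.
elim=> {u w} [u|u w _|u w z _ h1 _ h2|a b ab|u u' w w' uu' h1 ww' h2].
- by case: (rmv v u) => //= ?; exact: raam_refl.
- by case: (rmv v u) => [?|]; case: (rmv v w) => [?|] //=; exact: raam_sym.
- move: h1 h2; case: (rmv v u) => [?|]; case: (rmv v w) => [?|] //=; case: (rmv v z) => [?|] //=.
  exact: raam_trans.
- have ba : b != a by apply: contraTneq ab => ->; rewrite adj_irr.
  rewrite /=; have [av|av] := eqVneq a v.
    by rewrite -av (negbTE ba) adj_sym ab /=; exact: raam_refl.
  have [bv|bv] := eqVneq b v; first by rewrite -bv ab /=; exact: raam_refl.
  by case: (adj a v); case: (adj b v).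
rewrite !rmv_cat (cong_all _ uu'); move: h1.
case: (rmv v u) => [x|]; case: (rmv v u') => [y|] //= h; first exact: raam_cat.
case: (all _ u') => //; move: h2.
by case: (rmv v w) => [x|]; case: (rmv v w') => [y|] //= ?; exact: raam_cat.
Qed.

Lemma rmv_head v w : rmv v (v :: w) = Some w.
Proof. by rewrite /= eqxx. Qed.

Lemma cong_cons v u w :
  cong (v :: u) w <-> exists2 w', rmv v w = Some w' & cong u w'.
Proof.
split=> [vuw|[w' E uw']].
  have := rmv_cong v vuw; rewrite rmv_head; case: (rmv v w) => //= w' uw'.
  by exists w'.
apply: raam_trans (rmv_sound E); exact: (raam_cat (raam_refl _ [:: v]) uw').
Qed.

Lemma cong_nil w : cong [::] w -> w = [::].
Proof. by case: w => // v w /(rmv_cong v); rewrite rmv_head. Qed.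

End RemoveLetter.

Section Wold.
Variables (R : realType) (E : ips R) (I : finType) (adj : rel I).
Hypothesis adj_sym : symmetric adj.
Hypothesis adj_irr : irreflexive adj.
Local Notation C := R[i].
Local Notation cong := (raam_cong adj).
Variables l ls : I -> E -> E.
Hypothesis l_lin : forall v, linear (l v).
Hypothesis l_adj : forall v, adjoint_pair (l v) (ls v).
Hypothesis l_iso : forall v x, ls v (l v x) = x.
Hypothesis l_comm : forall v w x, adj v w -> l v (l w x) = l w (l v x).
Hypothesis l_dcomm : forall v w x, adj v w -> ls v (l w x) = l w (ls v x).
Hypothesis l_orth : forall v w x, v != w -> ~~ adj v w -> ls v (l w x) = 0.

Lemma ls_lin v : linear (ls v). Proof. exact: adjoint_linear (@l_adj v). Qed.

Lemma ls_comm v w x : adj v w -> ls v (ls w x) = ls w (ls v x).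
Proof.
move=> vw; apply: ip_ext => z.
by rewrite !(adjoint_pair_sym (@l_adj _)) l_comm// adj_sym.
Qed.

Definition wandering (x : E) := forall v, ls v x = 0.

Definition lw (w : seq I) (x : E) : E := foldr l x w.

Lemma lw_lin w : linear (lw w).
Proof. by elim: w => [|v w IH] k x y //=; rewrite IH l_lin. Qed.

(** Moving [ls v] to the right, it cancels the first equal letter, passes adjacent ones, is killed
    by any other, and dies on a wandering vector: the recursion that defines [rmv]. *)
Lemma ls_lw v w x : wandering x ->
  ls v (lw w x) = oapp (lw ^~ x) 0 (rmv adj v w).
Proof.
move=> x0; elim: w => [|a w IH] /=; first exact: x0.
have [->|av] := eqVneq a v; first exact: l_iso.
case ava: (adj a v).
  by rewrite l_dcomm ?(adj_sym v)// IH; case: (rmv adj v w) => //=; rewrite (lin0 (l_lin a)).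
by rewrite l_orth// ?(eq_sym v)// adj_sym ava.
Qed.

(** The letters of [u] are peeled off one at a time, with left cancellation matching the two sides.
    Translates of the wandering space by distinct monoid elements are orthogonal, whichever words
    represent them. *)
Lemma ip_lw u w x y : wandering x -> wandering y ->
  ip (lw u x) (lw w y) = (raam_word adj u == raam_word adj w)%:R * ip x y.
Proof.
move=> x0 y0; elim: u w => [|v u IH] w /=.
  case: w => [|v w]; first by rewrite eqxx mul1r.
  rewrite -(adjoint_pair_sym (@l_adj v)) x0 ip0l.
  case: eqP => [/raam_wordP /(cong_nil adj_sym adj_irr)//|_]; by rewrite mul0r.
rewrite l_adj ls_lw//; case E0 : (rmv adj v w) => [w'|] /=.
  rewrite IH; congr ((nat_of_bool _)%:R * _); apply/eqP/eqP => /raam_wordP h; apply/raam_wordP.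
    by apply/(cong_cons adj_sym adj_irr); exists w'.
  by move/(cong_cons adj_sym adj_irr): h => [w'']; rewrite E0 => -[->].
rewrite ip0r; case: eqP => [/raam_wordP /(cong_cons adj_sym adj_irr) [w']|_].
  by rewrite E0.
by rewrite mul0r.
Qed.

Inductive wold : E -> Prop :=
| wold0 : wold 0
| wold_add w x y : wandering x -> wold y -> wold (lw w x + y).

Lemma woldD x y : wold x -> wold y -> wold (x + y).
Proof.
by elim=> [|w z t z0 _ IH] wy; rewrite ?add0r// -addrA; apply: wold_add => //; exact: IH.
Qed.

Lemma wold_l v x : wold x -> wold (l v x).
Proof.
elim=> [|w z t z0 _ IH]; first by rewrite (lin0 (l_lin v)); exact: wold0.
by rewrite (linD (l_lin v)); exact: (wold_add (v :: w)).
Qed.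

(** The product of the projections 1 - l_v ls_v; taken over all letters it maps into the wandering
    space. *)
Fixpoint defect (vs : seq I) (x : E) : E :=
  if vs is v :: vs' then defect vs' x - l v (ls v (defect vs' x)) else x.

Lemma ls_defect u vs x : u \in vs -> ls u (defect vs x) = 0.
Proof.
elim: vs => // v vs IH; rewrite inE /= (linB (ls_lin u)).
have [-> _|uv /= uvs] := eqVneq u v; first by rewrite l_iso subrr.
rewrite IH// sub0r; case uva: (adj u v).
  by rewrite l_dcomm// ls_comm// IH// (lin0 (ls_lin v)) (lin0 (l_lin v)) oppr0.
by rewrite l_orth ?oppr0// uva.
Qed.

Variable deg : nat -> E -> Prop.
Hypothesis deg0 : forall x, deg 0 x -> x = 0.
Hypothesis degB : forall n x y, deg n x -> deg n y -> deg n (x - y).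
Hypothesis deg_ls : forall n v x, deg n.+1 x -> deg n (ls v x).
Hypothesis deg_proj : forall n v x, deg n x -> deg n (l v (ls v x)).

(** The degree replaces the limit in the classical decomposition: x minus its full defect is a sum
    of terms l_v (ls_v y), and ls_v lowers the degree, so the recursion stops. *)
Theorem wold_decomposition n x : deg n x -> wold x.
Proof.
elim: n x => [|n IH] x dx; first by rewrite (deg0 dx); exact: wold0.
have key vs : deg n.+1 (defect vs x) /\ wold (x - defect vs x).
  elim: vs => [|v vs [d w]] /=; first by rewrite subrr; split=> //; exact: wold0.
  split; first by apply: degB => //; exact: deg_proj.
  by rewrite opprB addrCA addrC; apply: woldD => //; apply: wold_l; apply: IH; exact: deg_ls.
have [_ w] := key (enum I).
rewrite -(subrK (defect (enum I) x) x) addrC.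
apply: (wold_add [::]) => // v; by apply: ls_defect; rewrite mem_enum.
Qed.

End Wold.

Section PullExtra.
Variables (R : realType) (X : choiceType).

Lemma pull_ext (p q : pbij X) (f : fs R X) : p =1 q -> pull p f = pull q f.
Proof. by move=> pq; apply: fs_ext => x; rewrite !pullE pq. Qed.

End PullExtra.

(** * Creation operators on the tensor Fock space *)

Section Push.
Variables (L : nat) (J : choiceType).
Local Notation X := {ffun 'I_L -> seq J}.
Implicit Types (A B : {set 'I_L}) (x y : X).

Definition push i A x : X := [ffun j => if j \in A then i :: x j else x j].

Lemma shift_push i A x : shift i finset.set0 A x = Some (push i A x).
Proof.
apply/shiftP => j; rewrite inE ffunE.
by case: (j \in A).
Qed.

Lemma popP i A x y : shift i A finset.set0 x = Some y <-> x = push i A y.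
Proof.
rewrite shiftP; split=> [h|-> j]; last first.
  by rewrite inE ffunE; case: (j \in A).
by apply/ffunP => j; rewrite ffunE; have := h j; rewrite inE; case: (j \in A).
Qed.

Lemma push_comm i i' A B x : [disjoint A & B]%B ->
  push i A (push i' B x) = push i' B (push i A x).
Proof.
move=> dAB; apply/ffunP => j; rewrite !ffunE.
by case jA: (j \in A); rewrite // (disjointFr dAB jA).
Qed.

Lemma pop_push i i' A x : A != finset.set0 ->
  shift i' A finset.set0 (push i A x) = if i == i' then Some x else None.
Proof.
move=> /set0Pn[j jA]; case: eqVneq => [->|ii']; first exact/popP.
case E : (shift _ _ _ _) => [z|//]; move/popP : E => /ffunP /(_ j).
by rewrite !ffunE jA => -[] /eqP; rewrite (negbTE ii').
Qed.

Lemma pop_push_disjoint i i' A B x : [disjoint A & B]%B ->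
  shift i' B finset.set0 (push i A x) = omap (push i A) (shift i' B finset.set0 x).
Proof.
move=> dAB; case E : (shift i' B finset.set0 x) => [z|] /=.
  by move/popP : E => ->; apply/popP; exact: push_comm.
case E' : (shift _ _ _ _) => [z|//]; move/popP : E' => /ffunP h.
suff : shift i' B finset.set0 x = Some [ffun j => if j \in B then z j else x j] by rewrite E.
apply/popP/ffunP => j; rewrite !ffunE; have := h j; rewrite !ffunE.
by case jB: (j \in B) => //; rewrite (disjointFl dAB jB).
Qed.

Lemma pop_push_overlap i i' A B x : i != i' -> ~~ [disjoint A & B]%B ->
  shift i' B finset.set0 (push i A x) = None.
Proof.
rewrite -finset.setI_eq0 => ii' /set0Pn[j]; rewrite inE => /andP[jA jB].
case E : (shift _ _ _ _) => [z|//]; move/popP : E => /ffunP /(_ j).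
by rewrite !ffunE jA jB => -[] /eqP; rewrite (negbTE ii').
Qed.

Definition weight x := (\sum_j size (x j))%N.

Lemma weight_push i A x : weight (push i A x) = (weight x + #|A|)%N.
Proof.
rewrite /weight -sum1_card [X in _ = (_ + X)%N]big_mkcond -big_split /=.
by apply: eq_bigr => j _; rewrite ffunE; case: ifP => _; rewrite ?addn0 ?addn1.
Qed.

End Push.

Section Creation.
Variables (R : realType) (L V T : nat) (K : 'I_V -> {set 'I_L}).
Hypothesis K_neq0 : forall v, K v != finset.set0.
Hypothesis T_gt0 : (0 < T)%N.
Local Notation C := R[i].
Local Notation J := ('I_V * 'I_T)%type.
Local Notation X := {ffun 'I_L -> seq J}.
Local Notation F := (fs R X).
Local Notation XI := (ips_fs R X).

Definition rsqrt : C := ((Num.sqrt T%:R)^-1)%:RC.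

Lemma rsqrt_conj : rsqrt^* = rsqrt.
Proof. by apply/CrealP/complex_realP; exists (Num.sqrt T%:R)^-1. Qed.

Lemma rsqrtK : rsqrt * rsqrt * T%:R = 1.
Proof.
have T0 : 0 < T%:R :> R by rewrite ltr0n.
have e : (T%:R)%:RC = T%:R :> C by rewrite rmorph_nat.
rewrite -e -!rmorphM -invfM -expr2 sqr_sqrtr ?ltW// mulVf ?lt0r_neq0//.
Qed.

(* [pull p f] is [f \o p], so a letter is created by pulling back along its removal. *)
Definition hcreate v (f : F) : F :=
  rsqrt *: \sum_t pull (shift_bij (v, t) (K v) (K v)) f.
Definition hannih v (f : F) : F :=
  rsqrt *: \sum_t pull (shift_bij (v, t) (K v) finset.set0) f.

Lemma hcreateE v f x :
  hcreate v f x = rsqrt * \sum_t oapp f 0 (shift (v, t) (K v) finset.set0 x).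
Proof.
rewrite fsZ fs_sum; congr (_ * _); apply: eq_bigr => t _.
by rewrite pullE /= finset.setDv.
Qed.

Lemma hannihE v f x : hannih v f x = rsqrt * \sum_t f (push (v, t) (K v) x).
Proof.
rewrite fsZ fs_sum; congr (_ * _); apply: eq_bigr => t _.
by rewrite pullE /= finset.setD0 shift_push.
Qed.

Lemma hcreate_linear v : linear (hcreate v).
Proof.
move=> k f g; rewrite /hcreate scalerA mulrC -scalerA -scalerDr; congr (_ *: _).
rewrite scaler_sumr -big_split; apply: eq_bigr => t _; exact: pull_linear.
Qed.

Lemma hcreate_adjoint v : @adjoint_pair R XI (hcreate v) (hannih v).
Proof.
move=> f g; rewrite /hcreate /hannih (@ipZl R XI) (@ipZr R XI) rsqrt_conj; congr (_ * _).
rewrite (@ip_suml R XI) (@ip_sumr R XI); apply: eq_bigr => t _.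
rewrite pull_adjoint; congr ip; apply: pull_ext => x /=.
by rewrite finset.setDv finset.setD0.
Qed.

Lemma hannih_linear v : linear (hannih v).
Proof. exact: (@adjoint_linear R XI _ _ (@hcreate_adjoint v)). Qed.

(** As K_v is nonempty, a letter (v, t) can only be undone with the same t; this leaves T equal
    terms, each with the factor 1 / T. *)
Lemma hannih_create v f : hannih v (hcreate v f) = f.
Proof.
apply: fs_ext => x; rewrite hannihE.
transitivity (rsqrt * \sum_(t < T) (rsqrt * f x)).
  congr (_ * _); apply: eq_bigr => t _; rewrite hcreateE; congr (_ * _).
  rewrite (bigD1 t)//= pop_push// eqxx /= big1 ?addr0// => t' t't.
  by rewrite pop_push// xpair_eqE eqxx eq_sym (negbTE t't).
rewrite sumr_const card_ord -[_ *+ T]mulr_natl.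
transitivity (rsqrt * rsqrt * T%:R * f x); first by ring.
by rewrite rsqrtK mul1r.
Qed.

Lemma hannih_comm v w f : [disjoint K v & K w]%B ->
  hannih v (hannih w f) = hannih w (hannih v f).
Proof.
move=> dvw; apply: fs_ext => x; rewrite !hannihE.
under eq_bigr do rewrite hannihE; under [in RHS]eq_bigr do rewrite hannihE.
rewrite -!mulr_sumr exchange_big; do 2 congr (_ * _).
apply: eq_bigr => t _; apply: eq_bigr => t' _.
by congr (f _); apply: push_comm; rewrite // disjoint_sym.
Qed.

Lemma hcreate_comm v w f : [disjoint K v & K w]%B ->
  hcreate v (hcreate w f) = hcreate w (hcreate v f).
Proof.
move=> dvw; apply: (@ip_ext R XI) => g.
by rewrite !hcreate_adjoint (hannih_comm _ dvw).
Qed.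

Lemma hannih_create_disjoint v w f : [disjoint K v & K w]%B ->
  hannih v (hcreate w f) = hcreate w (hannih v f).
Proof.
move=> dvw; apply: fs_ext => x; rewrite hannihE hcreateE.
under eq_bigr do rewrite hcreateE; rewrite -mulr_sumr exchange_big mulr_sumr.
congr (_ * _); apply: eq_bigr => t _.
transitivity (rsqrt * \sum_(t' < T) oapp (fun y => f (push (v, t') (K v) y)) 0
   (shift (w, t) (K w) finset.set0 x)).
  congr (_ * _); apply: eq_bigr => t' _; rewrite pop_push_disjoint//.
  by case: (shift _ _ _ x).
case: (shift _ _ _ x) => [y|]; first by symmetry; exact: hannihE.
by rewrite big1 ?mulr0.
Qed.

Lemma hannih_create_overlap v w f : v != w -> ~~ [disjoint K v & K w]%B ->
  hannih v (hcreate w f) = 0.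
Proof.
move=> vw dvw; apply: fs_ext => x; rewrite hannihE fs0.
rewrite big1 ?mulr0// => t _; rewrite hcreateE big1 ?mulr0// => t' _.
by rewrite pop_push_overlap// xpair_eqE (negbTE vw).
Qed.

(** Support in total length strictly below [n], so that degree 0 forces zero. An annihilator lowers
    it because each K_v is nonempty. *)
Definition hdeg n (f : F) := forall x, (n <= weight x)%N -> f x = 0.

Lemma hdeg0 f : hdeg 0 f -> f = 0.
Proof. by move=> h; apply: fs_ext => x; exact: h. Qed.

Lemma hdegB n f g : hdeg n f -> hdeg n g -> hdeg n (f - g).
Proof. by move=> hf hg x nx; rewrite fsB hf// hg// subrr. Qed.

Lemma hdeg_annih n v f : hdeg n.+1 f -> hdeg n (hannih v f).
Proof.
move=> hf x nx; rewrite hannihE big1 ?mulr0// => t _; apply: hf.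
by rewrite weight_push -addn1 leq_add// card_gt0 K_neq0.
Qed.

Lemma hdeg_proj n v f : hdeg n f -> hdeg n (hcreate v (hannih v f)).
Proof.
move=> hf x nx; rewrite hcreateE big1 ?mulr0// => t _.
case E : (shift _ _ _ _) => [y|//]; move/popP : E nx => -> nx.
rewrite [LHS]hannihE big1 ?mulr0// => t' _; apply: hf.
by move: nx; rewrite !weight_push.
Qed.

Lemma hdeg_ex f : exists n, hdeg n f.
Proof.
exists (\max_(x <- supp f) weight x).+1 => x nx; apply: suppN; apply/negP => xs.
by move: nx; rewrite ltnNge => /negP; apply; exact: leq_bigmax_seq.
Qed.

Local Notation adj := (hayes_graph K).

Lemma hayes_graph_sym : symmetric adj.
Proof. by move=> v w; rewrite /hayes_graph eq_sym disjoint_sym. Qed.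

Lemma hayes_graph_irr : irreflexive adj.
Proof. by move=> v; rewrite /hayes_graph eqxx. Qed.

Lemma hcreate_comm_adj v w f : adj v w -> hcreate v (hcreate w f) = hcreate w (hcreate v f).
Proof. by move=> /andP[_]; exact: hcreate_comm. Qed.

Lemma hannih_create_adj v w f : adj v w -> hannih v (hcreate w f) = hcreate w (hannih v f).
Proof. by move=> /andP[_]; exact: hannih_create_disjoint. Qed.

Lemma hannih_create_nadj v w f : v != w -> ~~ adj v w -> hannih v (hcreate w f) = 0.
Proof. by rewrite /hayes_graph => vw; rewrite vw /=; exact: hannih_create_overlap. Qed.

Theorem hayes_wold f : @wold R XI _ hcreate hannih f.
Proof.
have [n hn] := hdeg_ex f.
apply: (@wold_decomposition R XI _ adj hayes_graph_sym _ _ hcreate_linear hcreate_adjoint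
  hannih_create hcreate_comm_adj hannih_create_adj hannih_create_nadj
  hdeg hdeg0 hdegB hdeg_annih hdeg_proj n) => //.
Qed.

End Creation.

(** * The graph product Fock space and the intertwining *)

Section GraphFock.
Variables (R : realType) (V : nat) (adj : rel 'I_V).
Hypothesis adj_sym : symmetric adj.
Hypothesis adj_irr : irreflexive adj.
Variable G : graph_fock R adj.
Local Notation HI := (ips_hilbert (gf_space G)).
Local Notation word := (raam_word adj).

Definition wdelta (w : seq 'I_V) : HI := l2_delta (gf_space G) (word w).

Lemma delta_ext (x y : HI) : (forall w, ip x (wdelta w) = ip y (wdelta w)) -> x = y.
Proof.
move=> xy; apply/subr0_eq/nrm_eq0; set d := x - y.
have d0 w : ip d (wdelta w) = 0 by rewrite /d ipBl xy subrr.
have := nrm_ge0 d; rewrite le_eqVlt => /orP[/eqP//|dp].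
(* A combination of basis vectors within half the norm of [d], yet orthogonal to [d], which is
   impossible. *)
have [z [n [c [e zE]]] dz] := hilbert_dense (@l2_total _ _ (gf_space G)) d (divr_gt0 dp (ltr0Sn R 1)).
have z0 : ip d z = 0.
  rewrite zE (@ip_sumr R HI) big1// => i _; rewrite (@ipZr R HI).
  by have := d0 (repr (e i))%qT; rewrite /wdelta raam_wordK => ->; rewrite mulr0.
have : nrm d ^+ 2 <= nrm d * (nrm d / 2).
  rewrite sqr_nrm -[X in complex.Re X]subr0 -{1}z0 -ipBr.
  apply: le_trans (Re_ip_le _ _) _; apply: ler_wpM2l => //; exact: ltW.
move=> h; exfalso; nra.
Qed.

Lemma wdelta_ip u w : ip (wdelta u) (wdelta w) = (word u == word w)%:R.
Proof. exact: l2_orthonormal. Qed.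

Lemma gf_l_word v w : gf_l G v (wdelta w) = wdelta (v :: w).
Proof.
by rewrite /wdelta gf_l_delta; congr l2_delta; exact: (raam_mul_word adj [:: v] w).
Qed.

(** The annihilation part is known only as an adjoint; it is identified by testing against the
    basis, where left cancellation in the monoid makes it the removal of v. *)
Lemma graph_op_word v w : graph_op G v (wdelta w) =
  wdelta (v :: w) + oapp wdelta 0 (rmv adj v w) :> HI.
Proof.
rewrite /graph_op gf_l_word; congr (_ + _); apply: delta_ext => u.
have h : @adjoint_pair R HI (gf_l G v) (gf_l_star G v) by exact: gf_adjoint.
rewrite (adjoint_pair_sym h) gf_l_word wdelta_ip.
case E : (rmv adj v w) => [w'|]; rewrite [oapp _ _ _]/=.
  rewrite wdelta_ip; congr ((nat_of_bool _)%:R).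
  apply/eqP/eqP => /esym /raam_wordP e; apply/esym/raam_wordP.
    by move/(cong_cons adj_sym adj_irr) : e => [w'']; rewrite E => -[<-].
  by apply/(cong_cons adj_sym adj_irr); exists w'.
rewrite ip0l; case: eqP => // /esym /raam_wordP /(cong_cons adj_sym adj_irr) [w'].
by rewrite E.
Qed.

Lemma graph_op_linear v : linear (graph_op G v : HI -> HI).
Proof.
move=> k x y; have [l1 _] := gf_l_bounded G v; have [l2 _] := gf_l_star_bounded G v.
by rewrite /graph_op l1 l2 scalerDr addrACA.
Qed.

Lemma graph_op_bounded v : exists2 c : R, 0 <= c & @bnd_by R HI c (graph_op G v).
Proof.
have [_ [c1 h1]] := gf_l_bounded G v; have [_ [c2 h2]] := gf_l_star_bounded G v.
exists (`|c1| + `|c2|) => [|x]; first by rewrite addr_ge0.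
apply: le_trans (@nrm_triangle R HI _ _) _; rewrite mulrDl.
have n0 := @nrm_ge0 R HI x; rewrite !nrm_hilbert in n0 *; apply: lerD.
  by apply: le_trans (h1 x) _; apply: ler_wpM2r => //; exact: ler_norm.
by apply: le_trans (h2 x) _; apply: ler_wpM2r => //; exact: ler_norm.
Qed.

End GraphFock.

Section WoldCorrespondence.
Variables (R : realType) (L V T : nat) (K : 'I_V -> {set 'I_L}).
Hypothesis K_neq0 : forall v, K v != finset.set0.
Hypothesis T_gt0 : (0 < T)%N.
Variable G : graph_fock R (hayes_graph K).
Local Notation C := R[i].
Local Notation J := ('I_V * 'I_T)%type.
Local Notation X := {ffun 'I_L -> seq J}.
Local Notation F := (fs R X).
Local Notation XI := (ips_fs R X).
Local Notation adj := (hayes_graph K).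
Local Notation HI := (ips_hilbert (gf_space G)).
Local Notation wdelta := (@wdelta R V adj G).
Let asym := @hayes_graph_sym L V K.
Let airr := @hayes_graph_irr L V K.

(* [corr s x psi]: writing [x = \sum_i L_{w_i} eta_i] with the [eta_i] killed by
   all the annihilators, [psi p = \sum_i eta_i(p) delta_{w_i}]; this is the Wold
   decomposition of [x], followed by the coordinates [p] of the multiplicity
   space, which are supported in [s]. *)
Inductive corr (s : seq X) : XI -> (X -> HI) -> Prop :=
| corr0 : corr s 0 (fun=> 0)
| corrS w eta x psi : @wandering R XI _ (@hannih R L V T K) eta ->
    (forall p, p \notin s -> (eta : F) p = 0) -> corr s x psi ->
    corr s (@lw R XI _ (@hcreate R L V T K) w eta + x) (fun p => (eta : F) p *: wdelta w + psi p).

Lemma corr_ext s x psi psi' : psi =1 psi' -> corr s x psi -> corr s x psi'.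
Proof. by move=> /funext ->. Qed.

Lemma corrD s x psi y phi : corr s x psi -> corr s y phi ->
  corr s (x + y) (fun p => psi p + phi p).
Proof.
move=> cx cy; elim: cx => [|w eta z chi eta0 etas _ IH].
  by rewrite add0r; apply: corr_ext cy => p; rewrite add0r.
rewrite -addrA; apply: corr_ext (corrS w eta0 etas IH) => p; by rewrite addrA.
Qed.

Lemma wanderingZ k eta : @wandering R XI _ (@hannih R L V T K) eta ->
  @wandering R XI _ (@hannih R L V T K) (k *: eta).
Proof. by move=> h v; rewrite (@linZ R XI XI _ (@hannih_linear R L V T K v)) h scaler0. Qed.

Lemma corrZ s k x psi : corr s x psi -> corr s (k *: x) (fun p => k *: psi p).
Proof.
elim=> [|w eta z chi eta0 etas _ IH].
  by rewrite scaler0; apply: corr_ext (corr0 s) => p; rewrite scaler0.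
rewrite scalerDr -(@linZ R XI XI _ (@lw_lin R XI _ (@hcreate R L V T K) (@hcreate_linear R L V T K) w)).
apply: corr_ext (corrS w (wanderingZ k eta0) _ IH) => p.
  by rewrite scalerDr scalerA.
by move=> ps; rewrite fsZ etas// mulr0.
Qed.

Lemma corr_sum s (I : Type) (r : seq I) (x : I -> XI) (psi : I -> X -> HI) :
  (forall i, corr s (x i) (psi i)) ->
  corr s (\sum_(i <- r) x i) (fun p => \sum_(i <- r) psi i p).
Proof.
move=> h; elim: r => [|i r IH].
  by rewrite big_nil; apply: corr_ext (corr0 s) => p; rewrite big_nil.
by rewrite big_cons; apply: corr_ext (corrD (h i) IH) => p; rewrite big_cons.
Qed.

(** On either side the operator adds v to the word and removes v from it when possible, by [ls_lw]
    here and [graph_op_word] there; the wandering component is untouched. *)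
Lemma corr_op s v x psi : corr s x psi ->
  corr s (hcreate K v x + hannih K v x) (fun p => graph_op G v (psi p)).
Proof.
have lc := @hcreate_linear R L V T K; have la := @hannih_linear R L V T K.
elim=> [|w eta z chi eta0 etas _ IH].
  rewrite (@lin0 R XI XI _ (lc v)) (@lin0 R XI XI _ (la v)) addr0.
  apply: corr_ext (corr0 s) => p.
  by rewrite (@lin0 R HI HI _ (graph_op_linear v)).
rewrite (@linD R XI XI _ (lc v)) (@linD R XI XI _ (la v)) addrACA.
pose chi' p := (eta : F) p *: (wdelta (v :: w) + oapp wdelta 0 (rmv adj v w)).
apply: corr_ext (corrD (psi := chi') _ IH) => [p|].
  rewrite (@linD R HI HI _ (graph_op_linear v)) (@linZ R HI HI _ (graph_op_linear v)).
  by congr (_ + _); rewrite graph_op_word.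
have ls := @ls_lw R XI _ adj asym (@hcreate R L V T K) (@hannih R L V T K)
  lc (hannih_create K_neq0 T_gt0) (@hannih_create_adj R L V T K)
  (@hannih_create_nadj R L V T K) v w eta eta0.
rewrite ls.
have c1 : corr s (@lw R XI _ (@hcreate R L V T K) (v :: w) eta) (fun p => (eta : F) p *: wdelta (v :: w)).
  rewrite -[X in corr _ X]addr0; apply: corr_ext (corrS (v :: w) eta0 etas (corr0 s)) => p.
  by rewrite addr0.
have c2 : corr s (oapp ((@lw R XI _ (@hcreate R L V T K)) ^~ eta) 0 (rmv adj v w))
    (fun p => (eta : F) p *: oapp wdelta 0 (rmv adj v w)).
  case: (rmv adj v w) => [w'|] /=; last first.
    by apply: corr_ext (corr0 s) => p; rewrite scaler0.
  rewrite -[X in corr _ X]addr0; apply: corr_ext (corrS w' eta0 etas (corr0 s)) => p.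
  by rewrite addr0.
by apply: corr_ext (corrD c1 c2) => p; rewrite /chi' scalerDr.
Qed.

Lemma corr_mono s s' x psi : {subset s <= s'} -> corr s x psi -> corr s' x psi.
Proof.
move=> ss'; elim=> [|w eta z chi eta0 etas _ IH]; first exact: corr0.
apply: corrS => // p ps'; apply: etas; apply: contra ps'; exact: ss'.
Qed.

(** By [ip_lw] the words contribute as basis vectors of the graph Fock space, and the inner product
    of wandering components is a sum over the points of [s]. So [corr] is isometric whichever
    decompositions are chosen. *)
Lemma corr_ip s x psi y phi : uniq s -> corr s x psi -> corr s y phi ->
  ip x y = \sum_(p <- s) ip (psi p) (phi p).
Proof.
move=> us cx cy; elim: cx => [|w eta z chi eta0 etas _ IHx].
  by rewrite ip0l big1// => p _; rewrite ip0l.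
rewrite ipDl IHx; under [RHS]eq_bigr do rewrite ipDl; rewrite [RHS]big_split; congr (_ + _).
elim: cy {IHx} => [|w' eta' z' chi' eta0' etas' _ IHy].
  by rewrite ip0r big1// => p _; rewrite ip0r.
rewrite ipDr IHy; under [RHS]eq_bigr do rewrite ipDr; rewrite [RHS]big_split; congr (_ + _).
rewrite (@ip_lw R XI _ adj asym airr (@hcreate R L V T K) (@hannih R L V T K)
  (@hcreate_linear R L V T K) (@hcreate_adjoint R L V T K)
  (hannih_create K_neq0 T_gt0) (@hannih_create_adj R L V T K)
  (@hannih_create_nadj R L V T K))//.
have -> : ip eta eta' = \sum_(p <- s) (eta : F) p * ((eta' : F) p)^*.
  by apply: fsipE => // p ps; rewrite etas// mul0r.
rewrite mulr_sumr; apply: eq_bigr => p _.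
by rewrite (@ipZl R HI) (@ipZr R HI) wdelta_ip mulrC mulrA.
Qed.

Lemma corr_ex (x : XI) : exists s psi, corr s x psi.
Proof.
have := @hayes_wold R L V T K K_neq0 T_gt0 x.
elim=> [|w eta z eta0 _ [s [psi IH]]]; first by exists [::], (fun=> 0); exact: corr0.
exists (supp (eta : F) ++ s), (fun p => (eta : F) p *: wdelta w + psi p).
apply: corrS => //; last by apply: corr_mono IH => p; rewrite mem_cat orbC => ->.
by move=> p; rewrite mem_cat negb_or => /andP[/suppN].
Qed.

Definition vacuum : X := [ffun=> [::]].

Lemma vacuum_wandering : @wandering R XI _ (@hannih R L V T K) (fsdelta R vacuum).
Proof.
move=> v; apply: fs_ext => x; rewrite hannihE fs0 big1 ?mulr0// => t _.
rewrite fsdeltaE; case: eqVneq => // /ffunP h.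
have /set0Pn[j jK] := K_neq0 v.
by have := h j; rewrite !ffunE jK.
Qed.

(** The vacuum is a unit wandering vector, so its translates form a copy of the graph Fock basis.
    This copy serves to bound the graph pencil by the Fock one. *)
Lemma corr_span (z : HI) : lin_span (l2_delta (gf_space G)) z ->
  exists x, corr [:: vacuum] x (fun p => if p == vacuum then z else 0).
Proof.
move=> [n [c [e ->]]].
have h i : corr [:: vacuum] (c i *: @lw R XI _ (@hcreate R L V T K) (repr (e i))%qT (fsdelta R vacuum))
    (fun p => if p == vacuum then c i *: l2_delta (gf_space G) (e i) else 0).
  have out p : p \notin [:: vacuum] -> fsdelta R vacuum p = 0.
    by rewrite inE fsdeltaE => /negbTE ->.
  have := corrZ (c i) (corrS (repr (e i))%qT vacuum_wandering out (corr0 [:: vacuum])).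
  rewrite addr0; apply: corr_ext => p; rewrite addr0 fsdeltaE /wdelta raam_wordK.
  by case: eqP => _; rewrite ?scale1r// scale0r scaler0.
exists (\sum_(i < n) c i *: @lw R XI _ (@hcreate R L V T K) (repr (e i))%qT (fsdelta R vacuum)).
apply: corr_ext (corr_sum (index_enum _) h) => p.
by case: eqP => // _; rewrite big1.
Qed.

End WoldCorrespondence.

Section UnionPbij.
Variables (R : realType) (X : choiceType) (I : finType) (p : I -> pbij X).
Hypothesis dom_disj : forall t t' x y y', p t x = Some y -> p t' x = Some y' -> t = t'.
Hypothesis ran_disj : forall t t' x y y',
  pbij_inv (p t) x = Some y -> pbij_inv (p t') x = Some y' -> t = t'.

Let union (q : I -> X -> option X) x :=
  if [pick t | q t x != None] is Some t then q t x else None.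

Let unionP (q : I -> X -> option X) x y :
  (forall t t' x y y', q t x = Some y -> q t' x = Some y' -> t = t') ->
  union q x = Some y <-> exists t, q t x = Some y.
Proof.
move=> dq; rewrite /union; case: pickP => [t|h]; last first.
  by split=> // -[t e]; have := h t; rewrite e.
case E : (q t x) => [z|//] _; split=> [e|[t' e]]; first by exists t; rewrite -e.
by rewrite -e -(dq _ _ _ _ _ E e).
Qed.

Fact union_pbij x y : union p x = Some y <-> union (fun t => pbij_inv (p t)) y = Some x.
Proof. by rewrite !unionP//; split=> -[t /pbijP h]; exists t. Qed.

Lemma pull_union : exists q : pbij X, forall f : fs R X, \sum_t pull (p t) f = pull q f.
Proof.
exists (Pbij union_pbij) => f; apply: fs_ext => x; rewrite fs_sum pullE /=.
case E : (union p x) => [y|] /=.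
  have /(unionP _ _ dom_disj)[t h] := E.
  rewrite (bigD1 t)//= h big1 ?addr0// => t' t't.
  by case E' : (p t' x) => [z|//]; rewrite (dom_disj E' h) eqxx in t't.
rewrite big1// => t _; case E' : (p t x) => [z|//].
have : union p x = Some z by apply/unionP => //; exists t.
by rewrite E.
Qed.

End UnionPbij.

(** * Comparison of the pencils *)

Section MixedTerms.
Variables (R : realType) (L V T : nat) (K : 'I_V -> {set 'I_L}).
Local Notation C := R[i].
Local Notation J := ('I_V * 'I_T)%type.
Local Notation X := {ffun 'I_L -> seq J}.
Local Notation F := (fs R X).
Local Notation XI := (ips_fs R X).

Definition mixed v (A : {set 'I_L}) (f : F) : F :=
  \sum_t pull (shift_bij (v, t) (K v) A) f.

(** A leg in [A] displays the letter (v, t) in front, which determines t. Exchanging [A] and [B]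
    gives the same for ranges; both sets are nonempty exactly for the mixed terms. *)
Lemma shift_dom_disj v t t' (A B : {set 'I_L}) (x : X) y y' : A != finset.set0 ->
  shift (v, t) A B x = Some y -> shift (v, t') A B x = Some y' -> t = t'.
Proof.
move=> /set0Pn[j jA] /shiftP /(_ j) + /shiftP /(_ j); rewrite jA => e1 e2.
by move: e1; rewrite e2 => -[->].
Qed.

Lemma mixed_contraction v (A : {set 'I_L}) : A != finset.set0 -> K v :\: A != finset.set0 ->
  @bnd_by R XI 1 (mixed v A).
Proof.
move=> A0 KA0 f.
have [q qE] := @pull_union R X _ (fun t : 'I_T => shift_bij (v, t) (K v) A)
  (fun t t' x y y' => @shift_dom_disj v t t' A (K v :\: A) x y y' A0)
  (fun t t' x y y' => @shift_dom_disj v t t' (K v :\: A) A x y y' KA0).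
by rewrite /mixed qE; exact: pull_contraction.
Qed.

Definition mixed_sets v : pred {set 'I_L} :=
  fun A => [&& A \subset K v, A != finset.set0 & A != K v].

Lemma mixed_setsP v A : mixed_sets v A -> A != finset.set0 /\ K v :\: A != finset.set0.
Proof.
move=> /and3P[AK A0 AnK]; split=> //.
by rewrite finset.setD_eq0; apply: contra AnK => KA; rewrite finset.eqEsubset AK.
Qed.

Lemma card_mixed_sets v : K v != finset.set0 -> (#|mixed_sets v| <= 2 ^ L - 2)%N.
Proof.
move=> K0.
(* The two missing subsets are the empty set, for annihilation, and K_v, for creation, distinct
   because K_v is nonempty. *)
have e : (#|mixed_sets v| + 2 = 2 ^ #|K v|)%N.
  rewrite -card_powerset (cardsD1 finset.set0) (cardsD1 (K v)) !inE finset.sub0set subxx K0 /=.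
  rewrite addnC -addn2; congr (_ + _)%N; apply: eq_card => A; rewrite !inE.
  by rewrite /mixed_sets unfold_in; case: (A \subset _); rewrite ?andbF ?andbT//= andbC.
have : (2 ^ #|K v| <= 2 ^ L)%N.
  by rewrite leq_exp2l//; have := max_card (mem (K v)); rewrite card_ord.
by rewrite -e => h; rewrite -(addnK 2 #|_|) leq_sub2r.
Qed.

Definition fock_hayes v (f : F) : F := rsqrt R T *: \sum_t fockK (v, t) (K v) f.

Lemma fock_hayesE v f : K v != finset.set0 -> fock_hayes v f =
  hcreate K v f + hannih K v f + rsqrt R T *: \sum_(A | mixed_sets v A) mixed v A f.
Proof.
move=> K0; rewrite /fock_hayes /hcreate /hannih -!scalerDr; congr (_ *: _).
rewrite /fockK exchange_big (bigD1 (K v))//= (bigD1 finset.set0) /=; last first.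
  by rewrite finset.sub0set eq_sym.
rewrite addrA; congr (_ + _); apply: eq_bigl => A.
by rewrite /mixed_sets; case: (A \subset _) => //=; rewrite andbC.
Qed.

End MixedTerms.

(** * Matrix coefficients and operator norms *)

Section Amplification.
Variable R : realType.
Local Notation C := R[i].

Fact mulC_lin (k x y z : C^o) : (k *: x + y) * z^* = k * (x * z^*) + y * z^*.
Proof. by rewrite mulrDl mulrA. Qed.
Fact mulC_conj (x y : C^o) : y * x^* = (x * y^*)^*.
Proof. by rewrite rmorphM /= conjCK mulrC. Qed.
Fact mulC_ge0 (x : C^o) : 0 <= x * x^*.
Proof. by rewrite -normCK exprn_ge0. Qed.
Fact mulC_eq0 (x : C^o) : x * x^* = 0 -> x = 0.
Proof. by rewrite -normCK => /eqP; rewrite expf_eq0 /= normr_eq0 => /eqP. Qed.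

Definition ips_C : ips R := Ips C^o (fun x y => x * y^*) mulC_lin mulC_conj mulC_ge0 mulC_eq0.

Lemma nrm_C (x : C) : nrm (x : ips_C) = rnorm (x : C).
Proof.
rewrite /nrm /= -normCK /rnorm Re_normE -rmorphXn /= sqrtr_sqr ger0_norm//.
exact: Re_norm_ge0.
Qed.

Variables (X : choiceType) (D : nat).
Local Notation XI := (ips_fs R X).

(** The matrix acts separately on the slice of [xi] at each basis point; the bounds on the slices
    are squared and summed. *)
Lemma amplification_bound (a : 'I_D -> 'I_D -> C) (c : R) : 0 <= c ->
  (forall z : ips_tuple ips_C D, nrm ((fun d => \sum_k a d k * z k) : ips_tuple ips_C D) <= c * nrm z) ->
  forall xi : ips_tuple XI D,
    nrm ((fun d => \sum_k a d k *: xi k) : ips_tuple XI D) <= c * nrm xi.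
Proof.
move=> c0 ha xi.
pose s := undup (flatten [seq supp (xi d : fs R X) | d <- enum 'I_D]).
have us : uniq s by exact: undup_uniq.
have out p d : p \notin s -> (xi d : fs R X) p = 0.
  move=> ps; apply: suppN; apply: contra ps => pd; rewrite mem_undup.
  by apply/flattenP; exists (supp (xi d : fs R X)) => //; apply: map_f; rewrite mem_enum.
have sumE (zeta : ips_tuple XI D) : (forall p d, p \notin s -> (zeta d : fs R X) p = 0) ->
    ip zeta zeta = \sum_(p <- s) ip ((fun d => (zeta d : fs R X) p) : ips_tuple ips_C D)
      (fun d => (zeta d : fs R X) p).
  move=> zs; rewrite [RHS]exchange_big; apply: eq_bigr => d _.
  by apply: fsipE => // p ps; rewrite zs// mul0r.
rewrite -(ler_pXn2r (n := 2)) ?nnegrE ?mulr_ge0 ?nrm_ge0// exprMn -lecR [X in _ <= X](rmorphM (real_complex R)) /=.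
rewrite -!ip_nrm !sumE//; last first.
  by move=> p d ps; rewrite fs_sum big1// => k _; rewrite fsZ out// mulr0.
rewrite mulr_sumr; apply: ler_sum => p _.
rewrite !ip_nrm -rmorphM lecR -exprMn ler_pXn2r ?nnegrE ?mulr_ge0 ?nrm_ge0//.
apply: le_trans (ha _); rewrite le_eqVlt; apply/orP; left; apply/eqP; congr nrm.
by apply/funext => d; rewrite fs_sum; apply: eq_bigr => k _.
Qed.

End Amplification.

Section OperatorNorm.
Variables (R : realType) (E : ips R).

(** Boundedness of [P] makes [sup] a true supremum and not a default value. *)
Lemma op_norm_bound (P : E -> E) (x : E) : linear P ->
  (exists2 C, 0 <= C & bnd_by C P) -> nrm (P x) <= op_norm (@nrm R E) P * nrm x.
Proof.
move=> lP [C C0 PC].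
have [x0|x0] := eqVneq (nrm x) 0.
  by move: x0 => /nrm_eq0 ->; rewrite (lin0 lP) nrm0 mulr0.
have xp : 0 < nrm x by rewrite lt_neqAle eq_sym x0 nrm_ge0.
rewrite -ler_pdivrMr// mulrC.
have -> : (nrm x)^-1 * nrm (P x) = nrm (P ((nrm x)^-1%:RC *: x)).
  by rewrite (linZ lP) nrmZr ger0_norm// invr_ge0 ltW.
apply: ub_le_sup.
  exists C => _ [z /= z1 <-]; apply: le_trans (PC z) _; exact: ler_piMr.
exists ((nrm x)^-1%:RC *: x) => //=.
by rewrite nrmZr ger0_norm ?invr_ge0 ?(ltW xp)// mulVf.
Qed.

Lemma op_norm_le_bound (P : E -> E) (c : R) : 0 <= c -> linear P ->
  (forall x, nrm (P x) <= c * nrm x) -> op_norm (@nrm R E) P <= c.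
Proof.
move=> c0 lP Pc; apply: ge_sup.
  by exists (nrm (P 0)); exists 0 => //=; rewrite nrm0.
move=> _ [x /= x1 <-]; apply: le_trans (Pc x) _; exact: ler_piMr.
Qed.

Lemma op_norm_ge0 (P : E -> E) : linear P ->
  (exists2 C, 0 <= C & bnd_by C P) -> 0 <= op_norm (@nrm R E) P.
Proof.
move=> lP [C C0 PC]; apply: ub_le_sup.
  exists C => _ [z /= z1 <-]; apply: le_trans (PC z) _; exact: ler_piMr.
by exists 0; rewrite /= ?nrm0// (lin0 lP) nrm0.
Qed.

End OperatorNorm.

Section Pencil.
Variables (R : realType) (V D : nat).
Local Notation C := R[i].
Variable A : 'I_V.+1 -> 'M[C]_D.

Definition ipencil (E : ips R) (x : 'I_V -> E -> E) (xi : ips_tuple E D) : ips_tuple E D :=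
  fun i => \sum_(k < D) A ord0 i k *: xi k +
    \sum_(v < V) \sum_(k < D) A (lift ord0 v) i k *: x v (xi k).

Lemma ipencil_multi (T : finType) (r : C) (E : ips R) (O : option ('I_V * T) -> E -> E) :
  O None = id -> (forall al, linear (O al)) ->
  ipencil (fun v xi => r *: \sum_t O (Some (v, t)) xi) =
  multi_pencil (fun al i k => if al is Some vt then r * A (lift ord0 vt.1) i k else A ord0 i k) O.
Proof.
move=> O0 Ol; apply/funext => xi; apply/funext => i.
rewrite /multi_pencil sum_option O0; congr (_ + _).
transitivity (\sum_(v : 'I_V) \sum_t \sum_k (r * A (lift ord0 v) i k) *: O (Some (v, t)) (xi k));
  last by rewrite pair_bigA; apply: eq_bigr => -[v t] _.
apply: eq_bigr => v _; rewrite exchange_big; apply: eq_bigr => k _.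
by rewrite scalerA scaler_sumr; apply: eq_bigr => t _; rewrite mulrC.
Qed.

Lemma ipencil_multi1 (E : ips R) (x : 'I_V -> E -> E) :
  ipencil x = multi_pencil (fun al i k => if al is Some v then A (lift ord0 v) i k else A ord0 i k)
    (fun al => if al is Some v then x v else id).
Proof. by apply/funext => xi; apply/funext => i; rewrite /multi_pencil sum_option. Qed.

Section Bounded.
Variables (E : ips R) (x : 'I_V -> E -> E).
Hypothesis x_lin : forall v, linear (x v).

Let opt_lin : forall al : option 'I_V, linear (if al is Some v then x v else id).
Proof. by case. Qed.

Lemma ipencil_linear : linear (ipencil x).
Proof. by rewrite ipencil_multi1; exact: multi_pencil_linear opt_lin. Qed.

Hypothesis x_bnd : forall v, exists2 c : R, 0 <= c & bnd_by c (x v).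

Lemma ipencil_bounded : exists2 c : R, 0 <= c & bnd_by c (ipencil x).
Proof.
rewrite ipencil_multi1; apply: multi_pencil_bounded => -[v|]; first exact: x_bnd.
by exists 1 => // z; rewrite mul1r.
Qed.

End Bounded.

Lemma tuple_norm_hilbert (H : hilbert R) :
  @tuple_norm R H D = @nrm R (ips_tuple (ips_hilbert H) D).
Proof.
apply/funext => xi; rewrite nrm_tuple /tuple_norm.
by congr Num.sqrt; apply: eq_bigr => i _; rewrite nrm_hilbert.
Qed.

Lemma pencil_normE (H : hilbert R) (x : 'I_V -> H -> H) :
  pencil_norm A x = op_norm (@nrm R (ips_tuple (ips_hilbert H) D))
    (ipencil (x : 'I_V -> ips_hilbert H -> ips_hilbert H)).
Proof. by rewrite /pencil_norm tuple_norm_hilbert. Qed.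

Lemma mx_op_norm_bound (a : 'M[C]_D) :
  0 <= mx_op_norm a /\
  forall z : ips_tuple (ips_C R) D,
    nrm ((fun d => \sum_k a d k * z k) : ips_tuple (ips_C R) D) <= mx_op_norm a * nrm z.
Proof.
pose P (z : ips_tuple (ips_C R) D) : ips_tuple (ips_C R) D := fun d => \sum_k a d k * z k.
have lP : linear P.
  move=> k x y; apply/funext => d.
  have -> : (k *: P x + P y) d = k * P x d + P y d by [].
  rewrite /P mulr_sumr -big_split; apply: eq_bigr => i _.
  by rewrite mulrDr !mulrA [a d i * k]mulrC.
have bP : exists2 c : R, 0 <= c & bnd_by c P.
  exists (\sum_d \sum_k complex.Re `|a d k|).
    by apply: sumr_ge0 => d _; apply: sumr_ge0 => k _; exact: Re_norm_ge0.
  move=> z; apply: le_trans (nrm_tuple_le _) _; rewrite mulr_suml; apply: ler_sum => d _.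
  apply: le_trans (@nrm_sum R (ips_C R) _ _ _ _) _; rewrite mulr_suml; apply: ler_sum => k _.
  apply: le_trans (_ : complex.Re `|a d k| * nrm (z k) <= _).
    by rewrite -(@nrmZ R (ips_C R)).
  by apply: ler_wpM2l; [exact: Re_norm_ge0|exact: nrm_tuple_ge].
have tn : @tuple_norm R C D = @nrm R (ips_tuple (ips_C R) D).
  apply/funext => xi; rewrite nrm_tuple /tuple_norm.
  by congr Num.sqrt; apply: eq_bigr => i _; rewrite nrm_C.
rewrite /mx_op_norm tn; split; first exact: (op_norm_ge0 lP bP).
by move=> z; exact: (op_norm_bound z lP bP).
Qed.

End Pencil.

(** * Comparison of the two pencil norms *)

Section Comparison.
Variables (R : realType) (L V T : nat) (M : R) (K : 'I_V -> {set 'I_L}).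
Hypothesis K_neq0 : forall v, K v != finset.set0.
Hypothesis T_gt0 : (0 < T)%N.
Hypothesis L_gt0 : (0 < L)%N.
Variables (G : graph_fock R (hayes_graph K)) (S : hayes_model R T K).
Variables (D : nat) (A : 'I_V.+1 -> 'M[R[i]]_D).
Hypothesis AM : Lambda A <= M.
Local Notation C := R[i].
Local Notation J := ('I_V * 'I_T)%type.
Local Notation X := {ffun 'I_L -> seq J}.
Local Notation XI := (ips_fs R X).
Local Notation WI := (ips_hilbert (ht_space (hm_W S))).
Local Notation HI := (ips_hilbert (gf_space G)).

Definition fock_field v : XI -> XI := fun f => hcreate K v f + hannih K v f.

Lemma hayes_norm_transfer (c : R) : 0 <= c ->
  (forall xi, nrm (ipencil A (hayes_op S : 'I_V -> WI -> WI) xi) <= c * nrm xi) <->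
  (forall xi, nrm (ipencil A (@fock_hayes R L V T K : 'I_V -> XI -> XI) xi) <= c * nrm xi).
Proof.
move=> c0; pose KJ (vt : J) := K vt.1.
pose term (vt : J) := hm_term S vt.1 vt.2.
have tP (vt : J) : is_tensor_op (fun j => if j \in KJ vt then hm_s S vt.1 vt.2 (j := j) else idfun) (term vt).
  exact: hm_termP.
have lt := term_opt_linear tP.
have lf := @fock_opt_linear R L _ KJ.
have -> : (hayes_op S : 'I_V -> WI -> WI) =
   fun v xi => rsqrt R T *: \sum_t term_opt term (Some (v, t)) xi by [].
have -> : (@fock_hayes R L V T K : 'I_V -> XI -> XI) =
   fun v xi => rsqrt R T *: \sum_t (fock_opt KJ (Some (v, t)) xi : XI) by [].
rewrite (ipencil_multi A _ erefl lt) (ipencil_multi A _ erefl lf).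
exact: (norm_transfer (fun vt j => @hm_semicircular _ _ _ _ _ S vt.1 vt.2 j)
  (@hm_free _ _ _ _ _ S) tP _ c0).
Qed.

Lemma nrm_tuple_contraction (f : XI -> XI) (xi : ips_tuple XI D) : bnd_by 1 f ->
  nrm ((fun k => f (xi k)) : ips_tuple XI D) <= nrm xi.
Proof.
move=> f1; rewrite -(ler_pXn2r (n := 2)) ?nnegrE ?nrm_ge0// !sqr_nrm_tuple.
apply: ler_sum => i _; rewrite ler_pXn2r ?nnegrE ?nrm_ge0//.
by have := f1 (xi i); rewrite mul1r.
Qed.

(** The constant terms and the fields cancel. What remains is, for each v, at most 2^L - 2 mixed
    contractions amplified by A_v, and the norms of the A_v add up to at most M. *)
Lemma mixed_bound (xi : ips_tuple XI D) :
  nrm (ipencil A (@fock_hayes R L V T K : 'I_V -> XI -> XI) xi - ipencil A fock_field xi) <=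
  (2 ^+ L - 2) * M / Num.sqrt T%:R * nrm xi.
Proof.
pose e (v : 'I_V) (B : {set 'I_L}) : ips_tuple XI D :=
  fun d => \sum_k A (lift ord0 v) d k *: (mixed K v B (xi k) : XI).
have -> : ipencil A (@fock_hayes R L V T K : 'I_V -> XI -> XI) xi - ipencil A fock_field xi =
    rsqrt R T *: \sum_v \sum_(B | mixed_sets K v B) e v B.
  apply/funext => d.
  have tsum (I : Type) (r : seq I) (P : pred I) (F : I -> ips_tuple XI D) :
    (\sum_(i <- r | P i) F i) d = \sum_(i <- r | P i) F i d.
    exact: (big_morph (fun y : ips_tuple XI D => y d)).
  transitivity (rsqrt R T *: \sum_v \sum_(B | mixed_sets K v B) e v B d); last first.
    have -> (k : C) (y : ips_tuple XI D) : (k *: y) d = k *: y d by [].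
    by rewrite tsum; congr (_ *: _); apply: eq_bigr => v _; rewrite tsum.
  transitivity (ipencil A (@fock_hayes R L V T K : 'I_V -> XI -> XI) xi d - ipencil A fock_field xi d);
    first by [].
  rewrite /ipencil opprD addrACA subrr add0r -sumrB scaler_sumr.
  apply: eq_bigr => v _; rewrite -sumrB exchange_big scaler_sumr; apply: eq_bigr => k _.
  rewrite -scalerBr fock_hayesE// -/(fock_field v (xi k)) addrC addKr.
  by rewrite -scaler_sumr !scalerA mulrC.
have sq0 : 0 <= (Num.sqrt T%:R)^-1 :> R by rewrite invr_ge0 sqrtr_ge0.
rewrite nrmZr ger0_norm// mulrAC mulrC; apply: ler_wpM2r => //.
have n0 := nrm_ge0 xi.
have eb v B : mixed_sets K v B -> nrm (e v B) <= mx_op_norm (A (lift ord0 v)) * nrm xi.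
  move=> /mixed_setsP[B0 KB0]; have [a0 ha] := mx_op_norm_bound (A (lift ord0 v)).
  apply: le_trans (amplification_bound a0 ha ((fun k => mixed K v B (xi k)) : ips_tuple XI D)) _.
  by apply: ler_wpM2l => //; apply: nrm_tuple_contraction; exact: mixed_contraction.
have gns_ip : 0 <= 2 ^+ L - 2 :> R.
  rewrite subr_ge0 -[X in X <= _]expr1; apply: ler_weXn2l => //; lra.
apply: le_trans (nrm_sum _ _ _) _.
apply: (@le_trans _ _ (\sum_(v < V) (2 ^+ L - 2) * (mx_op_norm (A (lift ord0 v)) * nrm xi))).
  apply: ler_sum => v _; apply: le_trans (nrm_sum _ _ _) _.
  apply: (@le_trans _ _ (\sum_(B | mixed_sets K v B) mx_op_norm (A (lift ord0 v)) * nrm xi)).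
    by apply: ler_sum => B; exact: eb.
  rewrite sumr_const -[_ *+ _]mulr_natl; apply: ler_wpM2r.
    by rewrite mulr_ge0//; have [] := mx_op_norm_bound (A (lift ord0 v)).
  have := card_mixed_sets (K_neq0 v); rewrite -(ler_nat R) => /le_trans; apply.
  by rewrite natrB ?natrX// -[X in (X <= _)%N]expn1 leq_exp2l.
rewrite -mulr_sumr -mulr_suml mulrA; apply: ler_wpM2r => //; apply: ler_wpM2l => //.
apply: le_trans AM; rewrite /Lambda big_ord_recl lerDr.
by have [] := mx_op_norm_bound (A ord0).
Qed.

Local Notation corr := (@corr R L V T K G).

Lemma corr_pencil s (xi : ips_tuple XI D) (psi : 'I_D -> X -> HI) d :
  (forall k, corr s (xi k) (psi k)) ->
  corr s (ipencil A fock_field xi d)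
    (fun p => ipencil A (graph_op G : 'I_V -> HI -> HI) (fun k => psi k p) d).
Proof.
move=> h; apply: corrD.
  by apply: corr_sum => k; exact: corrZ.
apply: corr_sum => v; apply: corr_sum => k; apply: corrZ; exact: (corr_op K_neq0 T_gt0).
Qed.

Lemma corr_nrm s (xi : ips_tuple XI D) (psi : 'I_D -> X -> HI) : uniq s ->
  (forall k, corr s (xi k) (psi k)) ->
  nrm xi ^+ 2 = \sum_(p <- s) nrm ((fun k => psi k p) : ips_tuple HI D) ^+ 2.
Proof.
move=> us h; apply: (@complexI R); rewrite -ip_nrm rmorph_sum.
transitivity (\sum_d \sum_(p <- s) ip (psi d p) (psi d p)).
  by apply: eq_bigr => d _; exact: (corr_ip K_neq0 T_gt0 us (h d) (h d)).
rewrite exchange_big; apply: eq_bigr => p _.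
exact: (@ip_nrm R (ips_tuple HI D) (fun k => psi k p)).
Qed.

(** One direction decomposes a Fock vector and sums the squared graph bounds over the multiplicity
    coordinates. The other uses the copy of the graph space at the single coordinate [vacuum], and
    then density. *)
Lemma graph_norm_transfer (c : R) : 0 <= c ->
  (forall xi, nrm (ipencil A (graph_op G : 'I_V -> HI -> HI) xi) <= c * nrm xi) <->
  (forall xi, nrm (ipencil A fock_field xi) <= c * nrm xi).
Proof.
move=> c0; split=> h.
  move=> xi; have [s Hs] := choice (fun d => corr_ex K_neq0 T_gt0 G (xi d)).
  have [psi Hpsi] := choice Hs.
  pose s' := undup (flatten [seq s d | d <- enum 'I_D]).
  have us : uniq s' by exact: undup_uniq.
  have cs d : corr s' (xi d) (psi d).
    apply: corr_mono (Hpsi d) => p ps; rewrite mem_undup; apply/flattenP; exists (s d) => //.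
    by apply: map_f; rewrite mem_enum.
  rewrite -(ler_pXn2r (n := 2)) ?nnegrE ?mulr_ge0 ?nrm_ge0// exprMn.
  rewrite (corr_nrm us cs) (corr_nrm us (fun d => corr_pencil d cs)).
  rewrite mulr_sumr; apply: ler_sum => p _.
  by rewrite -exprMn ler_pXn2r ?nnegrE ?mulr_ge0 ?nrm_ge0.
have lP := @ipencil_linear R V D A HI (graph_op G) (@graph_op_linear R V _ G).
have bP := @ipencil_bounded R V D A HI (graph_op G) (graph_op_bounded G).
have dS := @tuple_dense R HI _ D (hilbert_dense (@l2_total _ _ (gf_space G))).
apply: (dense_bound c0 lP bP dS) => z zS.
have [xi Hxi] := choice (fun d => @corr_span R L V T K K_neq0 G _ (zS d)).
have cp d := corr_pencil d Hxi.
rewrite -(ler_pXn2r (n := 2)) ?nnegrE ?mulr_ge0 ?nrm_ge0// exprMn.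
have us : uniq [:: @vacuum L V T] by [].
have : nrm (ipencil A fock_field xi) ^+ 2 <= c ^+ 2 * nrm (xi : ips_tuple XI D) ^+ 2.
  by rewrite -exprMn ler_pXn2r ?nnegrE ?mulr_ge0 ?nrm_ge0.
rewrite (corr_nrm us Hxi) (corr_nrm us cp) !big_seq1.
have -> : (fun k => if @vacuum L V T == @vacuum L V T then z k else 0) = z.
  by apply/funext => k; rewrite eqxx.
by [].
Qed.

Lemma hayes_op_linear v : linear (hayes_op S v : WI -> WI).
Proof.
move=> k x y; rewrite /hayes_op scalerA mulrC -scalerA -scalerDr; congr (_ *: _).
rewrite scaler_sumr -big_split; apply: eq_bigr => t _.
by have [[l _] _] := hm_termP S v t; exact: l.
Qed.

Lemma hayes_op_bounded v : exists2 c : R, 0 <= c & @bnd_by R WI c (hayes_op S v).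
Proof.
have h t : exists c : R, 0 <= c /\ @bnd_by R WI c (hm_term S v t).
  have [[_ [c hc]] _] := hm_termP S v t; exists `|c|; split=> // x; rewrite !nrm_hilbert.
  apply: le_trans (hc x) _; apply: ler_wpM2r; last exact: ler_norm.
  by rewrite -nrm_hilbert nrm_ge0.
have [c hc] := choice h.
exists ((Num.sqrt T%:R)^-1 * \sum_t c t).
  by rewrite mulr_ge0 ?invr_ge0 ?sqrtr_ge0// sumr_ge0// => t _; have [] := hc t.
move=> x; rewrite /hayes_op (@nrmZr R WI) ger0_norm ?invr_ge0 ?sqrtr_ge0// -mulrA.
apply: ler_wpM2l; first by rewrite invr_ge0 sqrtr_ge0.
apply: le_trans (@nrm_sum R WI _ _ _ _) _; rewrite mulr_suml; apply: ler_sum => t _.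
by have [] := hc t.
Qed.

(** Each pencil's own norm is carried to the Fock space as a bound, enlarged by [eps] to cover the
    other Fock pencil, and carried back as a bound for the other norm. *)
Theorem pencil_norm_comparison :
  `|pencil_norm A (hayes_op S) - pencil_norm A (graph_op G)| <=
  (2 ^+ L - 2) * M / Num.sqrt T%:R.
Proof.
rewrite !pencil_normE; set eps := _ / _.
have lS := @ipencil_linear R V D A WI (hayes_op S) hayes_op_linear.
have bS := @ipencil_bounded R V D A WI (hayes_op S) hayes_op_bounded.
have lG := @ipencil_linear R V D A HI (graph_op G) (@graph_op_linear R V _ G).
have bG := @ipencil_bounded R V D A HI (graph_op G) (graph_op_bounded G).
set NS := op_norm _ _; set NG := op_norm _ _.
have NS0 : 0 <= NS by exact: (op_norm_ge0 lS bS).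
have NG0 : 0 <= NG by exact: (op_norm_ge0 lG bG).
have M0 : 0 <= M.
  apply: le_trans AM; apply: sumr_ge0 => v _; by have [] := mx_op_norm_bound (A v).
have eps0 : 0 <= eps.
  rewrite divr_ge0 ?sqrtr_ge0// mulr_ge0//.
  rewrite subr_ge0 -[X in X <= _]expr1; apply: ler_weXn2l => //; lra.
have hS := (hayes_norm_transfer NS0).1 (fun xi => op_norm_bound xi lS bS).
have hG := (graph_norm_transfer NG0).1 (fun xi => op_norm_bound xi lG bG).
have mb := mixed_bound.
rewrite ler_norml; apply/andP; split.
  rewrite lerNl opprB lerBlDr addrC; apply: op_norm_le_bound => //; first exact: addr_ge0.
  apply/graph_norm_transfer; first exact: addr_ge0.
  move=> xi; rewrite -(subrK (ipencil A (@fock_hayes R L V T K : 'I_V -> XI -> XI) xi)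
    (ipencil A fock_field xi)).
  apply: le_trans (nrm_triangle _ _) _; rewrite mulrDl addrC; apply: lerD; first exact: hS.
  by rewrite nrmB.
rewrite lerBlDr addrC; apply: op_norm_le_bound => //; first exact: addr_ge0.
apply/hayes_norm_transfer; first exact: addr_ge0.
move=> xi; rewrite -(subrK (ipencil A fock_field xi)
  (ipencil A (@fock_hayes R L V T K : 'I_V -> XI -> XI) xi)).
apply: le_trans (nrm_triangle _ _) _; rewrite mulrDl addrC; apply: lerD; first exact: hG.
exact: mb.
Qed.

End Comparison.

(** The zero matrices of size 1 are admissible, so the supremum is over a nonempty set and is not
    -oo. *)
Lemma Delta_ge0 (R : realType) (L V T : nat) (K : 'I_V -> {set 'I_L}) (M : R)
  (S : hayes_model R T K) (G : graph_fock R (hayes_graph K)) :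
  0 <= M -> (0 <= Delta M S G)%E.
Proof.
move=> M0; pose A (_ : 'I_V.+1) : 'M[R[i]]_1 := 0.
apply: (@le_trans _ _
  (`|pencil_norm A (hayes_op S) - pencil_norm A (graph_op G)|)%:E); first by rewrite lee_fin.
apply: ereal_sup_ubound; exists 1%N, A; split=> //.
  by move=> v; apply/is_hermitianmxP; rewrite /A trmx0 map_mx0 scaler0.
have A0 : mx_op_norm (0 : 'M[R[i]]_1) <= 0.
  apply: ge_sup.
    exists (@tuple_norm R R[i] 1 (fun=> 0)); exists (fun=> 0) => /=.
      rewrite /tuple_norm big1 ?sqrtr0// => i _.
      by rewrite /rnorm normr0 expr0n.
    by congr tuple_norm; apply/funext => i; rewrite big1// => k _; rewrite mulr0.
  move=> _ [x _ <-]; rewrite /tuple_norm big1 ?sqrtr0// => i _.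
  by rewrite big1 ?/rnorm ?normr0 ?expr0n// => k _; rewrite mxE mul0r.
rewrite /Lambda; apply: le_trans M0; apply: sumr_le0 => v _; exact: A0.
Qed.

Lemma div_sqrt_cvg0 (R : realType) (c : R) : 0 <= c ->
  (c / Num.sqrt T%:R) @[T --> \oo] --> (0 : R).
Proof.
move=> c0; apply/cvgrPdist_le => e e0.
exists (Num.bound ((c / e) ^+ 2)).+1 => // T /= NT.
have ce0 : 0 <= c / e by rewrite divr_ge0// ltW.
have h : c / e <= Num.sqrt T%:R.
  rewrite -[leLHS]ger0_norm// -sqrtr_sqr ler_sqrt ?ler0n//.
  apply: le_trans (ltW (archi_boundP (sqr_ge0 _))) _; rewrite ler_nat; exact: ltnW.
have T0 : 0 < Num.sqrt T%:R :> R by rewrite sqrtr_gt0 ltr0n; apply: leq_trans NT.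
rewrite sub0r normrN ger0_norm ?divr_ge0 ?sqrtr_ge0//.
by rewrite ler_pdivrMr// mulrC -ler_pdivrMr.
Qed.

Theorem lemma6p2 (R : realType) (L V : nat) (M : R) (K : 'I_V -> {set 'I_L})
    (L_ge1 : (1 <= L)%N) (V_ge1 : (1 <= V)%N) (M_ge1 : 1 <= M)
    (K_neq0 : forall v, K v != finset.set0)
    (G : graph_fock R (hayes_graph K))
    (S : forall T : nat, hayes_model R T K) :
  (forall T : nat, (1 <= T)%N ->
     (Delta M (S T) G <= ((2 ^+ L - 2) * M / Num.sqrt T%:R)%:E)%E) /\
  (Delta M (S T) G @[T --> \oo] --> 0%E).
Proof.
have M0 : 0 <= M by exact: le_trans ler01 M_ge1.
have bound T : (1 <= T)%N -> (Delta M (S T) G <= ((2 ^+ L - 2) * M / Num.sqrt T%:R)%:E)%E.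
  move=> T1; apply: ge_ereal_sup => _ [D [A [_ _ AM ->]]].
  by rewrite lee_fin; exact: pencil_norm_comparison.
split=> //.
have C0 : 0 <= (2 ^+ L - 2) * M.
  rewrite mulr_ge0// subr_ge0 -[X in X <= _]expr1; apply: ler_weXn2l => //; lra.
apply: (@squeeze_cvge _ _ _ _ (cst 0%E) _ (fun T => ((2 ^+ L - 2) * M / Num.sqrt T%:R)%:E)).
(* The upper bound is available from T = 1 on, which is enough for the limit. *)
- exists 1%N => // T /= T1; apply/andP; split; [exact: Delta_ge0|exact: bound].
- exact: cvg_cst.
- by apply: cvg_EFin; [near=> T|exact: div_sqrt_cvg0].
Unshelve. all: by end_near.
Qed.
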